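(* Let $n\ge1$ be an integer, let $H>0$ with $2H\neq n$, and let $f$ satisfy assumption $\mathbf{A}(H)$. For every positive function $\lambda$ on $(0,+\infty)$ such that $\lambda(\rho)\rho^{n-2H}\to+\infty$ as $\rho\to+\infty$, the limit $$\left\{\frac{X_\rho(\mu)-\mathbb{E}(X_\rho(\mu))}{\sqrt{\lambda(\rho)\rho^{n-2H}}}\,;\ \mu\in\mathcal{M}^H\right\}\ \underset{\rho\to+\infty}{\longrightarrow}\ \left\{W_H(\mu)\,;\ \mu\in\mathcal{M}^H\right\}$$ holds in the sense of finite dimensional distributions of the random functionals, where $W_H$ is the centered Gaussian random linear functional on $\mathcal{M}^H$ with $$\mathrm{Cov}\left(W_H(\mu),W_H(\nu)\right)=\int_{\mathbb{S}_n\times\mathbb{S}_n}K_H(d(z,z'))\,\mu(\mathrm{d}z)\,\nu(\mathrm{d}z'),\qquad \mu,\nu\in\mathcal{M}^H .$$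
   Context: $\mathbb{S}_n=\{(x_i)_{1\le i\le n+1}\in\mathbb{R}^{n+1}:\sum_i x_i^2=1\}$ is the $n$-dimensional unit sphere, $\sigma$ is its surface measure, and $d(x,y)\in[0,\pi]$ is the geodesic distance on $\mathbb{S}_n$ (the non-oriented angle between the vectors $x$ and $y$). For $x\in\mathbb{S}_n$ and $r\ge0$, $B(x,r)=\{y\in\mathbb{S}_n: d(x,y)\le r\}$. $\mathbb{R}^+=[0,+\infty)$. Assumption $\mathbf{A}(H)$ on a nonnegative measurable function $f$ on $\mathbb{R}^+$: the (closed) support of $f$ is contained in $[0,\pi)$; $f$ is bounded on any compact subset of $(0,\pi)$; and $f(r)\sim r^{-n-1+2H}$ as $r\to0^+$. $\mathcal{M}$ is the space of signed measures on $\mathbb{S}_n$ with finite total variation; $\mathcal{M}^H=\mathcal{M}$ if $2H<n$, and $\mathcal{M}^H=\{\mu\in\mathcal{M}:\mu(\mathbb{S}_n)=0\}$ if $2H>n$. For $\rho>0$, $N_\rho$ is a Poisson random measure on $\mathbb{S}_n\times\mathbb{R}^+$ with intensity $\lambda(\rho)\,\rho^{-1}f(\rho^{-1}r)\,\sigma(\mathrm{d}x)\,\mathrm{d}r$, and for $\mu\in\mathcal{M}$, $$X_\rho(\mu)=\int_{\mathbb{S}_n\times\mathbb{R}^+}\mu(B(x,r))\,N_\rho(\mathrm{d}x,\mathrm{d}r).$$ The function $\psi:[0,\pi]\times\mathbb{R}^+\to\mathbb{R}^+$ is defined by $\psi(d(z,z'),r)=\int_{\mathbb{S}_n}\mathbf{1}_{d(x,z)<r}\,\mathbf{1}_{d(x,z')<r}\,\sigma(\mathrm{d}x)$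 for $z,z'\in\mathbb{S}_n$, $r\in\mathbb{R}^+$ (the right-hand side depends on $z,z'$ only through $d(z,z')$). Set $\psi^{(H)}=\psi$ if $0<2H<n$ and $\psi^{(H)}=\psi-\sigma(\mathbb{S}_n)$ if $2H>n$, and $$K_H(u)=\int_{\mathbb{R}^+}\psi^{(H)}(u,r)\,r^{-n-1+2H}\,\mathrm{d}r,\qquad u\in[0,\pi],$$ the integral being absolutely convergent. Convergence in the sense of finite dimensional distributions means that for all $k\ge1$ and $\mu_1,\dots,\mu_k\in\mathcal{M}^H$ the corresponding $k$-dimensional random vectors converge in distribution. *)

(* Defs.v *)
From HB Require Import structures.
From mathcomp Require Import all_boot all_order all_algebra.
From mathcomp Require Import all_classical all_reals all_analysis.
From mathcomp Require Import measurable_realfun.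

Set Implicit Arguments.
Unset Strict Implicit.
Unset Printing Implicit Defensive.

Import Order.TTheory GRing.Theory Num.Theory.
Import numFieldNormedType.Exports.

Local Open Scope classical_set_scope.
Local Open Scope ring_scope.

Section lebesgue_tuple.
Context {R : realType}.

Definition tuple_cons n (p : n.-tuple R * R) : n.+1.-tuple R :=
  [tuple of p.2 :: p.1].

Lemma measurable_tuple_cons n : measurable_fun setT (@tuple_cons n).
Proof. exact: (measurable_cons (f := snd) (g := fst)). Qed.

Definition lebesgue_tuple_step n (m : {measure set (n.-tuple R) -> \bar R}) :
    set (n.+1.-tuple R) -> \bar R :=
  pushforward (m \x @lebesgue_measure R)%E (@tuple_cons n).

HB.instance Definition _ n (m : {measure set (n.-tuple R) -> \bar R}) :=
  Measure.copy (lebesgue_tuple_step m)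
    (measure_function_pushforward__canonical__measure_function_Measure
       (m \x @lebesgue_measure R)%E (@measurable_tuple_cons n)).

(** Lebesgue measure on R^n, as an iterated product. *)
Fixpoint lebesgue_tuple (n : nat) : {measure set (n.-tuple R) -> \bar R} :=
  match n with
  | 0 => dirac [tuple]
  | n'.+1 => lebesgue_tuple_step (lebesgue_tuple n')
  end.

End lebesgue_tuple.

Definition sphere (R : realType) (n : nat) :=
  {x : n.+1.-tuple R | \sum_(i < n.+1) tnth x i ^+ 2 == 1}.

Section sphere_measurable.
Context {R : realType} {n : nat}.

Let pole_tuple : n.+1.-tuple R := [tuple (i == ord0)%:R | i < n.+1].

Let pole_subproof : \sum_(i < n.+1) tnth pole_tuple i ^+ 2 == 1.
Proof.
rewrite big_ord_recl big1 ?tnth_mktuple ?eqxx ?expr1n ?addr0// => i _.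
by rewrite tnth_mktuple (_ : _ == _ = false) ?expr0n.
Qed.

Definition sphere_pole : sphere R n := exist _ pole_tuple pole_subproof.

HB.instance Definition _ := Choice.on (sphere R n).
HB.instance Definition _ := isPointed.Build (sphere R n) sphere_pole.

(** Borel sets of R^(n+1) (the product sigma-algebra) intersected with the
    sphere. *)
Definition sphere_measurable : set (set (sphere R n)) :=
  preimage_set_system setT (fun x : sphere R n => val x) measurable.

Let sphere_sigma_algebra : sigma_algebra setT sphere_measurable.
Proof.
apply: sigma_algebra_preimage.
exact: sigma_algebra_measurable.
Qed.

Let sphere_measurable0 : sphere_measurable set0.
Proof. by case: sphere_sigma_algebra. Qed.

Let sphere_measurableC A : sphere_measurable A -> sphere_measurable (~` A).
Proof. by case: sphere_sigma_algebra => _ + _; rewrite -setTD; exact. Qed.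

Let sphere_measurable_bigcup (F : (set (sphere R n))^nat) :
  (forall i, sphere_measurable (F i)) -> sphere_measurable (\bigcup_i F i).
Proof. by case: sphere_sigma_algebra => _ _; exact. Qed.

HB.instance Definition _ := @isMeasurable.Build default_measure_display
  (sphere R n) sphere_measurable
  sphere_measurable0 sphere_measurableC sphere_measurable_bigcup.

End sphere_measurable.

(** In polar coordinates the cone over [A] has volume [sigma A] times the
    integral of [t ^+ n] over [[0, 1]], i.e. [sigma A / (n + 1)]. *)

Section surface_measure.
Context {R : realType} {n : nat}.

Definition cone (A : set (sphere R n)) : set (n.+1.-tuple R) :=
  [set x | exists t y, [/\ 0 < t <= 1, A y &
                           x = [tuple t * tnth (val y) i | i < n.+1]]].

Definition surface_measure (A : set (sphere R n)) : \bar R :=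
  (n.+1%:R%:E * lebesgue_tuple n.+1 (cone A))%E.

Let sqnorm (x : n.+1.-tuple R) := \sum_(i < n.+1) tnth x i ^+ 2.

Let normalize (x : n.+1.-tuple R) : n.+1.-tuple R :=
  [tuple tnth x i / Num.sqrt (sqnorm x) | i < n.+1].

Let measurable_sqnorm : measurable_fun setT sqnorm.
Proof.
apply: measurable_sum => i; apply: measurable_funX; exact: measurable_tnth.
Qed.

Let measurable_normalize : measurable_fun setT normalize.
Proof.
apply/measurable_fun_tnthP => i.
rewrite (_ : _ \o _ = fun x => tnth x i * (sqnorm x) `^ (- (2^-1))); last first.
  by apply/funext => x /=; rewrite tnth_mktuple powRN powR12_sqrt// sumr_ge0// => j _; rewrite sqr_ge0.
apply: measurable_funM; first exact: measurable_tnth.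
exact: (measurableT_comp (measurable_powR _)).
Qed.

Let sqnormZ t (y : n.+1.-tuple R) :
  sqnorm [tuple t * tnth y i | i < n.+1] = t ^+ 2 * sqnorm y.
Proof.
rewrite /sqnorm mulr_sumr; apply: eq_bigr => i _.
by rewrite tnth_mktuple exprMn.
Qed.

Let sqnorm_sphere (y : sphere R n) : sqnorm (val y) = 1.
Proof. exact/eqP/(valP y). Qed.

Let coneE (A : set (sphere R n)) (B : set (n.+1.-tuple R)) :
  A = (fun x : sphere R n => val x) @^-1` B ->
  cone A = (sqnorm @^-1` `]0, 1]) `&` (normalize @^-1` B).
Proof.
move=> ->; apply/seteqP; split=> x.
  move=> [t [y [/andP[t0 t1] By ->]]]; split => /=.
    rewrite in_itv/= sqnormZ sqnorm_sphere mulr1 exprn_gt0//=.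
    by rewrite expr_le1// ltW.
  rewrite /normalize sqnormZ sqnorm_sphere mulr1 sqrtr_sqr gtr0_norm//.
  set u := (X in B X); suff -> : u = val y by [].
  apply: eq_from_tnth => i.
  by rewrite !tnth_mktuple mulrAC mulfV ?gt_eqF// mul1r.
move=> [/=]; rewrite in_itv/= => /andP[x0 x1] Bx.
have s0 : 0 < Num.sqrt (sqnorm x) by rewrite sqrtr_gt0.
have yS : \sum_(i < n.+1) tnth (normalize x) i ^+ 2 == 1.
  under eq_bigr do rewrite tnth_mktuple exprMn exprVn sqr_sqrtr ?(ltW x0)//.
  by rewrite -mulr_suml mulfV// gt_eqF.
exists (Num.sqrt (sqnorm x)), (exist _ (normalize x) yS); split => //.
  by rewrite s0/= -(sqrtr1 R) ler_wsqrtr.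
apply: eq_from_tnth => i.
by rewrite !tnth_mktuple mulrC divfK// gt_eqF.
Qed.

Let measurable_cone A : measurable A -> measurable (cone A).
Proof.
move=> [B mB]; rewrite setTI => /esym/coneE ->.
apply: measurableI; rewrite -[X in measurable X]setTI.
  exact: measurable_sqnorm.
exact: measurable_normalize.
Qed.

Let cone_bigcup (F : (set (sphere R n))^nat) :
  cone (\bigcup_i F i) = \bigcup_i cone (F i).
Proof.
apply/seteqP; split=> x.
  by move=> [t [y [t01 [i _ Fy] ->]]]; exists i => //; exists t, y.
by move=> [i _ [t [y [t01 Fy ->]]]]; exists t, y; split => //; exists i.
Qed.

Let cone_disjoint (A B : set (sphere R n)) :
  A `&` B = set0 -> cone A `&` cone B = set0.
Proof.
move=> AB; apply/seteqP; split=> // x.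
move=> [[t [y [/andP[t0 _] Ay ->]]] [s [z [/andP[s0 _] Bz]]]] yz.
have ts : t = s.
  have := congr1 sqnorm yz; rewrite !sqnormZ !sqnorm_sphere.
  by rewrite !mulr1 => /eqP; rewrite eqrXn2// ?ltW// => /eqP.
suff : (A `&` B) y by rewrite AB.
split => //; rewrite (_ : y = z)//; apply/val_inj/eq_from_tnth => i.
have := congr1 (fun u => tnth u i) yz; rewrite !tnth_mktuple -ts.
by apply: mulfI; rewrite gt_eqF.
Qed.

Let surface_measure0 : surface_measure set0 = 0%E.
Proof.
rewrite /surface_measure (_ : cone set0 = set0) ?measure0 ?mule0//.
by apply/seteqP; split=> // x [t [y []]].
Qed.

Let surface_measure_ge0 A : (0 <= surface_measure A)%E.
Proof. by rewrite mule_ge0// lee_fin. Qed.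

Let surface_measure_sigma_additive : semi_sigma_additive surface_measure.
Proof.
move=> F mF tF mUF; rewrite /surface_measure cone_bigcup.
apply: (@measure_semi_sigma_additive _ _ _
  (mscale (n.+1%:R)%:nng (lebesgue_tuple n.+1)) (fun i => cone (F i))).
- by move=> i; apply: measurable_cone; exact: mF.
- apply/trivIsetP => i j _ _ ij; apply: cone_disjoint.
  by move/trivIsetP : tF; exact.
- by apply: bigcupT_measurable => i; apply: measurable_cone; exact: mF.
Qed.

HB.instance Definition _ := isMeasure.Build _ _ _ surface_measure
  surface_measure0 surface_measure_ge0 surface_measure_sigma_additive.

End surface_measure.

Section geometry.
Context {R : realType} {n : nat}.
Implicit Types (x y z : sphere R n) (u r : R).

Definition geodist x y : R :=
  acos (\sum_(i < n.+1) tnth (val x) i * tnth (val y) i).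

Definition geoball x r : set (sphere R n) := [set y | geodist x y <= r].

(** The function [psi] of the distance: by rotation invariance of the surface
    measure the integral only depends on [z], [z'] through [geodist z z'], and
    every [u] in [[0, pi]] is such a distance as soon as [1 <= n], so that the
    set below is then a singleton. *)
Definition psi u r : R :=
  xget 0 [set v | exists z z', geodist z z' = u /\
    v = \int[@surface_measure R n]_x
          (\1_[set y | geodist y z < r] x * \1_[set y | geodist y z' < r] x)].

(** To be used with [2 * H != n%:R]. *)
Definition psiH (H : R) u r : R :=
  if 2 * H < n%:R then psi u r
  else psi u r - fine (@surface_measure R n setT).

Definition KH (H : R) u : R :=
  \int[@lebesgue_measure R]_(r in `[0, +oo[)
    (psiH H u r * r `^ (2 * H - n%:R - 1)).

End geometry.

Arguments psi {R} n u r.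
Arguments psiH {R} n H u r.
Arguments KH {R} n H u.

Section charge_integral.
Context d (T : measurableType d) (R : realType).
Implicit Types mu nu : {charge set T -> \bar R}.

Lemma hahn_sets_ex mu :
  exists PN : set T * set T, hahn_decomposition mu PN.1 PN.2.
Proof. by have [P [N PN]] := Hahn_decomposition mu; exists (P, N). Qed.

Definition hahn_sets mu := cid (hahn_sets_ex mu).

Definition charge_pos mu : {finite_measure set T -> \bar R} :=
  jordan_pos (projT2 (hahn_sets mu)).

Definition charge_neg mu : {finite_measure set T -> \bar R} :=
  jordan_neg (projT2 (hahn_sets mu)).

(** The product signed measure, expanded with the Jordan decompositions of
    [mu] and [nu]. *)
Definition charge_integral2 mu nu (F : T * T -> R) : R :=
    \int[(charge_pos mu \x charge_pos nu)%E]_p F p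
  - \int[(charge_pos mu \x charge_neg nu)%E]_p F p
  - \int[(charge_neg mu \x charge_pos nu)%E]_p F p
  + \int[(charge_neg mu \x charge_neg nu)%E]_p F p.

End charge_integral.

Definition independent_family d d' (Omega : measurableType d)
    (T : measurableType d') (R : realType) (P : probability Omega R)
    (k : nat) (X : 'I_k -> Omega -> T) : Prop :=
  forall B : 'I_k -> set T, (forall i, measurable (B i)) ->
    P [set w | forall i, B i (X i w)] =
    (\prod_(i < k) P [set w | B i (X i w)])%E.

Record poisson_random_measure d d' (Omega : measurableType d)
    (T : measurableType d') (R : realType) (P : probability Omega R)
    (N : R.-ker Omega ~> T) (m : set T -> \bar R) : Prop := {
  prm_fin : forall A, measurable A -> (m A < +oo)%E ->
    forall j : nat, P [set w | N w A = j%:R%:E] =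
      (expR (- fine (m A)) * fine (m A) ^+ j / j`!%:R)%:E ;
  prm_infty : forall A, measurable A -> m A = +oo%E ->
    {ae P, forall w, N w A = +oo%E} ;
  prm_indep : forall (k : nat) (A : 'I_k -> set T),
    (forall i, measurable (A i)) -> trivIset setT A ->
    independent_family P (fun i w => N w (A i)) }.

(** [normal_prob m 0] is the uniform law on [[0, 1]], not the Dirac mass. *)
Definition gaussian_prob (R : realType) (m s : R) : set R -> \bar R :=
  if s == 0 then dirac m else normal_prob m s.

Record centered_gaussian_functional d d' (Omega : measurableType d)
    (T : measurableType d') (R : realType) (P : probability Omega R)
    (D : set (charge T R))
    (C : charge T R -> charge T R -> R)
    (W : charge T R -> {RV P >-> R}) : Prop := {
  cgf_linear : forall (a b : R) (mu nu : charge T R),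
    D mu -> D nu ->
    {ae P, forall w, W (cadd (cscale a mu) (cscale b nu)) w =
                     a * W mu w + b * W nu w} ;
  cgf_gaussian : forall (k : nat) (a : 'I_k -> R)
      (mu : 'I_k -> charge T R), (forall i, D (mu i)) ->
    exists s : R, forall B : set R, measurable B ->
      P [set w | B (\sum_(i < k) a i * W (mu i) w)] = gaussian_prob 0 s B ;
  cgf_cov : forall mu nu : charge T R, D mu -> D nu ->
    covariance P (W mu) (W nu) = (C mu nu)%:E }.

Definition cvg_in_distribution (R : realType) (k : nat)
    (d : R -> measure_display) (Omega : forall rho, measurableType (d rho))
    (P : forall rho, probability (Omega rho) R)
    (Y : forall rho, Omega rho -> 'rV[R]_k)
    d' (Omega' : measurableType d') (P' : probability Omega' R)
    (Z : Omega' -> 'rV[R]_k) : Prop :=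
  forall g : 'rV[R]_k -> R, continuous g ->
    (exists M : R, forall x, `|g x| <= M) ->
    ('E_(P rho)[fun w => g (Y rho w)])%E @[rho --> +oo] -->
    ('E_P'[fun w => g (Z w)])%E.

Definition cvg_fdd (R : realType) (I : Type) (D : set I)
    (d : R -> measure_display) (Omega : forall rho, measurableType (d rho))
    (P : forall rho, probability (Omega rho) R)
    (Y : forall rho, I -> Omega rho -> R)
    d' (Omega' : measurableType d') (P' : probability Omega' R)
    (Z : I -> Omega' -> R) : Prop :=
  forall (k : nat) (mu : 'I_k -> I), (0 < k)%N -> (forall i, D (mu i)) ->
    cvg_in_distribution P (fun rho w => \row_(i < k) Y rho (mu i) w)
      P' (fun w => \row_(i < k) Z (mu i) w).

Record assumptionA (R : realType) (n : nat) (H : R) (f : R -> R) : Prop := {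
  assumptionA_measurable : measurable_fun (`[0, +oo[ : set R) f ;
  assumptionA_ge0 : forall r, 0 <= r -> 0 <= f r ;
  assumptionA_support : closure [set r | 0 <= r /\ f r != 0] `<=` `[0, pi[ ;
  assumptionA_bounded : forall K : set R, compact K -> K `<=` `]0, pi[ ->
    exists M, forall r, K r -> f r <= M ;
  assumptionA_equiv :
    (fun r => f r / r `^ (- n%:R - 1 + 2 * H)) @ 0^'+ --> (1 : R) }.

Section random_balls.
Context {R : realType} {n : nat}.

(** The half-line R^+ of radii is embedded in [R]: the intensity, hence the
    Poisson random measure, puts no mass on [sphere R n * ]-oo, 0[]. *)
Definition ball_intensity (lambda f : R -> R) (rho : R)
    (A : set (sphere R n * R)) : \bar R :=
  (\int[@surface_measure R n \x @lebesgue_measure R]_(p in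
      A `&` (setT `*` `[0%R, +oo[))
    (lambda rho * rho^-1 * f (rho^-1 * p.2))%:E)%E.

Definition ball_functional (N : {measure set (sphere R n * R) -> \bar R})
    (mu : {charge set (sphere R n) -> \bar R}) : R :=
  \int[N]_(p in setT `*` `[0, +oo[) fine (mu (geoball p.1 p.2)).

(** Charges are finite-valued, hence they are exactly the signed measures of
    finite total variation. *)
Definition MH (H : R) : set (charge (sphere R n) R) :=
  [set mu | n%:R < 2 * H -> mu setT = 0%E].

End random_balls.

(* Main.v *)
(** For a Poisson random measure [N] of intensity [m], the law of [int h dN] is
    given by [E exp (i int h dN) = exp (int (exp (i h) - 1) dm)].  With
    [h (x, r) = mu (B (x, r))] and [s ^ 2 = lambda rho * rho ^ (n - 2 H)], the
    centred functional divided by [s] thus has characteristic exponent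
    [int (exp (i h / s) - 1 - i h / s) dm_rho].  The density of [m_rho / s ^ 2]
    converges to [r ^ (2 H - n - 1)] and is dominated by a multiple of it, so that
    the exponent tends to [- 1/2 int mu (B (x, r)) ^ 2 r ^ (2 H - n - 1) dx dr],
    and by Fubini's theorem (together with [mu (S_n) = 0] if [n < 2 H]) this
    integral is the variance of [W_H mu].  The space [M^H] being linear, this gives
    the convergence of the characteristic functions of all finite-dimensional
    marginals; since their second moments are bounded, it is enough to approximate
    continuous bounded functions on large cubes by trigonometric polynomials.
    The kernel [psi] depends on the distance only because reflections preserve the
    surface measure and act transitively on pairs of points at a given distance. *)

From HB Require Import structures.
Require Import Defs.
From mathcomp Require Import all_boot all_order all_algebra.
From mathcomp Require Import all_classical all_reals all_analysis.
From mathcomp Require Import finmap measurable_realfun.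
From mathcomp Require Import ring lra.

Set Implicit Arguments.
Unset Strict Implicit.
Unset Printing Implicit Defensive.

Import Order.TTheory GRing.Theory Num.Theory.
Import numFieldNormedType.Exports.

Local Open Scope classical_set_scope.
Local Open Scope ring_scope.

(** Cosines with an arbitrary phase, [E cos (X + b)], stand in for complex characteristic functions
    throughout. A Poisson random measure is given by probabilities of events only, so its
    exponential formula rests on conditioning on the integer values of [N w A] over disjoint sets,
    and reaches integrable functions through an L1 contraction given by Campbell's formula. The
    second moments are bounded without a variance formula: Fatou's lemma reads the bound off the
    cosine formula. The obstacle to Fubini's theorem is sign. If [n < 2 H], [psi - sigma (S_n)] is
    minus the measure of the complement of an intersection of two balls; up to a sign both cases
    integrate an indicator, and Tonelli's theorem applies. A bound uniform in the two points comes
    from [sigma (B (x, r)) = O (r ^ n)] if [2 H < n], and otherwise from the emptiness of that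
    complement for [r > pi]. The cap estimate also makes [mu (B (x, r))] integrable for the
    intensity, so that the mean exists. Reflections preserve the surface measure since the image of
    Lebesgue measure under a linear isometric involution is translation invariant, hence
    proportional to it. *)

(** * Positive functionals that are integrals *)

Section integral_functional.
Local Open Scope ereal_scope.
Variables (d : measure_display) (T : measurableType d) (R : realType).
Variable nu : {measure set T -> \bar R}.
Variable Phi : (T -> \bar R) -> \bar R.
Hypothesis Phi_indic : forall A, measurable A -> Phi (EFin \o \1_A) = nu A.
Hypothesis PhiD : forall f g, (forall x, 0 <= f x) -> (forall x, 0 <= g x) ->
  measurable_fun setT f -> measurable_fun setT g ->
  Phi (fun x => f x + g x) = Phi f + Phi g.
Hypothesis PhiZ : forall (c : R) f, (0 <= c)%R -> (forall x, 0 <= f x) ->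
  measurable_fun setT f -> Phi (fun x => c%:E * f x) = c%:E * Phi f.
Hypothesis Phi_cvg : forall f_ : (T -> \bar R)^nat,
  (forall n, measurable_fun setT (f_ n)) -> (forall n x, 0 <= f_ n x) ->
  (forall x, nondecreasing_seq (f_ ^~ x)) ->
  Phi (fun x => limn (f_ ^~ x)) = limn (fun n => Phi (f_ n)).

Let Phi_sum I (s : seq I) (F : I -> T -> \bar R) :
  (forall i x, 0 <= F i x) -> (forall i, measurable_fun setT (F i)) ->
  Phi (fun x => \sum_(i <- s) F i x) = \sum_(i <- s) Phi (F i).
Proof.
move=> F0 mF; elim: s => [|i s IH].
  rewrite big_nil; under eq_fun do rewrite big_nil.
  have := @PhiZ 0%R (cst 0) (lexx _) (fun _ => lexx _) (measurable_cst _).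
  by under eq_fun do rewrite mul0e; rewrite mul0e.
rewrite big_cons; under eq_fun do rewrite big_cons.
rewrite PhiD// ?IH//; first by move=> x; exact: sume_ge0.
exact: emeasurable_sum.
Qed.

Import HBNNSimple.

Let Phi_nnsfun (f : {nnsfun T >-> R}) :
  Phi (EFin \o f) = \int[nu]_x (f x)%:E.
Proof.
pose s : seq R := enum_fset (fset_set (range f)).
pose A i := f @^-1` [set s`_i].
have s0 (i : 'I_(size s)) : (0 <= s`_i)%R.
  have : s`_i \in fset_set (range f) by exact: mem_nth.
  by rewrite in_fset_set// => /set_mem[x _ <-].
have mA i : measurable (A i) by exact: measurable_funPTI.
have i0 i x : 0 <= (EFin \o \1_(A i)) x :> \bar R by rewrite lee_fin.
have mi i : measurable_fun setT (EFin \o (\1_(A i) : T -> R)).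
  by apply/measurable_EFinP; exact: measurable_indic.
have fE : EFin \o f = fun x =>
    \sum_(i <- index_enum 'I_(size s)) ((s`_i)%:E * (EFin \o \1_(A i)) x).
  by apply/funext => x /=; rewrite fimfunEord -sumEFin.
transitivity (\sum_(i <- index_enum 'I_(size s)) ((s`_i)%:E * nu (A i))).
  rewrite fE Phi_sum; last 2 first.
  - by move=> i x; rewrite mule_ge0// lee_fin.
  - by move=> i; exact: measurable_funeM.
  by apply: eq_bigr => i _; rewrite PhiZ// Phi_indic.
rewrite [RHS](_ : _ = \int[nu]_x (EFin \o f) x)// fE ge0_integral_sum//.
- apply: eq_bigr => i _; rewrite ge0_integralZl_EFin//.
  by rewrite integral_indic// setIT.
- by move=> i; exact: measurable_funeM.
- by move=> i x _; rewrite mule_ge0// lee_fin.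
Qed.

(** By linearity [Phi] agrees with the integral on nonnegative simple functions, and a nonnegative
    measurable function is an increasing limit of those. It is applied to integrals against a
    density and to the mean of an integral against a Poisson random measure. *)
Lemma functional_eq_integral f : (forall x, 0 <= f x) -> measurable_fun setT f ->
  Phi f = \int[nu]_x f x.
Proof.
move=> f0 mf; pose f_ := nnsfun_approx measurableT mf.
have fE : f = fun x => limn (fun n => (EFin \o f_ n) x).
  by apply/funext => x; apply/esym/cvg_lim => //; exact: cvg_nnsfun_approx.
have mf_ n : measurable_fun setT (EFin \o f_ n) by exact/measurable_EFinP.
have f_0 n x : 0 <= (EFin \o f_ n) x by rewrite lee_fin.
have f_nd x : nondecreasing_seq (fun n => (EFin \o f_ n) x).
  by move=> a b ab; rewrite lee_fin; exact/lefP/nd_nnsfun_approx.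
rewrite {1}fE Phi_cvg// [in RHS]fE monotone_convergence//.
by congr (limn _); apply/funext => n; exact: Phi_nnsfun.
Qed.

End integral_functional.

(** * Change of measure by a density *)

Section density.
Local Open Scope ereal_scope.
Variables (d : measure_display) (T : measurableType d) (R : realType).
Variables (mu nu : {measure set T -> \bar R}) (g : T -> R).
Hypothesis mg : measurable_fun setT g.
Hypothesis g0 : forall x, (0 <= g x)%R.
Hypothesis nuE : forall A, measurable A -> nu A = \int[mu]_(x in A) (g x)%:E.

Lemma ge0_integral_density f : (forall x, 0 <= f x) -> measurable_fun setT f ->
  \int[nu]_x f x = \int[mu]_x (f x * (g x)%:E).
Proof.
move=> f0 mf.
have meg : measurable_fun setT (EFin \o g) by exact/measurable_EFinP.
have eg0 x : 0 <= (g x)%:E by rewrite lee_fin.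
apply/esym/(@functional_eq_integral _ _ _ nu
  (fun f => \int[mu]_x (f x * (g x)%:E))) => //.
- move=> A mA; rewrite nuE// [RHS]integral_mkcond.
  apply: eq_integral => x _; rewrite patchE /= indicE.
  by case: (x \in A) => /=; rewrite ?mul1e ?mul0e.
- move=> h k h0 k0 mh mk; rewrite -ge0_integralD//.
  + by apply: eq_integral => x _; rewrite ge0_muleDl.
  + by move=> x _; exact: mule_ge0.
  + exact: emeasurable_funM.
  + by move=> x _; exact: mule_ge0.
  + exact: emeasurable_funM.
- move=> c h c0 h0 mh; rewrite -ge0_integralZl_EFin//.
  + by apply: eq_integral => x _; rewrite muleA.
  + by move=> x _; exact: mule_ge0.
  + exact: emeasurable_funM.
- move=> h mh h0 hnd; rewrite -monotone_convergence//.
  + apply: eq_integral => x _; apply/esym/cvg_lim => //.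
    apply: cvgeMr => //; apply: ereal_nondecreasing_is_cvgn; exact: hnd.
  + by move=> n; exact: emeasurable_funM.
  + by move=> n x _; exact: mule_ge0.
  + by move=> x _ a b ab; apply: lee_wpmul2r => //; exact: hnd.
Qed.

Lemma integrable_density (f : T -> R) : measurable_fun setT f ->
  nu.-integrable setT (EFin \o f) <->
  mu.-integrable setT (EFin \o (fun x => f x * g x)%R).
Proof.
move=> mf.
have E : \int[nu]_x `|(EFin \o f) x| =
    \int[mu]_x `|(EFin \o (fun x => f x * g x)%R) x|.
  rewrite ge0_integral_density//; last first.
    by apply: measurableT_comp => //; exact/measurable_EFinP.
  by apply: eq_integral => x _ /=; rewrite normrM (ger0_norm (g0 x)) EFinM.
split=> /integrableP[_ i]; apply/integrableP; split.
- by apply/measurable_EFinP; exact: measurable_funM.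
- by rewrite -E.
- exact/measurable_EFinP.
- by rewrite E.
Qed.

Lemma integral_density (f : T -> R) : measurable_fun setT f ->
  \int[nu]_x (f x)%:E = \int[mu]_x (f x * g x)%:E.
Proof.
move=> mf; rewrite integralE [RHS]integralE.
have mEf : measurable_fun setT (EFin \o f) by exact/measurable_EFinP.
rewrite !ge0_integral_density//.
- congr (_ - _); apply: eq_integral => x _.
    rewrite !funeposE /= -!EFin_max -EFinM.
    by rewrite maxr_pMl// mul0r.
  rewrite !funenegE /= -!EFin_max -EFinM.
  by rewrite maxr_pMl// mul0r mulNr.
- exact: measurable_funeneg.
- exact: measurable_funepos.
Qed.

Lemma Rintegral_density (f : T -> R) : measurable_fun setT f ->
  (\int[nu]_x f x = \int[mu]_x (f x * g x))%R.
Proof. by move=> mf; rewrite /Rintegral integral_density. Qed.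

End density.

(** * Convergence in distribution from characteristic functions *)

Section bernstein.
Variable R : realType.
Implicit Types (s c : R) (N : nat).

Definition bernstein N (l : nat) s : R :=
  'C(N, l)%:R * s ^+ l * (1 - s) ^+ (N - l).

Lemma bernstein_ge0 N l s : 0 <= s <= 1 -> 0 <= bernstein N l s.
Proof.
move=> /andP[s0 s1]; rewrite /bernstein !mulr_ge0// exprn_ge0//.
by rewrite subr_ge0.
Qed.

(** Pascal's rule, read as conditioning a binomial variable on its last trial: a success, of
    probability [s], moves [l] to [l.+1]. *)
Lemma bernstein_rec N s (phi : nat -> R) :
  \sum_(l < N.+2) bernstein N.+1 l s * phi l =
  s * (\sum_(l < N.+1) bernstein N l s * phi l.+1) +
  (1 - s) * (\sum_(l < N.+1) bernstein N l s * phi l).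
Proof.
rewrite big_ord_recl /=.
have -> : \sum_(i < N.+1) bernstein N.+1 (bump 0 i) s * phi (bump 0 i) =
  s * (\sum_(l < N.+1) bernstein N l s * phi l.+1) +
  \sum_(l < N.+1) ('C(N, l.+1)%:R * s ^+ l.+1 * (1 - s) ^+ (N - l)) * phi l.+1.
  rewrite mulr_sumr -big_split /=; apply: eq_bigr => l _.
  rewrite /bump /= add1n /bernstein binS subSS natrD exprS.
  move: 'C(N, l.+1)%:R 'C(N, l)%:R (s ^+ l) (_ ^+ (N - l)) (phi _) => a b c d e.
  by ring.
rewrite addrCA; congr (_ + _).
rewrite [in RHS]big_ord_recl /= mulrDr; congr (_ + _).
  by rewrite /bernstein !bin0 !subn0 !expr0 exprS; ring.
rewrite big_ord_recr /= bin_small// !mul0r addr0 mulr_sumr.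
apply: eq_bigr => l _; rewrite /bump /= add1n /bernstein.
have -> : (N - l = (N - l.+1).+1)%N by rewrite subnSK.
rewrite [(1 - s) ^+ _.+1]exprS.
move: 'C(N, l.+1)%:R (s ^+ l.+1) (_ ^+ _) (phi _) => a b c d.
by ring.
Qed.

Lemma bernstein_sum N s : \sum_(l < N.+1) bernstein N l s = 1.
Proof.
transitivity ((1 - s + s) ^+ N); last by rewrite subrK expr1n.
rewrite exprDn; apply: eq_bigr => l _.
by rewrite /bernstein -[RHS]mulr_natl -mulrA [s ^+ _ * _]mulrC.
Qed.

(** The centre [c] is arbitrary so that the induction closes: a success in the last trial amounts to
    replacing [c] by [c - 1]. *)
Lemma bernstein_var_shift N s c :
  \sum_(l < N.+1) bernstein N l s * (l%:R - c) ^+ 2 =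
  N%:R * s * (1 - s) + (N%:R * s - c) ^+ 2.
Proof.
elim: N c => [|N IH] c.
  rewrite big_ord1 /bernstein bin0 !expr0 !mul0r !add0r !mul1r /=.
  by [].
rewrite (bernstein_rec _ _ (fun l => (l%:R - c) ^+ 2)) IH.
have -> : \sum_(l < N.+1) bernstein N l s * (l.+1%:R - c) ^+ 2 =
    \sum_(l < N.+1) bernstein N l s * (l%:R - (c - 1)) ^+ 2.
  by apply: eq_bigr => l _; rewrite opprB addrA natr1.
by rewrite IH -natr1; ring.
Qed.

Lemma bernstein_var N s : (0 < N)%N ->
  \sum_(l < N.+1) bernstein N l s * (l%:R / N%:R - s) ^+ 2 =
  s * (1 - s) / N%:R.
Proof.
move=> N0; have N0' : N%:R != 0 :> R by rewrite pnatr_eq0 -lt0n.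
have := bernstein_var_shift N s (N%:R * s).
rewrite subrr expr0n addr0 => h.
transitivity (N%:R ^- 2 * \sum_(l < N.+1) bernstein N l s * (l%:R - N%:R * s) ^+ 2).
  rewrite mulr_sumr; apply: eq_bigr => l _.
  by field.
by rewrite h; field.
Qed.

End bernstein.

(** * Bernstein approximation on the cube *)

Section bernstein_cube.
Variables (R : realType) (k : nat).
Implicit Types (s t : 'I_k -> R).

Definition in_cube s := forall i, 0 <= s i <= 1.

Definition bernstein_cube N (G : ('I_k -> R) -> R) s : R :=
  \sum_(j : {ffun 'I_k -> 'I_N.+1})
    G (fun i => (j i : nat)%:R / N%:R) * \prod_i bernstein N (j i) (s i).

Lemma bernstein_cube_weight N s :
  \sum_(j : {ffun 'I_k -> 'I_N.+1}) \prod_i bernstein N (j i) (s i) = 1.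
Proof.
rewrite -(bigA_distr_bigA (fun i (j : 'I_N.+1) => bernstein N j (s i))) /=.
by rewrite big1// => i _; rewrite bernstein_sum.
Qed.

(** A marginal of a product of binomial laws: the factors other than [i0] sum to 1. *)
Lemma bernstein_cube_weight1 N s (phi : nat -> R) (i0 : 'I_k) :
  \sum_(j : {ffun 'I_k -> 'I_N.+1})
    (\prod_i bernstein N (j i) (s i)) * phi (j i0) =
  \sum_(l < N.+1) bernstein N l (s i0) * phi l.
Proof.
pose F (i : 'I_k) (j : 'I_N.+1) :=
  bernstein N j (s i) * (if i == i0 then phi j else 1).
transitivity (\sum_(j : {ffun 'I_k -> 'I_N.+1}) \prod_i F i (j i)).
  apply: eq_bigr => j _; rewrite /F [RHS]big_split /=; congr (_ * _).
  by rewrite (bigD1 i0)//= eqxx big1 ?mulr1// => i /negbTE ->.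
rewrite -bigA_distr_bigA /= (bigD1 i0)//= [X in _ * X]big1 ?mulr1.
  by apply: eq_bigr => l _; rewrite /F eqxx.
move=> i /negbTE ii0; rewrite /F ii0.
by under eq_bigr do rewrite mulr1; exact: bernstein_sum.
Qed.

Lemma bernstein_cube_le N (G : ('I_k -> R) -> R) (M : R) s :
  (forall t, `|G t| <= M) -> in_cube s -> `|bernstein_cube N G s| <= M.
Proof.
move=> GM s01; rewrite (le_trans (ler_norm_sum _ _ _))//.
have -> : M = \sum_(j : {ffun 'I_k -> 'I_N.+1})
    M * \prod_i bernstein N (j i) (s i).
  by rewrite -mulr_sumr bernstein_cube_weight mulr1.
apply: ler_sum => j _.
have w0 : 0 <= \prod_i bernstein N (j i) (s i).
  by rewrite prodr_ge0// => i _; exact: bernstein_ge0.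
by rewrite normrM (ger0_norm w0) ler_wpM2r.
Qed.

(** Chebyshev's argument. Grid points within [del] of [s] in every coordinate cost [e / 2]; for the
    others [2 * M] is at most [2 * M / del ^+ 2] times the squared distance, whose mean is at most
    [k / N]. *)
Lemma bernstein_cube_approx (G : ('I_k -> R) -> R) (M : R) :
  (forall t, `|G t| <= M) ->
  (forall e : R, 0 < e -> exists2 del : R, 0 < del & forall s t, in_cube s -> in_cube t ->
     (forall i, `|s i - t i| < del) -> `|G s - G t| <= e) ->
  forall e : R, 0 < e -> exists N, forall s, in_cube s ->
    `|bernstein_cube N G s - G s| <= e.
Proof.
move=> GM Gc e e0.
have [del del0 Gdel] := Gc (e / 2) (divr_gt0 e0 (ltr0Sn _ 1)).
have M0 : 0 <= M by exact: le_trans (normr_ge0 _) (GM (fun=> 0)).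
(* [N >= A] makes the Chebyshev term [2 * M / del ^+ 2 * k / N] at most [e / 2]. *)
pose A : R := 4 * M * k%:R / del ^+ 2 / e.
have A0 : 0 <= A by rewrite /A !divr_ge0 ?mulr_ge0 ?sqr_ge0// ltW.
have [N N0 AN] : exists2 N, (0 < N)%N & A <= N%:R.
  exists (Num.bound A).+1 => //.
  by rewrite (le_trans (ltW (archi_boundP A0)))// ler_nat.
exists N => s s01.
have NR : 0 < N%:R :> R by rewrite ltr0n.
pose w (j : {ffun 'I_k -> 'I_N.+1}) := \prod_i bernstein N (j i) (s i).
have w0 j : 0 <= w j.
  by rewrite prodr_ge0// => i _; exact: bernstein_ge0.
have key (j : {ffun 'I_k -> 'I_N.+1}) : `|G (fun i => (j i : nat)%:R / N%:R) - G s| <=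
    e / 2 + 2 * M / del ^+ 2 * \sum_i ((j i : nat)%:R / N%:R - s i) ^+ 2.
  have S0 i : 0 <= ((j i : nat)%:R / N%:R - s i) ^+ 2 by exact: sqr_ge0.
  have [near|] := pselect (forall i, `|(j i : nat)%:R / N%:R - s i| < del).
    apply: le_trans (Gdel _ _ _ s01 near) _.
      move=> i; rewrite divr_ge0//= ler_pdivrMr// mul1r ler_nat.
      by rewrite -ltnS ltn_ord.
    by rewrite lerDl mulr_ge0 ?sumr_ge0// divr_ge0 ?sqr_ge0// mulr_ge0.
  move=> /existsNP[i /negP]; rewrite -leNgt => far.
  apply: (@le_trans _ _ (2 * M)).
    by rewrite (le_trans (ler_normB _ _))// mulr_natl mulr2n lerD.
  rewrite -[leLHS]add0r lerD// ?divr_ge0 ?(ltW e0)//.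
  rewrite -mulrA ler_peMr ?mulr_ge0// mulrC ler_pdivlMr ?exprn_gt0// mul1r.
  rewrite (bigD1 i)//= -[leLHS]addr0 lerD ?sumr_ge0//.
  by rewrite -[leRHS]real_normK ?num_real// lerXn2r// nnegrE ltW.
have -> : bernstein_cube N G s - G s =
    \sum_(j : {ffun 'I_k -> 'I_N.+1})
      (G (fun i => (j i : nat)%:R / N%:R) - G s) * w j.
  under eq_bigr do rewrite mulrBl.
  by rewrite sumrB -mulr_sumr bernstein_cube_weight mulr1.
rewrite (le_trans (ler_norm_sum _ _ _))//.
apply: (@le_trans _ _ (\sum_(j : {ffun 'I_k -> 'I_N.+1}) (e / 2 + 2 * M / del ^+ 2 *
    \sum_i ((j i : nat)%:R / N%:R - s i) ^+ 2) * w j)).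
  apply: ler_sum => j _; rewrite normrM (ger0_norm (w0 j)).
  by rewrite ler_wpM2r.
under eq_bigr do rewrite mulrDl.
rewrite big_split /= -mulr_sumr bernstein_cube_weight mulr1.
have -> : \sum_(j : {ffun 'I_k -> 'I_N.+1}) 2 * M / del ^+ 2 *
    (\sum_i ((j i : nat)%:R / N%:R - s i) ^+ 2) * w j =
   2 * M / del ^+ 2 * \sum_i (s i * (1 - s i) / N%:R).
  rewrite mulr_sumr.
  transitivity (\sum_(j : {ffun 'I_k -> 'I_N.+1}) \sum_i
     (2 * M / del ^+ 2 * (w j * ((j i : nat)%:R / N%:R - s i) ^+ 2))).
    apply: eq_bigr => j _; rewrite mulr_sumr mulr_suml.
    by apply: eq_bigr => i _; ring.
  rewrite exchange_big /=; apply: eq_bigr => i _.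
  rewrite -mulr_sumr; congr (_ * _).
  rewrite (bernstein_cube_weight1 N s (fun l => (l%:R / N%:R - s i) ^+ 2)).
  exact: bernstein_var.
apply: (@le_trans _ _ (e / 2 + 2 * M / del ^+ 2 * \sum_(i < k) N%:R^-1)).
  rewrite lerD2l ler_wpM2l ?divr_ge0 ?sqr_ge0 ?mulr_ge0//.
  apply: ler_sum => i _; rewrite ler_piMl ?invr_ge0//.
  have /andP[s0 s1] := s01 i.
  by rewrite mulr_ile1// ?subr_ge0// lerBlDr lerDl.
have -> : \sum_(i < k) N%:R^-1 = k%:R / N%:R :> R.
  by rewrite sumr_const card_ord mulr_natl.
rewrite [leRHS]splitr lerD2l.
rewrite mulrA ler_pdivrMr//.
move: AN; rewrite /A ler_pdivrMr// => AN.
have -> : 2 * M / del ^+ 2 * k%:R = 4 * M * k%:R / del ^+ 2 / 2.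
  by field; rewrite gt_eqF.
by rewrite (_ : e / 2 * N%:R = N%:R * e / 2) ?ler_pM2r//; field.
Qed.

End bernstein_cube.

(** Heine's theorem: in the near-covering form of compactness the point and the modulus [del] vary
    together, which yields one [del] for all of [K]. *)
Lemma compact_unif_continuous (R : realType) (k : nat) (g : 'rV[R]_k -> R)
    (K : set 'rV[R]_k) : compact K -> continuous g ->
  forall e : R, 0 < e -> exists2 del : R, 0 < del &
    forall x y : 'rV[R]_k, K x -> (forall i, `|x ord0 i - y ord0 i| < del) ->
      `|g x - g y| <= e.
Proof.
move=> /compact_near_coveringP cK cg e e0.
pose P (del : R) (x : 'rV[R]_k) := forall y : 'rV[R]_k,
  (forall i, `|x ord0 i - y ord0 i| < del) -> `|g x - g y| <= e.
have [] := cK R (0^'+) P _.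
  move=> x Kx.
  have /cvgrPdist_lt /(_ (e / 2)) := cg x.
  rewrite divr_gt0// => /(_ erefl) /nbhs_ballP[r /= r0 xr].
  near=> x' del => y x'y.
  have bxx' : ball x (r / 2) x'.
    by near: x'; apply: nbhsx_ballx; rewrite divr_gt0.
  have bxy : ball x r y.
    apply: (@le_ball _ _ _ (r / 2 + del)).
      rewrite [leRHS]splitr lerD2l.
      by near: del; apply: nbhs_right_le; rewrite divr_gt0.
    apply: (ball_triangle bxx').
    rewrite mx_norm_ball /ball_/= /Num.norm/= mx_normrE.
    apply/bigmax_ltP; split => [|[i j] _]; last by rewrite !mxE (ord1 i).
    by near: del; exact: nbhs_right_gt.
  rewrite (le_trans (ler_distD (g x) _ _))// [leRHS]splitr lerD// ltW//.
    rewrite distrC; apply: xr; apply: (le_ball _ bxx').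
    by rewrite ler_pdivrMr// ler_pMr// lerDl.
  exact: xr.
move=> r /= r0 Pr.
exists (r / 2); first by rewrite divr_gt0.
move=> x y Kx xy; apply: (Pr (r / 2)) => //=.
  rewrite sub0r normrN gtr0_norm ?divr_gt0// ltr_pdivrMr// ltr_pMr//.
  by rewrite ltrDl.
by rewrite divr_gt0.
Unshelve. all: by end_near. Qed.

(** * Trigonometric polynomials in several variables *)

Section trigonometric.
Variables (R : realType) (k : nat).
Implicit Types (F G : ('I_k -> R) -> R).

(** The phase makes sines available as cosines, and the product formula for two cosines keeps the
    family closed under multiplication. *)
Definition trigpoly F := exists s : seq (R * ('I_k -> R) * R),
  F = fun x => \sum_(p <- s) p.1.1 * cos (\sum_i p.1.2 i * x i + p.2).

Lemma trigpoly_cos (a : 'I_k -> R) b :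
  trigpoly (fun x => cos (\sum_i a i * x i + b)).
Proof.
exists [:: (1, a, b)]; apply/funext => x.
by rewrite big_seq1 mul1r.
Qed.

Lemma trigpoly_cst c : trigpoly (fun=> c).
Proof.
exists [:: (c, fun=> 0, 0)]; apply/funext => x.
rewrite big_seq1 /= big1 ?addr0 ?cos0 ?mulr1// => i _.
by rewrite mul0r.
Qed.

Lemma trigpolyD F G :
  trigpoly F -> trigpoly G -> trigpoly (fun x => F x + G x).
Proof.
move=> [s ->] [t ->]; exists (s ++ t); apply/funext => x.
by rewrite big_cat.
Qed.

Lemma trigpolyM F G :
  trigpoly F -> trigpoly G -> trigpoly (fun x => F x * G x).
Proof.
move=> [s ->] [t ->].
exists ([seq (p.1.1 * q.1.1 / 2, fun i => p.1.2 i + q.1.2 i, p.2 + q.2)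
             | p <- s, q <- t] ++
        [seq (p.1.1 * q.1.1 / 2, fun i => p.1.2 i - q.1.2 i, p.2 - q.2)
             | p <- s, q <- t]).
apply/funext => x; rewrite big_cat !big_allpairs_dep /= -big_split /=.
rewrite mulr_suml; apply: eq_bigr => p _.
rewrite mulr_sumr -big_split; apply: eq_bigr => q _ /=.
set u := \sum_i p.1.2 i * x i + p.2; set v := \sum_i q.1.2 i * x i + q.2.
have -> : \sum_i (p.1.2 i + q.1.2 i) * x i + (p.2 + q.2) = u + v.
  rewrite /u /v addrACA -big_split; congr (_ + _).
  by apply: eq_bigr => i _; rewrite mulrDl.
have -> : \sum_i (p.1.2 i - q.1.2 i) * x i + (p.2 - q.2) = u - v.
  rewrite /u /v opprD addrACA -sumrB; congr (_ + _).
  by apply: eq_bigr => i _; rewrite mulrBl.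
by clearbody u v; rewrite cosD cosB; field.
Qed.

Lemma trigpoly_sum I (r : seq I) (F : I -> ('I_k -> R) -> R) :
  (forall i, trigpoly (F i)) -> trigpoly (fun x => \sum_(i <- r) F i x).
Proof.
move=> FP; elim: r => [|i r IH].
  by under eq_fun do rewrite big_nil; exact: trigpoly_cst.
by under eq_fun do rewrite big_cons; exact: trigpolyD.
Qed.

Lemma trigpoly_prod I (r : seq I) (F : I -> ('I_k -> R) -> R) :
  (forall i, trigpoly (F i)) -> trigpoly (fun x => \prod_(i <- r) F i x).
Proof.
move=> FP; elim: r => [|i r IH].
  by under eq_fun do rewrite big_nil; exact: trigpoly_cst.
by under eq_fun do rewrite big_cons; exact: trigpolyM.
Qed.

Lemma trigpolyX F m : trigpoly F -> trigpoly (fun x => F x ^+ m).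
Proof.
move=> FP; elim: m => [|m IH].
  by under eq_fun do rewrite expr0; exact: trigpoly_cst.
by under eq_fun do rewrite exprS; exact: trigpolyM.
Qed.

Lemma trigpoly_sin (L : R) i : trigpoly (fun x => sin (x i / L)).
Proof.
have := trigpoly_cos (fun j => if j == i then L^-1 else 0) (- (pi / 2)).
congr trigpoly; apply/funext => x.
rewrite (bigD1 i)//= eqxx big1 ?addr0; last first.
  by move=> j /negbTE ->; rewrite mul0r.
by rewrite cosD cosN sinN cos_pihalf sin_pihalf mulr0 add0r mulrN1 opprK mulrC.
Qed.

(** Continuous on the whole line, and inverse to [x |-> (1 + sin (x / L)) / 2] on [[- L, L]]. The
    argument of [asin] is clamped to [[- sin 1, sin 1]], inside the open interval where [asin] is
    continuous. *)
Let xi (L s : R) := L * asin (Num.max (- sin 1) (Num.min (sin 1) (2 * s - 1))).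

Let sin1_lt1 : 0 < sin (1 : R) < 1.
Proof.
have p1 : 1 < pi / 2 :> R.
  have := @pihalf_ge1 R; rewrite le_eqVlt => /orP[/eqP p1|//].
  by have := @cos1_gt0 R; rewrite p1 cos_pihalf ltxx.
have s0 : 0 < sin (1 : R) by apply: sin_gt0_pi; rewrite ltr01/=; lra.
rewrite s0/=.
have c0 : 0 < cos (1 : R) by apply: cos_gt0_pihalf; lra.
have := cos2Dsin2 (1 : R); nra.
Qed.

Let xi_continuous L : continuous (xi L).
Proof.
move=> s; apply: cvgM; first exact: cvg_cst.
have /andP[s0 s1] := sin1_lt1.
apply: (@continuous_comp _ _ _
  (fun s : R => Num.max (- sin 1) (Num.min (sin 1) (2 * s - 1))) (@asin R)).
  apply: (@continuous_max R R (cst (- sin 1))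
    (fun s : R => Num.min (sin 1) (2 * s - 1))); first exact: cvg_cst.
  apply: (@continuous_min R R (cst (sin 1)) (fun s : R => 2 * s - 1)).
    exact: cvg_cst.
  apply: cvgB; last exact: cvg_cst.
  by apply: cvgM; [exact: cvg_cst|exact: cvg_id].
apply: continuous_asin; rewrite lt_max gt_max lt_min gt_min.
by rewrite !(ltrN2, s0, s1) /= ltrNl; lra.
Qed.

Let xiK L x : 0 < L -> `|x| <= L -> xi L ((1 + sin (x / L)) / 2) = x.
Proof.
move=> L0 xL; rewrite /xi.
have -> : 2 * ((1 + sin (x / L)) / 2) - 1 = sin (x / L) by field.
have /andP[y1 y2] : -1 <= x / L <= 1.
  by rewrite -ler_norml normrM normfV (gtr0_norm L0) ler_pdivrMr ?mul1r.
have p1 := @pihalf_ge1 R.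
have ms (u v : R) : -1 <= u -> u <= v -> v <= 1 -> sin u <= sin v.
  move=> u1 uv v1; move: (uv); rewrite le_eqVlt => /orP[/eqP -> //|uv'].
  by rewrite ltW// ltr_sin// in_itv/=; lra.
have -> : Num.min (sin 1) (sin (x / L)) = sin (x / L).
  by apply/min_idPr; apply: ms.
have -> : Num.max (- sin 1) (sin (x / L)) = sin (x / L).
  by apply/max_idPr; rewrite -sinN; apply: ms.
rewrite sinK; first by rewrite mulrC divfK// gt_eqF.
by rewrite in_itv/=; lra.
Qed.

(* The quadratic term absorbs [2 M] off the cube of side [L]; on the cube, use
   Bernstein polynomials in the variables [(1 + sin (x_i / L)) / 2]. *)
Lemma trigpoly_approx (g : 'rV[R]_k -> R) (M : R) :
  continuous g -> (forall x, `|g x| <= M) ->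
  forall e : R, 0 < e -> exists2 F, trigpoly F &
    forall x, `|g (\row_i x i) - F x| <= e + e * \sum_i x i ^+ 2.
Proof.
move=> cg gM e e0.
have M0 : 0 <= M by exact: le_trans (normr_ge0 _) (gM 0).
pose L := Num.sqrt (2 * M / e) + 1.
have L0 : 0 < L by rewrite ltr_wpDl.
have L2 : 2 * M <= e * L ^+ 2.
  rewrite [leRHS]mulrC -ler_pdivrMr// -[leLHS]sqr_sqrtr ?divr_ge0 ?mulr_ge0 ?(ltW e0)//.
  by rewrite lerXn2r ?nnegrE ?(ltW L0)// lerDl.
pose G (s : 'I_k -> R) := g (\row_i xi L (s i)).
have GM t : `|G t| <= M by exact: gM.
have cG : continuous (fun s : 'rV[R]_k => G (fun i => s ord0 i)).
  move=> s; rewrite /G.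
  apply: (@continuous_comp _ _ _
    (fun s : 'rV[R]_k => \row_i xi L (s ord0 i) : 'rV[R]_k) g); last exact: cg.
  apply/(@cvgrPdist_lt R 'rV[R]_k _ (nbhs s) _
    (fun s : 'rV[R]_k => \row_i xi L (s ord0 i))) => e' e'0.
  have : forall i, \forall t \near nbhs s,
      `|xi L (s ord0 i) - xi L ((t : 'rV[R]_k) ord0 i)| < e'.
    move=> i.
    have ci : {for s, continuous (xi L \o (fun s : 'rV[R]_k => s ord0 i))}.
      apply: continuous_comp; last exact: xi_continuous.
      exact: coord_continuous.
    by have /cvgrPdist_lt/(_ _ e'0) := ci.
  move=> /filter_forall; apply: filterS => t At.
  rewrite /Num.norm/= mx_normrE; apply/bigmax_ltP; split => // -[i j] _ /=.
  by rewrite !mxE.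
have cK : compact [set s : 'rV[R]_k | forall i, `[0, 1]%classic (s ord0 i)].
  apply: (@rV_compact R k (fun=> `[0, 1]%classic)) => i.
  exact: segment_compact.
have [|N HN] := bernstein_cube_approx GM _ e0.
  move=> e' e'0; have [del del0 H] := compact_unif_continuous cK cG e'0.
  exists del => // s t s01 t01 st.
  have := H (\row_i s i) (\row_i t i).
  have -> : G (fun i => (\row_i s i) ord0 i) = G s.
    by congr G; apply/funext => i; rewrite mxE.
  have -> : G (fun i => (\row_i t i) ord0 i) = G t.
    by congr G; apply/funext => i; rewrite mxE.
  by apply => i; rewrite !mxE//= in_itv; exact: s01.
pose S (x : 'I_k -> R) i := (1 + sin (x i / L)) / 2.
have S01 x : in_cube (S x).
  by move=> i; have := sin_geN1 (x i / L); have := sin_le1 (x i / L); rewrite /S; lra.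
exists (fun x => bernstein_cube N G (S x)).
  apply: trigpoly_sum => j; apply: trigpolyM; first exact: trigpoly_cst.
  apply: trigpoly_prod => i.
  have T1 : trigpoly (fun x => S x i).
    apply: trigpolyM; last exact: trigpoly_cst.
    by apply: trigpolyD; [exact: trigpoly_cst|exact: trigpoly_sin].
  apply: trigpolyM; last first.
    apply: trigpolyX; apply: trigpolyD; first exact: trigpoly_cst.
    under eq_fun do rewrite -mulN1r.
    by apply: trigpolyM => //; exact: trigpoly_cst.
  by apply: trigpolyM; [exact: trigpoly_cst|exact: trigpolyX].
move=> x.
have S0 i : 0 <= x i ^+ 2 by exact: sqr_ge0.
have [xL|/existsNP[i /negP]] := pselect (forall i, `|x i| <= L).
  have GS : G (S x) = g (\row_i x i).
    by congr g; apply/rowP => i; rewrite !mxE xiK.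
  rewrite -GS distrC (le_trans (HN _ (S01 x)))// lerDl mulr_ge0 ?(ltW e0)//.
  exact: sumr_ge0.
rewrite -ltNge => Lx.
apply: (@le_trans _ _ (2 * M)).
  rewrite (le_trans (ler_normB _ _))// mulr_natl mulr2n lerD//.
  exact: bernstein_cube_le.
rewrite (le_trans L2)// -[leLHS]add0r lerD ?(ltW e0)// ler_wpM2l ?(ltW e0)//.
rewrite (bigD1 i)//= -[leLHS]addr0 lerD ?sumr_ge0//.
by rewrite -[leRHS]real_normK ?num_real// lerXn2r ?nnegrE ?(ltW L0)// ltW.
Qed.

End trigonometric.

Lemma measurable_cos (R : realType) : measurable_fun setT (@cos R).
Proof. exact: (continuous_measurable_fun (@continuous_cos R)). Qed.

Lemma measurable_sin (R : realType) : measurable_fun setT (@sin R).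
Proof. exact: (continuous_measurable_fun (@continuous_sin R)). Qed.

(** * Bounded functions under a probability *)

Section probability_integral.
Variables (d : measure_display) (T : measurableType d) (R : realType).
Variable P : probability T R.
Implicit Types f g : T -> R.

Lemma bounded_integrable f (M : R) : measurable_fun setT f ->
  (forall x, `|f x| <= M) -> P.-integrable setT (EFin \o f).
Proof.
move=> mf fM.
have iM : P.-integrable setT (EFin \o cst M).
  exact: finite_measure_integrable_cst.
apply: (le_integrable measurableT _ _ iM) => //.
  exact/measurable_EFinP.
by move=> x _ /=; rewrite lee_fin (le_trans (fM x))// ler_norm.
Qed.

Lemma EFin_Rintegral f : P.-integrable setT (EFin \o f) ->
  (\int[P]_x f x)%:E = (\int[P]_x (f x)%:E)%E.
Proof. by move=> If; rewrite /Rintegral fineK//; exact: integrable_fin_num. Qed.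

Lemma Rintegral_prob_cst (c : R) : \int[P]_x c = c.
Proof.
rewrite (Rintegral_cst P measurableT).
by rewrite [X in fine X]probability_setT /= mulr1.
Qed.

End probability_integral.

(** * Levy's continuity argument with second moments *)

Section levy.
Variables (R : realType) (k : nat).

Lemma trigpoly_measurable d (T : measurableType d) (Y : 'I_k -> T -> R) F :
  (forall i, measurable_fun setT (Y i)) -> trigpoly F ->
  measurable_fun setT (fun w => F (Y ^~ w)).
Proof.
move=> mY [s ->]; apply: measurable_sum => p.
apply: measurable_funM => //.
apply: (measurableT_comp (@measurable_cos R)); apply: measurable_funD => //.
by apply: measurable_sum => i; apply: measurable_funM.
Qed.

Lemma trigpoly_bounded F : trigpoly F -> exists M : R, forall x : 'I_k -> R, `|F x| <= M.
Proof.
move=> [s ->]; exists (\sum_(p <- s) `|p.1.1|) => x.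
rewrite (le_trans (ler_norm_sum _ _ _))//; apply: ler_sum => p _.
rewrite normrM ler_piMr// ler_norml.
by rewrite cos_geN1 cos_le1.
Qed.

(** The composite is a pointwise limit of trigonometric polynomials in the measurable [Y i], so no
    sigma-algebra on row vectors comes in. *)
Lemma measurable_continuous_row d (T : measurableType d) (Y : 'I_k -> T -> R)
    (g : 'rV[R]_k -> R) (M : R) :
  (forall i, measurable_fun setT (Y i)) -> continuous g ->
  (forall x, `|g x| <= M) ->
  measurable_fun setT (fun w => g (\row_i Y i w)).
Proof.
move=> mY cg gM.
pose e (m : nat) : R := m.+1%:R^-1.
have e0 m : 0 < e m by rewrite invr_gt0.
have h m := cid2 (trigpoly_approx cg gM (e0 m)).
apply: (@measurable_fun_cvg _ _ _ _ (fun m w => projT1 (h m) (Y ^~ w))).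
  move=> m; case: (h m) => F tF _ /=; exact: trigpoly_measurable.
move=> w _; apply/cvgrPdist_le => eps eps0.
pose A := 1 + \sum_i Y i w ^+ 2.
have A0 : 0 < A by rewrite ltr_pwDl// sumr_ge0// => i _; exact: sqr_ge0.
near=> m; case: (h m) => F tF /= /(_ (Y ^~ w)) /le_trans; apply.
rewrite -[X in X + _]mulr1 -mulrDr -/A -ler_pdivlMr//.
near: m.
have := @near_infty_natSinv_lt R (PosNum (divr_gt0 eps0 A0)).
by apply: filterS => m /ltW.
Unshelve. all: by end_near. Qed.

Section approx.
Variables (d : measure_display) (T : measurableType d) (P : probability T R).
Variables (Y : 'I_k -> T -> R) (C e M : R).
Hypothesis mY : forall i, measurable_fun setT (Y i).
Hypothesis YC : forall i, (\int[P]_w (Y i w ^+ 2)%:E <= C%:E)%E.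
Variables (g : 'rV[R]_k -> R) (F : ('I_k -> R) -> R).
Hypothesis cg : continuous g.
Hypothesis gM : forall x, `|g x| <= M.
Hypothesis e0 : 0 <= e.
Hypothesis tF : trigpoly F.
Hypothesis gF : forall x, `|g (\row_i x i) - F x| <= e + e * \sum_i x i ^+ 2.

(** The pointwise error has a quadratic term, which integrates to at most [e * k * C]: bounded
    second moments play the part of tightness. *)
Lemma trigpoly_approx_expectation :
  `|\int[P]_w g (\row_i Y i w) - \int[P]_w F (Y ^~ w)| <= e * (1 + k%:R * C).
Proof.
have mg := measurable_continuous_row mY cg gM.
have mF := trigpoly_measurable mY tF.
have [MF FM] := trigpoly_bounded tF.
have ig : P.-integrable setT (EFin \o (fun w => g (\row_i Y i w))).
  by apply: (@bounded_integrable _ _ _ P _ M mg) => w; exact: gM.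
have iF : P.-integrable setT (EFin \o (fun w => F (Y ^~ w))).
  by apply: (@bounded_integrable _ _ _ P _ MF mF) => w; exact: FM.
have mS : measurable_fun setT (fun w => \sum_i Y i w ^+ 2).
  by apply: measurable_sum => i; exact: measurable_funX.
rewrite -RintegralB// -lee_fin EFin_normr_Rintegral//; last first.
  exact: (integrableB measurableT ig iF).
apply: (le_trans (le_abse_integral _ _ _)) => //.
  by apply/measurable_EFinP; exact: measurable_funB.
apply: (@le_trans _ _ (\int[P]_w (e + e * \sum_i Y i w ^+ 2)%:E)%E).
  apply: ge0_le_integral => //.
  - by apply/measurableT_comp => //; apply/measurable_EFinP; exact: measurable_funB.
  - by apply/measurable_EFinP/measurable_funD => //; exact: measurable_funM.
  - by move=> w _; rewrite lee_fin gF.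
under eq_integral do rewrite EFinD EFinM.
have S0 w : 0 <= \sum_i Y i w ^+ 2 by apply: sumr_ge0 => i _; exact: sqr_ge0.
rewrite ge0_integralD//=; last 2 first.
- by move=> w _; rewrite -EFinM lee_fin mulr_ge0.
- by apply: measurable_funeM; exact/measurable_EFinP.
rewrite integral_cst// ge0_integralZl_EFin//; last 2 first.
- by move=> w _; rewrite lee_fin.
- exact/measurable_EFinP.
rewrite [X in (_ * X + _)%E]probability_setT mule1 mulrDr mulr1 EFinD.
rewrite leeD2l// EFinM lee_wpmul2l//.
under eq_integral do rewrite -sumEFin.
rewrite ge0_integral_sum//; last 2 first.
- by move=> i; apply/measurable_EFinP; exact: measurable_funX.
- by move=> i w _; rewrite lee_fin sqr_ge0.
apply: (@le_trans _ _ (\sum_(i < k) C%:E)%E); first exact: lee_sum.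
by rewrite sumEFin sumr_const card_ord mulr_natl.
Qed.

End approx.

(** A three-epsilon argument: the expectations of [g] are compared with those of a single
    trigonometric polynomial, which converge by linearity from the cosines. One constant [C] has to
    serve all coordinates and the limit. *)
Lemma levy_cvg (dn : nat -> measure_display) (On : forall n, measurableType (dn n))
    (Pn : forall n, probability (On n) R) (Y : forall n, 'I_k -> On n -> R)
    (d : measure_display) (T : measurableType d) (P : probability T R)
    (Z : 'I_k -> T -> R) (C : R) :
  (forall n i, measurable_fun setT (Y n i)) ->
  (forall i, measurable_fun setT (Z i)) ->
  (forall n i, (\int[Pn n]_w (Y n i w ^+ 2)%:E <= C%:E)%E) ->
  (forall i, (\int[P]_w (Z i w ^+ 2)%:E <= C%:E)%E) ->
  (forall a b, \int[Pn n]_w cos (\sum_i a i * Y n i w + b) @[n --> \oo] -->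
     \int[P]_w cos (\sum_i a i * Z i w + b)) ->
  forall (g : 'rV[R]_k -> R) (M : R), continuous g -> (forall x, `|g x| <= M) ->
    \int[Pn n]_w g (\row_i Y n i w) @[n --> \oo] --> \int[P]_w g (\row_i Z i w).
Proof.
move=> mY mZ YC ZC YZ g M cg gM.
have icos d' (T' : measurableType d') (Q : probability T' R) (X : 'I_k -> T' -> R)
    a b c : (forall i, measurable_fun setT (X i)) ->
    Q.-integrable setT (EFin \o (fun w => c * cos (\sum_i a i * X i w + b))).
  move=> mX; apply: (@bounded_integrable _ _ _ Q _ `|c|).
    apply: measurable_funM => //.
    apply: (measurableT_comp (@measurable_cos R)); apply: measurable_funD => //.
    by apply: measurable_sum => i; apply: measurable_funM.
  by move=> w; rewrite normrM ler_piMr// ler_norml cos_geN1 cos_le1.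
have trig F : trigpoly F ->
    \int[Pn n]_w F (Y n ^~ w) @[n --> \oo] --> \int[P]_w F (Z ^~ w).
  move=> [s ->].
  elim: s => [|p s IH].
    rewrite (_ : (fun n => _) = cst (\int[P]_w \sum_(p <- [::])
       p.1.1 * cos (\sum_i p.1.2 i * Z i w + p.2))); first exact: cvg_cst.
    apply/funext => n /=.
    under eq_Rintegral do rewrite big_nil.
    under [RHS]eq_Rintegral do rewrite big_nil.
    by rewrite !Rintegral_prob_cst.
  have split_int d' (T' : measurableType d') (Q : probability T' R)
      (X : 'I_k -> T' -> R) : (forall i, measurable_fun setT (X i)) ->
     \int[Q]_w (\sum_(p <- p :: s) p.1.1 * cos (\sum_i p.1.2 i * X i w + p.2)) =
     p.1.1 * \int[Q]_w cos (\sum_i p.1.2 i * X i w + p.2) +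
     \int[Q]_w (\sum_(p <- s) p.1.1 * cos (\sum_i p.1.2 i * X i w + p.2)).
    move=> mX; under eq_Rintegral do rewrite big_cons.
    have tS : trigpoly (fun x : 'I_k -> R =>
      \sum_(p <- s) p.1.1 * cos (\sum_i p.1.2 i * x i + p.2)) by exists s.
    rewrite RintegralD//; [|exact: icos|].
      rewrite RintegralZl//.
      have := icos _ _ Q X p.1.2 p.2 1 mX.
      by under eq_fun do rewrite mul1r.
    have [MS SM] := trigpoly_bounded tS.
    apply: (@bounded_integrable _ _ _ Q _ MS).
      exact: (trigpoly_measurable mX tS).
    by move=> w; exact: (SM (X ^~ w)).
  rewrite split_int//; under eq_fun do rewrite split_int//.
  by apply: cvgD => //; apply: cvgM; [exact: cvg_cst|exact: YZ].
apply/cvgrPdist_le => eps eps0.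
have C1 : 0 < 1 + k%:R * `|C| by rewrite ltr_pwDl// mulr_ge0.
(* The factor [1 + k * C] of the approximation error is divided out; the absolute value of [C] keeps
   the denominator positive. *)
pose e := eps / 3 / (1 + k%:R * `|C|).
have e0 : 0 < e by rewrite !divr_gt0.
have eC : e * (1 + k%:R * C) <= eps / 3.
  rewrite /e mulrAC ler_pdivrMr// ler_wpM2l ?divr_ge0 ?(ltW eps0)//.
  by rewrite lerD2l ler_wpM2l// ler_norm.
have [F tF gF] := trigpoly_approx cg gM e0.
have e3 : 0 < eps / 3 by rewrite divr_gt0.
have /cvgrPdist_le/(_ _ e3) := trig _ tF.
apply: filterS => n Fn.
have hZ := trigpoly_approx_expectation mZ ZC cg gM (ltW e0) tF gF.
have hY := trigpoly_approx_expectation (mY n) (YC n) cg gM (ltW e0) tF gF.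
move: Fn hZ hY.
set a := \int[P]_w g _; set b := \int[P]_w F _.
set a' := \int[Pn n]_w g _; set b' := \int[Pn n]_w F _ => h1 h2 h3.
have -> : a - a' = (a - b) + (b - b') - (a' - b') by ring.
rewrite (le_trans (ler_normB _ _))// (_ : eps = eps / 3 + eps / 3 + eps / 3); last by field.
rewrite lerD//; last exact: le_trans h3 eC.
by rewrite (le_trans (ler_normD _ _))// lerD//; exact: le_trans h2 eC.
Qed.

End levy.

(** * Gaussian laws *)

Section gaussian_integrals.
Variable R : realType.
Local Notation mu := (@lebesgue_measure R).

(** The tool for integration by parts on the line: the fundamental theorem of calculus on growing
    symmetric intervals, combined with dominated convergence. *)
Lemma integral_derive_vanishing (F f : R -> R) :
  (forall x : R, is_derive x (1 : R) F (f x)) -> continuous f ->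
  mu.-integrable setT (EFin \o f) ->
  F (n%:R) @[n --> \oo] --> 0 -> F (- n%:R) @[n --> \oo] --> 0 ->
  \int[mu]_x f x = 0.
Proof.
move=> dF cf intf Fy FNy.
have mf : measurable_fun setT (EFin \o f) by case/integrableP : intf.
pose I (n : nat) := `[- n.+1%:R, n.+1%:R]%classic : set R.
have mI n : measurable (I n) by exact: measurable_itv.
have E n : (\int[mu]_x ((EFin \o f) \_ (I n)) x)%E = (F n.+1%:R - F (- n.+1%:R))%:E.
  rewrite -integral_mkcond EFinB; apply: continuous_FTC2.
  - by rewrite -subr_gt0 opprK addr_gt0.
  - by apply: continuous_subspaceT => x; exact: cf.
  - have cF x : {for x, continuous F}.
      by apply: differentiable_continuous; apply/derivable1_diffP; case: (dF x).
    split; first by move=> x _; case: (dF x).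
      by apply: cvg_at_right_filter; exact: cF.
    by apply: cvg_at_left_filter; exact: cF.
  - by move=> x _; rewrite derive1E derive_val.
have h1 : (\int[mu]_x ((EFin \o f) \_ (I n)) x)%E @[n --> \oo] --> (\int[mu]_x (f x)%:E)%E.
  have [] // := @dominated_convergence _ _ _ mu setT measurableT
    (fun n => (EFin \o f) \_ (I n)) (EFin \o f) (abse \o (EFin \o f)).
  - move=> n; apply/measurable_restrict => //; first exact: measurable_itv.
    exact: measurable_funTS.
  - apply: aeW => x _; apply: cvg_near_cst.
    have := nbhs_infty_ger `|x|.
    apply: filterS => n nx; rewrite patchE mem_set//.
    rewrite /I /= in_itv/= -ler_norml (le_trans nx)// ler_nat//.
  - exact: integrable_abse.
  - apply: aeW => x n _ /=; rewrite patchE; case: ifPn => // _.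
    by rewrite lee_fin ?normr0.
have h2 : (\int[mu]_x ((EFin \o f) \_ (I n)) x)%E @[n --> \oo] --> 0%:E.
  under eq_fun do rewrite E.
  apply: cvg_EFin; first by apply: nearW.
  rewrite /comp /= -[X in _ --> X](subr0 (0 : R)).
  by apply: cvgB; [move: Fy|move: FNy]; rewrite -(cvg_shiftS) .
by rewrite /Rintegral (cvg_unique _ h1 h2).
Qed.

Variable s : R.
Hypothesis s0 : s != 0.
Local Notation p := (normal_pdf 0 s).

Let s2 : 0 < s ^+ 2.
Proof. by rewrite exprn_even_gt0. Qed.

Lemma normal_pdf0E x : p x = normal_peak s * expR (- (x ^+ 2 / (s ^+ 2 *+ 2))).
Proof. by rewrite normal_pdfE// /normal_fun subr0 mulNr. Qed.

Lemma is_derive_normal_pdf x : is_derive x (1 : R) p (- (x / s ^+ 2) * p x).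
Proof.
pose q (y : R) := - (y ^+ 2 / (s ^+ 2 *+ 2)).
have -> : p = normal_peak s *: (expR \o q).
  by apply/funext => y; exact: normal_pdf0E.
have dq : is_derive x (1 : R) q (- (x / s ^+ 2)).
  have -> : q = (- (s ^+ 2 *+ 2)^-1) *: (fun y : R => y ^+ 2).
    by apply/funext => y; rewrite /q mulrC -mulNr.
  apply: is_derive_eq; rewrite /GRing.scale /= -mulr_natr.
  by field.
apply: is_derive_eq; rewrite /GRing.scale /=.
rewrite -[X in _ = _ * X]/(normal_peak s * expR (q x)).
by ring.
Qed.

(** Half of the exponent absorbs [x ^+ 2], by [u * expR (- u) <= 1] with
    [u = x ^+ 2 / (4 * s ^+ 2)]; the other half is the normal density of deviation [Num.sqrt 2 * s],
    known to be integrable and bounded. *)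
Lemma sqr_normal_pdf_le x :
  x ^+ 2 * p x <= 4 * s ^+ 2 * (normal_peak s / normal_peak (Num.sqrt 2 * s)) *
    normal_pdf 0 (Num.sqrt 2 * s) x.
Proof.
have t0 : Num.sqrt 2 * s != 0 by rewrite mulf_neq0// sqrtr_eq0 -ltNge.
have pk : 0 < normal_peak (Num.sqrt 2 * s) by exact: normal_peak_gt0.
rewrite normal_pdf0E normal_pdfE// /normal_fun subr0 mulNr exprMn sqr_sqrtr//.
set u := x ^+ 2 / (4 * s ^+ 2).
have u0 : 0 <= u by rewrite /u divr_ge0 ?sqr_ge0// mulr_ge0// ltW.
have -> : x ^+ 2 / (s ^+ 2 *+ 2) = u + u.
  by rewrite /u -mulr_natr; field.
have -> : x ^+ 2 / (2 * s ^+ 2 *+ 2) = u.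
  by rewrite /u -mulr_natr; field.
have -> : x ^+ 2 = 4 * s ^+ 2 * u by rewrite /u; field.
rewrite opprD expRD.
have ue : u * expR (- u) <= 1.
  rewrite expRN ler_pdivrMr ?expR_gt0// mul1r.
  by rewrite (le_trans _ (expR_ge1Dx u))// lerDr.
rewrite [leRHS](_ : _ = 4 * s ^+ 2 * normal_peak s * expR (- u) * 1); last first.
  by field; rewrite gt_eqF.
rewrite [leLHS](_ : _ = 4 * s ^+ 2 * normal_peak s * expR (- u) * (u * expR (- u))); last by ring.
have k0 : 0 <= 4 * s ^+ 2 by apply: mulr_ge0; [|exact: ltW].
by rewrite ler_wpM2l// mulr_ge0 ?expR_ge0// mulr_ge0 ?normal_peak_ge0.
Qed.

Lemma integrable_sqr_normal_pdf :
  mu.-integrable setT (EFin \o (fun x => x ^+ 2 * p x)).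
Proof.
have i := integrable_normal_pdf 0 (Num.sqrt 2 * s).
have := integrableZl measurableT
  (4 * s ^+ 2 * (normal_peak s / normal_peak (Num.sqrt 2 * s))) i.
apply: le_integrable => //.
  apply/measurable_EFinP; apply: measurable_funM; first exact: measurable_funX.
  exact: measurable_normal_pdf.
move=> x _ /=; rewrite lee_fin ger0_norm.
  by rewrite (le_trans (sqr_normal_pdf_le x))// ler_norm.
by rewrite mulr_ge0 ?sqr_ge0 ?normal_pdf_ge0.
Qed.

Lemma integrable_normal_pdf_dom (f : R -> R) (c : R) :
  measurable_fun setT f -> (forall x, `|f x| <= c * (1 + x ^+ 2)) ->
  mu.-integrable setT (EFin \o (fun x => f x * p x)).
Proof.
move=> mf fc.
have i := integrableZl measurableT c (integrableD measurableT
  (integrable_normal_pdf 0 s) integrable_sqr_normal_pdf).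
apply: le_integrable i => //.
  apply/measurable_EFinP; apply: measurable_funM => //.
  exact: measurable_normal_pdf.
move=> x _ /=; rewrite lee_fin normrM (ger0_norm (normal_pdf_ge0 _ _ _)).
rewrite (_ : _ * (_ + _) = c * (1 + x ^+ 2) * p x); last by ring.
by rewrite (le_trans _ (ler_norm _))// ler_wpM2r ?normal_pdf_ge0.
Qed.

(** These are the boundary terms of the integrations by parts. As [x ^+ 2 * p x] is bounded, linear
    growth of [f] leaves a bound of order [1 / n]. *)
Lemma cvg_normal_pdf (c : R) (f : R -> R) (u : R^nat) :
  (forall x, `|f x| <= c * (1 + `|x|)) -> (forall n, `|u n| = n%:R) ->
  f (u n) * p (u n) @[n --> \oo] --> 0.
Proof.
move=> fc un.
have t0 : Num.sqrt 2 * s != 0 by rewrite mulf_neq0// sqrtr_eq0 -ltNge.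
pose K := 4 * s ^+ 2 * (normal_peak s / normal_peak (Num.sqrt 2 * s)) *
  normal_peak (Num.sqrt 2 * s).
have pK x : x ^+ 2 * p x <= K.
  rewrite (le_trans (sqr_normal_pdf_le x))// ler_wpM2l ?normal_pdf_ub//.
  have k0 : 0 <= 4 * s ^+ 2 by apply: mulr_ge0; [|exact: ltW].
  exact: mulr_ge0 k0 (divr_ge0 (normal_peak_ge0 _) (normal_peak_ge0 _)).
have c0 : 0 <= c.
  have := fc 0; rewrite normr0 addr0 mulr1; exact: le_trans.
apply/cvgrPdist_le => e e0; near=> n; rewrite sub0r normrN.
have n1 : 1 <= n%:R :> R by rewrite ler1n; near: n; exact: nbhs_infty_ge.
have n0 : 0 < n%:R :> R by exact: lt_le_trans n1.
apply: (@le_trans _ _ (2 * c * K / n%:R)).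
  rewrite normrM (ger0_norm (normal_pdf_ge0 _ _ _)) ler_pdivlMr//.
  apply: (@le_trans _ _ (c * (2 * n%:R) * p (u n) * n%:R)).
    rewrite ler_wpM2r ?(ltW n0)// ler_wpM2r ?normal_pdf_ge0//.
    rewrite (le_trans (fc _))// ler_wpM2l// un mulr_natl mulr2n.
    by rewrite lerD2r.
  rewrite (_ : _ * _ = 2 * c * (n%:R ^+ 2 * p (u n))); last by ring.
  rewrite ler_wpM2l ?mulr_ge0// -(un n) real_normK ?num_real//.
rewrite ler_pdivrMr// [leRHS]mulrC -ler_pdivrMr//.
by near: n; exact: nbhs_infty_ger.
Unshelve. all: by end_near. Qed.

Lemma continuous_normal_pdf0 : continuous p.
Proof. exact: continuous_normal_pdf. Qed.

(** Integration of the derivative of [x * p x], which is [p x - x ^+ 2 * p x / s ^+ 2]. *)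
Lemma normal_variance : \int[mu]_x (x ^+ 2 * p x) = s ^+ 2.
Proof.
have i1 := integrable_normal_pdf 0 s.
have i2 := integrableZl measurableT (s ^- 2) integrable_sqr_normal_pdf.
have := @integral_derive_vanishing (fun x => x * p x)
  (fun x => p x - s ^- 2 * (x ^+ 2 * p x)).
have -> : \int[mu]_x (p x - s ^- 2 * (x ^+ 2 * p x)) =
    1 - s ^- 2 * \int[mu]_x (x ^+ 2 * p x).
  rewrite RintegralB// RintegralZl//; last exact: integrable_sqr_normal_pdf.
  by rewrite /Rintegral integral_normal_pdf.
have ss : s ^+ 2 != 0 by rewrite gt_eqF.
move=> h; suff /eqP : 1 - s ^- 2 * \int[mu]_x (x ^+ 2 * p x) = 0.
  rewrite subr_eq0 => /eqP e1.
  by rewrite -[RHS]mulr1 e1 mulrA mulfV// mul1r.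
apply: h.
- move=> x; have d := is_derive_normal_pdf x.
  apply: is_derive_eq; rewrite /GRing.scale /=.
  by field.
- move=> x; apply: cvgB; first exact: continuous_normal_pdf0.
  apply: cvgM; first exact: cvg_cst.
  apply: cvgM; last exact: continuous_normal_pdf0.
  exact: exprn_continuous.
- exact: (integrableB measurableT i1 i2).
- apply: (@cvg_normal_pdf 1 id) => [x|n]; last by rewrite normr_nat.
  by rewrite mul1r lerDr.
- apply: (@cvg_normal_pdf 1 id) => [x|n]; last by rewrite normrN normr_nat.
  by rewrite mul1r lerDr.
Qed.

Definition normal_cf t := \int[mu]_x (cos (t * x) * p x).

Let integrable_cos t : mu.-integrable setT (EFin \o (fun x => cos (t * x) * p x)).
Proof.
apply: (@integrable_normal_pdf_dom (fun x => cos (t * x)) 1).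
  by apply: (measurableT_comp (@measurable_cos R)); exact: measurable_funM.
move=> x; rewrite mul1r (@le_trans _ _ 1) ?lerDl ?sqr_ge0//.
by rewrite ler_norml cos_geN1 cos_le1.
Qed.

Let integrable_xsin t :
  mu.-integrable setT (EFin \o (fun x => x * sin (t * x) * p x)).
Proof.
apply: (@integrable_normal_pdf_dom (fun x => x * sin (t * x)) 1).
  apply: measurable_funM => //.
  by apply: (measurableT_comp (@measurable_sin R)); exact: measurable_funM.
move=> x; rewrite mul1r normrM.
apply: (@le_trans _ _ (`|x| * 1)).
  by rewrite ler_wpM2l// ler_norml sin_geN1 sin_le1.
rewrite mulr1 -[x ^+ 2]real_normK ?num_real//.
by have := sqr_ge0 (`|x| - 1); nra.
Qed.

(** Integration of the derivative of [sin (t * x) * p x]. *)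
Lemma normal_cf_ibp t : \int[mu]_x (x * sin (t * x) * p x) = s ^+ 2 * t * normal_cf t.
Proof.
have ss : s ^+ 2 != 0 by rewrite gt_eqF.
have i1 := integrableZl measurableT t (integrable_cos t).
have i2 := integrableZl measurableT (s ^- 2) (integrable_xsin t).
have := @integral_derive_vanishing (fun x => sin (t * x) * p x)
  (fun x => t * (cos (t * x) * p x) - s ^- 2 * (x * sin (t * x) * p x)).
have -> : \int[mu]_x (t * (cos (t * x) * p x) - s ^- 2 * (x * sin (t * x) * p x)) =
    t * normal_cf t - s ^- 2 * \int[mu]_x (x * sin (t * x) * p x).
  by rewrite RintegralB// !RintegralZl.
move=> h; suff /eqP : t * normal_cf t - s ^- 2 * \int[mu]_x (x * sin (t * x) * p x) = 0.
  rewrite subr_eq0 => /eqP e1.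
  by rewrite -mulrA e1 mulrA mulfV// mul1r.
apply: h.
- move=> x; have d := is_derive_normal_pdf x.
  have dt : is_derive x (1 : R) (fun x => sin (t * x)) (t * cos (t * x)).
    have dtx : is_derive x (1 : R) (fun x => t * x) t.
      by apply: is_derive_eq; rewrite /GRing.scale /=; ring.
    have -> : (fun x => sin (t * x)) = @sin R \o (fun x => t * x) by [].
    by apply: is_derive_eq; rewrite /GRing.scale /=; ring.
  apply: is_derive_eq; rewrite /GRing.scale /=.
  by field.
- have ct (x : R) : {for x, continuous (fun x => t * x)}.
    by apply: cvgM; [exact: cvg_cst|exact: cvg_id].
  move=> x; apply: cvgB.
    apply: cvgM; first exact: cvg_cst.
    apply: cvgM; last exact: continuous_normal_pdf0.
    by apply: continuous_comp; [exact: ct|exact: continuous_cos].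
  apply: cvgM; first exact: cvg_cst.
  apply: cvgM; last exact: continuous_normal_pdf0.
  apply: cvgM; first exact: cvg_id.
  by apply: continuous_comp; [exact: ct|exact: continuous_sin].
- exact: (integrableB measurableT i1 i2).
- apply: (@cvg_normal_pdf 1 (fun x => sin (t * x))) => [x|n]; last by rewrite normr_nat.
  by rewrite mul1r (@le_trans _ _ 1) ?lerDl// ler_norml sin_geN1 sin_le1.
- apply: (@cvg_normal_pdf 1 (fun x => sin (t * x))) => [x|n]; last by rewrite normrN normr_nat.
  by rewrite mul1r (@le_trans _ _ 1) ?lerDl// ler_norml sin_geN1 sin_le1.
Qed.

(** Differentiation under the integral, dominated by [(1 + x ^+ 2) * p x]; the integration by parts
    turns the result into a linear differential equation. *)
Lemma is_derive_normal_cf t :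
  is_derive t (1 : R) normal_cf (- (s ^+ 2 * t * normal_cf t)).
Proof.
pose f t x := cos (t * x) * p x.
have df y (x : R) : is_derive x (1 : R) (f ^~ y) (- (y * sin (x * y) * p y)).
  have dtx : is_derive x (1 : R) (fun x => x * y) y.
    by apply: is_derive_eq; rewrite /GRing.scale /=; ring.
  have dc : is_derive x (1 : R) (fun x => cos (x * y)) (y * - sin (x * y)).
    have -> : (fun x => cos (x * y)) = @cos R \o (fun x => x * y) by [].
    by apply: is_derive_eq; rewrite /GRing.scale /=; ring.
  apply: is_derive_eq; rewrite /GRing.scale /=.
  by ring.
pose G x := (1 + x ^+ 2) * p x.
have It : `]t - 1, t + 1[%classic t by rewrite /= in_itv/= ltrBlDr ltrDl ltr01.
have intf x : `]t - 1, t + 1[%classic x -> mu.-integrable setT (EFin \o f x).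
  by move=> _; exact: integrable_cos.
have derf1 x y : `]t - 1, t + 1[%classic x -> setT y -> derivable (f ^~ y) x 1.
  by move=> _ _; case: (df y x).
have dfE x y : partial1of2 f x y = - (y * sin (x * y) * p y).
  by rewrite partial1of2E; case: (df y x).
have G0 y : 0 <= G y by rewrite mulr_ge0 ?normal_pdf_ge0 ?addr_ge0 ?sqr_ge0.
have intG : mu.-integrable setT (EFin \o G).
  apply: (@integrable_normal_pdf_dom (fun x => 1 + x ^+ 2) 1) => [|x].
    by apply: measurable_funD => //; exact: measurable_funX.
  by rewrite mul1r ger0_norm ?addr_ge0 ?sqr_ge0.
have Gub x y : `]t - 1, t + 1[%classic x -> setT y -> `|partial1of2 f x y| <= G y.
  move=> _ _; rewrite dfE normrN normrM (ger0_norm (normal_pdf_ge0 _ _ _)).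
  rewrite ler_wpM2r ?normal_pdf_ge0// normrM.
  apply: (@le_trans _ _ (`|y| * 1)).
    by rewrite ler_wpM2l// ler_norml sin_geN1 sin_le1.
  rewrite mulr1 -[y ^+ 2]real_normK ?num_real//.
  by have := sqr_ge0 (`|y| - 1); nra.
have der := derivable_under_integral measurableT It intf derf1 G0 intG Gub.
have := differentiation_under_integral measurableT It intf derf1 G0 intG Gub.
rewrite derive1E => D.
have -> : - (s ^+ 2 * t * normal_cf t) = 'D_1 normal_cf t.
  rewrite [RHS]D; under [RHS]eq_Rintegral do rewrite dfE -mulN1r.
  by rewrite RintegralZl// normal_cf_ibp mulN1r.
exact: DeriveDef.
Qed.

(** The product [h] with the inverse of the expected solution has zero derivative and equals 1 at
    0. *)
Lemma normal_cfE t : normal_cf t = expR (- (s ^+ 2 * t ^+ 2 / 2)).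
Proof.
pose h t := normal_cf t * expR (s ^+ 2 * t ^+ 2 / 2).
have dh x : is_derive x (1 : R) h 0.
  have dn := is_derive_normal_cf x.
  have dq : is_derive x (1 : R) (fun t => s ^+ 2 * t ^+ 2 / 2) (s ^+ 2 * x).
    have -> : (fun t => s ^+ 2 * t ^+ 2 / 2) = (s ^+ 2 / 2) *: (fun y : R => y ^+ 2).
      by apply/funext => y; rewrite /GRing.scale /= mulrAC.
    apply: is_derive_eq; rewrite /GRing.scale /= -mulr_natr.
    by field.
  have de : is_derive x (1 : R) (fun t => expR (s ^+ 2 * t ^+ 2 / 2))
      (s ^+ 2 * x * expR (s ^+ 2 * x ^+ 2 / 2)).
    have -> : (fun t => expR (s ^+ 2 * t ^+ 2 / 2)) =
      @expR R \o (fun t => s ^+ 2 * t ^+ 2 / 2) by [].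
    by apply: is_derive_eq; rewrite /GRing.scale /=; ring.
  apply: is_derive_eq; rewrite /GRing.scale /=.
  by ring.
have := @is_derive_0_is_cst _ h t 0 dh.
rewrite /h expr0n /= mulr0 mul0r expR0 mulr1 => e.
have n0 : normal_cf 0 = 1.
  rewrite /normal_cf; under eq_Rintegral do rewrite mul0r cos0 mul1r.
  by rewrite /Rintegral integral_normal_pdf.
apply: (mulIf (lt0r_neq0 (expR_gt0 (s ^+ 2 * t ^+ 2 / 2)))).
by rewrite e n0 -expRD addNr expR0.
Qed.

End gaussian_integrals.

(** * Random variables with a centered Gaussian law *)

Section gaussian_law.
Variable R : realType.
Local Notation mu := (@lebesgue_measure R).

(** Lebesgue measure is invariant under [x |-> - x], so the integral equals its opposite. *)
Lemma Rintegral_odd (f : R -> R) : mu.-integrable setT (EFin \o f) ->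
  (forall x, f (- x) = - f x) -> \int[mu]_x f x = 0.
Proof.
move=> intf oddf.
have mN : measurable_fun setT (-%R : measurableTypeR R -> measurableTypeR R).
  exact: oppr_measurable.
have mf : measurable_fun setT (EFin \o f) by case/integrableP : intf.
have Ef : EFin \o f \o -%R = (fun x => (- 1)%:E * (EFin \o f) x)%E.
  by apply/funext => x /=; rewrite oddf -EFinM mulN1r.
have e1 : (\int[mu]_x (EFin \o f) x = \int[mu]_x (EFin \o f \o -%R) x)%E.
  rewrite -[RHS](@integral_pushforward _ _ _ _ _
    (-%R : measurableTypeR R -> measurableTypeR R) mN mu setT (EFin \o f))//; last first.
    by rewrite preimage_setT Ef; apply: integrableZl => //.
  apply: eq_measure_integral => A mA _; exact/esym/lebesgue_measureN.
have fin := integrable_fin_num measurableT intf.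
move: e1; rewrite Ef integralZl// EFinN mulN1e.
rewrite /Rintegral -(fineK fin) -EFinN => -[] /eqP.
by rewrite -addr_eq0 -mulr2n mulrn_eq0/= => /eqP.
Qed.

Variables (d : measure_display) (T : measurableType d) (P : probability T R).
Variables (X : {RV P >-> R}) (s : R).
Hypothesis lawX : forall B, measurable B ->
  P [set w | B (X w)] = gaussian_prob 0 s B.

Lemma gaussian_ae0 : s = 0 -> {ae P, forall w, X w = 0}.
Proof.
move=> s0; exists (X @^-1` (~` [set 0])); split.
- by apply: measurable_funPTI; exact: measurableC.
- have mC : measurable (~` [set (0 : R)]) by exact: measurableC.
  rewrite [LHS](lawX mC) /gaussian_prob s0 eqxx diracE memNset//=.
  exact.
Qed.

(** The image law has the normal density, so integrals transfer to the line. Quadratic growth covers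
    all the functions used later: cosine, sine, identity and square. *)
Lemma gaussian_expectation (f : R -> R) (c : R) : s != 0 ->
  measurable_fun setT f -> (forall x, `|f x| <= c * (1 + x ^+ 2)) ->
  P.-integrable setT (EFin \o (f \o X)) /\
  \int[P]_w f (X w) = \int[mu]_x (f x * normal_pdf 0 s x).
Proof.
move=> s0 mf fc.
have mp := measurable_normal_pdf (0 : R) s.
have p0 := normal_pdf_ge0 (0 : R) s.
have mX : measurable_fun setT (X : T -> measurableTypeR R).
  exact: (@measurable_funPT _ _ _ _ X).
pose nuX : {measure set (measurableTypeR R) -> \bar R} :=
  measure_function_pushforward__canonical__measure_function_Measure P mX.
have lawE A : measurable A -> nuX A =
    (\int[mu]_(x in A) (normal_pdf 0 s x)%:E)%E.
  by move=> mA; rewrite [LHS](lawX mA) /gaussian_prob (negbTE s0).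
have i1 := integrable_normal_pdf_dom s0 mf fc.
have mEf : measurable_fun setT (EFin \o f : measurableTypeR R -> _).
  exact/measurable_EFinP.
have i2 : nuX.-integrable setT (EFin \o f).
  exact: (@integrable_density _ (measurableTypeR R) R mu nuX
    (normal_pdf 0 s) mp p0 lawE f mf).2 i1.
have i3 : P.-integrable setT (EFin \o (f \o X)).
  apply/integrableP; split.
    exact: (measurableT_comp mEf mX).
  have /integrableP[_] := i2.
  rewrite (ge0_integral_pushforward mX)//; exact: measurableT_comp.
split => //.
rewrite -(@Rintegral_density _ (measurableTypeR R) R mu nuX
  (normal_pdf 0 s) mp p0 lawE f mf) /Rintegral.
by rewrite (integral_pushforward mX).
Qed.

(** In the expansion of [cos (t * X w + b)] the sine part vanishes by oddness. The case [s = 0] is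
    apart, the law being then a Dirac mass. *)
Lemma gaussian_cos t b :
  \int[P]_w cos (t * X w + b) = expR (- (s ^+ 2 * t ^+ 2 / 2)) * cos b.
Proof.
have [s0|s0] := eqVneq s 0.
  rewrite s0 expr0n /= mul0r mul0r oppr0 expR0 mul1r.
  rewrite -[RHS](Rintegral_prob_cst P (cos b)).
  rewrite /Rintegral; congr fine; apply: ae_eq_integral => //.
    apply/measurable_EFinP/(measurableT_comp (@measurable_cos R)).
    by apply: measurable_funD => //; exact: measurable_funM.
  have := gaussian_ae0 s0; apply: filterS => w Xw _.
  by rewrite Xw mulr0 add0r.
have mt : measurable_fun setT (fun x : R => t * x) by exact: measurable_funM.
have cb (g : R -> R) x : (forall y, `|g y| <= 1) -> `|g (t * x)| <= 1 * (1 + x ^+ 2).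
  by move=> g1; rewrite mul1r (le_trans (g1 _))// lerDl sqr_ge0.
have c1 (y : R) : `|cos y| <= 1 by rewrite ler_norml cos_geN1 cos_le1.
have s1 (y : R) : `|sin y| <= 1 by rewrite ler_norml sin_geN1 sin_le1.
have [i1 e1] := gaussian_expectation s0
  (measurableT_comp (@measurable_cos R) mt) (fun x => cb _ x c1).
have [i2 e2] := gaussian_expectation s0
  (measurableT_comp (@measurable_sin R) mt) (fun x => cb _ x s1).
transitivity (cos b * \int[P]_w cos (t * X w) - sin b * \int[P]_w sin (t * X w)).
  rewrite -!RintegralZl// -RintegralB//; last 2 first.
  - exact: integrableZl i1.
  - exact: integrableZl i2.
  by apply: eq_Rintegral => w _; rewrite cosD mulrC [X in _ - X]mulrC.
rewrite e1 e2 [X in _ - sin b * X]Rintegral_odd.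
- by rewrite mulr0 subr0 [X in _ * X]normal_cfE// mulrC.
- exact: integrable_normal_pdf_dom (measurableT_comp (@measurable_sin R) mt) (fun x => cb _ x s1).
- move=> x /=; rewrite mulrN sinN mulNr; congr (- (_ * _)).
  by rewrite !normal_pdf0E// sqrrN.
Qed.

(** The second conclusion is an extended integral, the form of moment bound that [levy_cvg] asks
    for. *)
Lemma gaussian_variance : covariance P X X = (s ^+ 2)%:E /\
  (\int[P]_w (X w ^+ 2)%:E)%E = (s ^+ 2)%:E.
Proof.
suff [m v] : (\int[P]_w (X w)%:E)%E = 0%:E /\
    (\int[P]_w (X w ^+ 2)%:E)%E = (s ^+ 2)%:E.
  split => //; have EX : ('E_P[X] = 0)%E by rewrite expectation.unlock.
  rewrite covariance.unlock EX /= expectation.unlock -v.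
  apply: eq_integral => w _; congr EFin.
  by rewrite !fctE /= subr0 expr2.
have [s0|s0] := eqVneq s 0.
  have X0 := gaussian_ae0 s0; rewrite s0 expr0n /=.
  have i0 (f : R -> R) : measurable_fun setT f -> f 0 = 0 ->
      (\int[P]_w (f (X w))%:E)%E = 0%:E.
    move=> mf f0; rewrite -[RHS](@integral0 _ _ _ P setT).
    apply: ae_eq_integral => //.
      by apply/measurable_EFinP; exact: measurableT_comp.
    by move: X0; apply: filterS => w Xw _; rewrite Xw f0.
  split; first exact: (i0 id).
  by apply: (i0 (fun x => x ^+ 2)); [exact: measurable_funX|rewrite expr0n].
have [i1 e1] := @gaussian_expectation id 1 s0 (@measurable_id _ _ _) (fun x => ltac:(
  rewrite mul1r -[x ^+ 2]real_normK ?num_real//;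
  by have := sqr_ge0 (`|x| - 1); nra)).
have [i2 e2] := @gaussian_expectation (fun x => x ^+ 2) 1 s0 ltac:(exact: measurable_funX) (fun x => ltac:(
  by rewrite mul1r ger0_norm ?sqr_ge0// lerDr)).
split.
  rewrite -[LHS](EFin_Rintegral i1) e1 Rintegral_odd//.
    apply: (@integrable_normal_pdf_dom _ _ s0 id 1) => // x.
    rewrite mul1r -[x ^+ 2]real_normK ?num_real//=.
    by have := sqr_ge0 (`|x| - 1); nra.
  by move=> x; rewrite mulNr !normal_pdf0E// sqrrN.
by rewrite -[LHS](EFin_Rintegral i2) e2 normal_variance.
Qed.

End gaussian_law.

(** * Poisson random measures *)

Section exponential_trigonometric_series.
Variable R : realType.
Implicit Types (c b m : R).

Lemma is_derive_expn (x : R) n :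
  is_derive x (1 : R) (fun y : R => y ^+ n.+1) (n.+1%:R * x ^+ n).
Proof.
apply: DeriveDef; first exact: exprn_derivable.
by rewrite exp_derive /GRing.scale /= mulr1.
Qed.

(** The function is the real part of [exp (m exp (i c) + i b)]; differentiating in [m] multiplies by
    [exp (i c)], which adds [c] to the phase. *)
Lemma is_derive_exp_cos c b m :
  is_derive m (1 : R) (fun m => expR (m * cos c) * cos (m * sin c + b))
    (expR (m * cos c) * cos (m * sin c + (b + c))).
Proof.
have d1 (a e : R) : is_derive m (1 : R) (fun m => m * a + e) a.
  by apply: is_derive_eq; rewrite /GRing.scale /=; ring.
have de : is_derive m (1 : R) (fun m => expR (m * cos c))
    (expR (m * cos c) * cos c).
  have dl := d1 (cos c) 0.
  have -> : (fun m => expR (m * cos c)) = @expR R \o (fun m => m * cos c + 0).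
    by apply/funext => x /=; rewrite addr0.
  by apply: is_derive_eq; rewrite /= addr0.
have dc : is_derive m (1 : R) (fun m => cos (m * sin c + b))
    (- sin (m * sin c + b) * sin c).
  have dl := d1 (sin c) b.
  have -> : (fun m => cos (m * sin c + b)) = @cos R \o (fun m => m * sin c + b).
    by [].
  exact: is_derive_eq.
apply: is_derive_eq; rewrite /GRing.scale /= addrA.
rewrite [X in _ = _ * X]cosD.
by ring.
Qed.

(* Induction on [J]: the derivative in [m] of the difference is the difference
   for [J - 1] and the phase [b + c]. *)
Lemma exp_cos_taylor J c b m : 0 <= m ->
  `|expR (m * cos c) * cos (m * sin c + b) -
    \sum_(j < J) m ^+ j / j`!%:R * cos (c * j%:R + b)| <=
  expR m * (m ^+ J / J`!%:R).
Proof.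
elim: J b m => [|J IH] b m m0.
  rewrite big_ord0 subr0 expr0 fact0 divr1 mulr1 normrM.
  rewrite -[leRHS]mulr1 ler_pM//; last by rewrite ler_norml cos_geN1 cos_le1.
  by rewrite ger0_norm ?expR_ge0// ler_expR ler_piMr// cos_le1.
pose f b m := expR (m * cos c) * cos (m * sin c + b) : R.
pose S K b m := \sum_(j < K) m ^+ j / j`!%:R * cos (c * j%:R + b) : R.
have dS K e x : is_derive x (1 : R) (S K.+1 e) (S K (e + c) x).
  have Si K' : S K' e = \sum_(j < K')
      (fun y : R => (cos (c * j%:R + e) / j`!%:R) *: y ^+ j).
    apply/funext => y; rewrite fct_sumE /S; apply: eq_bigr => j _.
    by rewrite /GRing.scale /= mulrAC [RHS]mulrAC; congr (_ / _); exact: mulrC.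
  elim: K => [|K IHK].
    have -> : S 1 e = cst (cos e).
      apply/funext => y; rewrite /S big_ord1 expr0 fact0 divr1 mul1r mulr0 add0r.
      by [].
    by rewrite /S big_ord0; exact: is_derive_cst.
  have -> : S K.+2 e = S K.+1 e +
      (cos (c * K.+1%:R + e) / K.+1`!%:R) *: (fun y : R => y ^+ K.+1).
    apply/funext => y; rewrite /S big_ord_recr /= ; congr (_ + _).
    by rewrite /GRing.scale /= mulrAC [RHS]mulrAC; congr (_ / _); exact: mulrC.
  have dX : is_derive x (1 : R) (fun y : R => y ^+ K.+1) (K.+1%:R * x ^+ K).
    exact: is_derive_expn.
  apply: is_derive_eq; rewrite /S big_ord_recr /=; congr (_ + _).
  rewrite /GRing.scale /= factS natrM -natr1.
  have n1 : K%:R + 1 != 0 :> R by rewrite natr1 pnatr_eq0.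
  have n2 : K`!%:R != 0 :> R by rewrite pnatr_eq0 -lt0n fact_gt0.
  rewrite (_ : c * (K%:R + 1) + e = c * K%:R + (e + c)); last by ring.
  by field; rewrite n1 n2.
(* The two signs [sg] give the two sides of the bound. The factor [expR m] is frozen at the right
   end point, so that the first term differentiates into a majorant of the bound for [J]. *)
pose g (sg : R) y := expR m * (y ^+ J.+1 / J.+1`!%:R) + sg * (f b y - S J.+1 b y).
have dg sg x : is_derive x (1 : R) (g sg)
    (expR m * (x ^+ J / J`!%:R) + sg * (f (b + c) x - S J (b + c) x)).
  have d1 := dS J b x.
  have d2 : is_derive x (1 : R) (f b) (f (b + c) x) := is_derive_exp_cos c b x.
  have dX : is_derive x (1 : R) (fun y : R => y ^+ J.+1) (J.+1%:R * x ^+ J).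
    exact: is_derive_expn.
  have -> : g sg = (expR m / J.+1`!%:R) *: (fun y : R => y ^+ J.+1) +
      sg *: (f b - S J.+1 b).
    apply/funext => y; rewrite /g; congr (_ + _).
    by rewrite /GRing.scale /= mulrA mulrAC.
  apply: is_derive_eq; rewrite /GRing.scale /=; congr (_ + _).
  rewrite factS natrM -natr1.
  have n1 : J%:R + 1 != 0 :> R by rewrite natr1 pnatr_eq0.
  have n2 : J`!%:R != 0 :> R by rewrite pnatr_eq0 -lt0n fact_gt0.
  by field; rewrite n1 n2.
have g0 sg : g sg 0 = 0.
  rewrite /g expr0n /= mul0r mulr0 add0r /f /S big_ord_recl /= expr0 fact0.
  rewrite !mul0r expR0 mul1r add0r divr1 mulr0 mul1r add0r.
  rewrite big1 ?addr0 ?subrr ?mulr0// => i _.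
  by rewrite /bump /= add1n exprS !mul0r.
have gm sg : `|sg| = 1 -> 0 <= g sg m.
  move=> sg1; rewrite -(g0 sg).
  apply: (@ger0_derive1_le_cc _ (g sg) 0 m) => //.
  - move=> x; rewrite in_itv/= => /andP[x0 xm]; rewrite derive1E.
    have [_ ->] := dg sg x.
    have h : `|sg * (f (b + c) x - S J (b + c) x)| <= expR m * (x ^+ J / J`!%:R).
      rewrite normrM sg1 mul1r (le_trans (IH (b + c) x (ltW x0)))//.
      rewrite ler_wpM2r ?ler_expR ?(ltW xm)// divr_ge0 ?exprn_ge0// ltW//.
    by rewrite -[X in _ + X]opprK subr_ge0 (le_trans _ h)// -normrN ler_norm.
  - apply: continuous_subspaceT => x.
    by apply: differentiable_continuous; apply/derivable1_diffP; case: (dg sg x).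
  - by rewrite in_itv/= lexx.
  - by rewrite in_itv/= lexx andbT.
have := gm 1; have := gm (-1); rewrite normrN normr1 /g => /(_ erefl) h1 /(_ erefl) h2.
rewrite -/(f b m) -/(S J.+1 b m) ler_norml.
by move: h1 h2; move: (expR m * _) (f b m - S _ _ _) => u v; lra.
Qed.

Definition poisson_weight m (j : nat) : R := expR (- m) * m ^+ j / j`!%:R.

(** The weights carry [expR (- m)], which cancels the factor [expR m] of the remainder in
    [exp_cos_taylor]; what is left is the general term of the exponential series. *)
Lemma cvg_poisson_cos c b m : 0 <= m ->
  \sum_(j < J) poisson_weight m j * cos (c * j%:R + b) @[J --> \oo] -->
  expR (m * (cos c - 1)) * cos (m * sin c + b).
Proof.
move=> m0.
have h : m ^+ J / J`!%:R @[J --> \oo] --> 0.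
  have := @cvg_exp_coeff R m; rewrite exp_coeffE.
  by under eq_fun do rewrite mulrC.
apply/cvgrPdist_le => e e0.
have /cvgrPdist_le/(_ _ e0) := h.
apply: filterS => J; rewrite sub0r normrN => hJ.
have p0 : 0 <= m ^+ J / J`!%:R by rewrite divr_ge0// exprn_ge0.
rewrite ger0_norm// in hJ; apply: le_trans hJ.
rewrite mulrBr mulr1 expRD.
have -> : \sum_(j < J) poisson_weight m j * cos (c * j%:R + b) =
   expR (- m) * \sum_(j < J) m ^+ j / j`!%:R * cos (c * j%:R + b).
  by rewrite mulr_sumr; apply: eq_bigr => j _; rewrite /poisson_weight !mulrA.
rewrite [expR (m * cos c) * _]mulrC -mulrA -mulrBr normrM ger0_norm ?expR_ge0//.
rewrite expRN ler_pdivrMl ?expR_gt0//.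
exact: exp_cos_taylor.
Qed.

Lemma cvg_poisson_weight m : 0 <= m ->
  \sum_(j < J) poisson_weight m j @[J --> \oo] --> (1 : R).
Proof.
move=> m0; have := @cvg_poisson_cos 0 0 m m0.
rewrite cos0 subrr sin0 !mulr0 expR0 addr0 cos0 mulr1.
by under eq_fun do under eq_bigr do rewrite mul0r addr0 cos0 mulr1.
Qed.

Lemma poisson_weight_mean m j :
  j.+1%:R * poisson_weight m j.+1 = m * poisson_weight m j.
Proof.
rewrite /poisson_weight factS natrM exprS.
have n1 : j.+1%:R != 0 :> R by rewrite pnatr_eq0.
have n2 : j`!%:R != 0 :> R by rewrite pnatr_eq0 -lt0n fact_gt0.
by move: n1 n2; move: j.+1%:R j`!%:R (m ^+ j) => x y z x0 y0; field; rewrite x0 y0.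
Qed.

End exponential_trigonometric_series.

(** * Joint law of a Poisson random measure on disjoint sets *)

Section poisson_random_measure_theory.
Variables (d d' : measure_display) (O : measurableType d) (T : measurableType d').
Variables (R : realType) (P : probability O R) (N : R.-ker O ~> T).
Variable m : {measure set T -> \bar R}.
Hypothesis prmN : poisson_random_measure P N m.

Let measurable_N A : measurable A -> measurable_fun setT (fun w => N w A).
Proof. by move=> mA; exact: measurable_kernel. Qed.

Let measurable_indicN A B : measurable A -> measurable B ->
  measurable_fun setT (fun w => \1_B (N w A) : R).
Proof.
by move=> mA mB; apply: measurableT_comp; [exact: measurable_indic|exact: measurable_N].
Qed.

Let count (w : O) (A : set T) : R := fine (N w A).

Let measurable_count A : measurable A -> measurable_fun setT (count ^~ A).
Proof.
move=> mA; apply: measurableT_comp; first exact: fine_measurable.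
exact: measurable_N.
Qed.

Let pN A (B : set (\bar R)) : R := \int[P]_w \1_B (N w A).

Let pNE A B : measurable A -> measurable B ->
  P [set w | B (N w A)] = (pN A B)%:E.
Proof.
move=> mA mB; rewrite /pN /Rintegral.
rewrite (_ : (fun w => _) = EFin \o \1_[set w | B (N w A)]); last first.
  by apply/funext => w /=; rewrite !indicE; congr (_%:R%:E); apply/idP/idP; rewrite !inE.
have mS : measurable [set w | B (N w A)].
  by rewrite -[X in measurable X]setTI; exact: measurable_N.
by rewrite integral_indic// setIT fineK// fin_num_measure.
Qed.

Let pN_nat A j : measurable A -> (m A < +oo)%E ->
  pN A [set j%:R%:E] = poisson_weight (fine (m A)) j.
Proof.
move=> mA fA; apply: EFin_inj; rewrite -pNE//.
exact: (prm_fin prmN mA fA j).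
Qed.

Let fine_m_ge0 A : 0 <= fine (m A).
Proof. by rewrite fine_ge0. Qed.

Let integrable_bounded (f : O -> R) M : measurable_fun setT f ->
  (forall w, `|f w| <= M) -> P.-integrable setT (EFin \o f).
Proof. exact: (@bounded_integrable _ _ _ P f M). Qed.

Let atom (j : nat) (x : \bar R) : R := \1_[set j%:R%:E] x.

Let atomE j x : atom j x = (x == j%:R%:E)%:R.
Proof.
rewrite /atom indicE.
have -> // : (x \in [set j%:R%:E]) = (x == j%:R%:E).
apply/idP/idP; first by move=> /set_mem ->.
by move=> /eqP ->; apply/mem_set.
Qed.

Let atoms01 J x : 0 <= \sum_(j < J) atom j x <= 1.
Proof.
apply/andP; split; first by apply: sumr_ge0 => j _; rewrite atomE.
have [[j0 xj0]|nex] := pselect (exists j0 : 'I_J, x = j0%:R%:E).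
  rewrite (bigD1 j0)//= atomE xj0 eqxx big1 ?addr0// => j /negP jj0.
  rewrite atomE; case: eqP => // -[] /eqP; rewrite eqr_nat => /eqP e.
  by exfalso; apply: jj0; apply/eqP/val_inj.
rewrite big1// => j _; rewrite atomE; case: eqP => // xj.
by exfalso; apply: nex; exists j.
Qed.

Let measurable_atom A j : measurable A ->
  measurable_fun setT (fun w => atom j (N w A)).
Proof. by move=> mA; exact: measurable_indicN. Qed.

Let measurable_atoms A J : measurable A ->
  measurable_fun setT (fun w => \sum_(j < J) atom j (N w A)).
Proof. by move=> mA; apply: measurable_sum => j; exact: measurable_atom. Qed.

Let Rint_sum J (f : 'I_J -> O -> R) (M : R) :
  (forall j, measurable_fun setT (f j)) -> (forall j w, `|f j w| <= M) ->
  \int[P]_w (\sum_(j < J) f j w) = \sum_(j < J) \int[P]_w f j w.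
Proof.
move=> mf fM; rewrite /Rintegral.
under eq_integral do rewrite -sumEFin.
have fi j : P.-integrable setT (EFin \o f j) by exact: (integrable_bounded (M := M)).
rewrite (integral_sum measurableT (f := fun j => EFin \o f j))//.
apply: EFin_inj; rewrite fineK; last first.
  by apply/sum_fin_numP => j _ _; exact: (integrable_fin_num measurableT (fi j)).
rewrite -sumEFin; apply: eq_bigr => j _; rewrite fineK//.
exact: (integrable_fin_num measurableT (fi j)).
Qed.

Let norm_atom j x : `|atom j x| <= 1.
Proof. by rewrite atomE; case: eqP; rewrite ?normr1 ?normr0. Qed.

Let atoms_rest A J : measurable A -> (m A < +oo)%E ->
  \int[P]_w (1 - \sum_(j < J) atom j (N w A)) =
  1 - \sum_(j < J) poisson_weight (fine (m A)) j.
Proof.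
move=> mA fA; rewrite RintegralB//; last 2 first.
- by apply: (@integrable_bounded (cst 1) 1) => // w; rewrite normr1.
- apply: (@integrable_bounded _ 1); first exact: measurable_atoms.
  by move=> w; have /andP[h1 h2] := atoms01 J (N w A); rewrite ger0_norm.
rewrite Rintegral_prob_cst (Rint_sum (M := 1))//; last first.
  by move=> j; exact: measurable_atom.
by congr (_ - _); apply: eq_bigr => j _; exact: pN_nat.
Qed.

(** Total probability over the values of [N w A]: the events [N w A = j] with [j < J] miss only the
    tail of the Poisson weights, which bounds the error since [G] is bounded by 1. *)
Lemma cvg_prm_atoms A (G : O -> R) : measurable A -> (m A < +oo)%E ->
  measurable_fun setT G -> (forall w, `|G w| <= 1) ->
  \sum_(j < J) \int[P]_w (G w * \1_[set j%:R%:E] (N w A)) @[J --> \oo] -->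
  \int[P]_w G w.
Proof.
move=> mA fA mG G1.
have h := cvg_poisson_weight (fine_m_ge0 A).
apply/cvgrPdist_le => e e0.
have /cvgrPdist_le/(_ _ e0) := h.
apply: filterS => J hJ.
rewrite -(Rint_sum (M := 1)); last 2 first.
- by move=> j; apply: measurable_funM => //; exact: measurable_atom.
- by move=> j w; rewrite normrM -[leRHS]mulr1 ler_pM// norm_atom.
under [X in _ - X]eq_Rintegral do rewrite -mulr_sumr.
have mS := measurable_atoms J mA.
have iG : P.-integrable setT (EFin \o G) by exact: (integrable_bounded (M := 1)).
have iGS : P.-integrable setT (EFin \o (fun w => G w * \sum_(j < J) atom j (N w A))).
  apply: (integrable_bounded (M := 1)); first exact: measurable_funM.
  move=> w; rewrite normrM -[leRHS]mulr1 ler_pM//.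
  by have /andP[h1 h2] := atoms01 J (N w A); rewrite ger0_norm.
rewrite -RintegralB//.
apply: (le_trans (le_normr_Rintegral measurableT _)).
  exact: (integrableB measurableT iG iGS).
apply: le_trans (ler_norm _) _ => //.
rewrite ger0_norm ?Rintegral_ge0//.
apply: (@le_trans _ _ (\int[P]_w (1 - \sum_(j < J) atom j (N w A)))).
  apply: le_Rintegral => //.
  - apply: (integrable_bounded (M := 2)).
      by apply: measurableT_comp => //; apply: measurable_funB => //; exact: measurable_funM.
    move=> w; rewrite normr_id -[X in `|X - _|]mulr1 -mulrBr normrM.
    have /andP[h1 h2] := atoms01 J (N w A).
    rewrite -[leRHS]mul1r ler_pM// ger0_norm ?subr_ge0//.
    by rewrite lerBlDr (le_trans (_ : 1 <= 2))// ?ler1n// lerDl.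
  - apply: (integrable_bounded (M := 1)).
      exact: measurable_funB.
    move=> w; have /andP[h1 h2] := atoms01 J (N w A).
    by rewrite ger0_norm ?subr_ge0// gerBl.
  - move=> w _; have /andP[h1 h2] := atoms01 J (N w A).
    rewrite -[X in `|X - _|]mulr1 -mulrBr normrM.
    by rewrite -[leRHS]mul1r ler_pM// ger0_norm// subr_ge0.
rewrite atoms_rest//; apply: le_trans (ler_norm _) _.
by rewrite distrC in hJ; rewrite distrC.
Qed.

(* Independence is only available for events, so the variables not yet turned
   into phases are kept inside indicators. *)
Lemma prm_cos_partial k (A : 'I_k -> set T) (c : 'I_k -> R) :
  (forall i, measurable (A i)) -> (forall i, (m (A i) < +oo)%E) ->
  trivIset setT A ->
  forall t, (t <= k)%N -> forall b (B : 'I_k -> set (\bar R)),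
  (forall i, measurable (B i)) ->
  \int[P]_w (cos (\sum_(i < k | (i < t)%N) c i * fine (N w (A i)) + b) *
             \prod_(i < k | (t <= i)%N) \1_(B i) (N w (A i))) =
  expR (\sum_(i < k | (i < t)%N) fine (m (A i)) * (cos (c i) - 1)) *
  cos (\sum_(i < k | (i < t)%N) fine (m (A i)) * sin (c i) + b) *
  \prod_(i < k | (t <= i)%N) \int[P]_w \1_(B i) (N w (A i)).
Proof.
move=> mA fA tA; elim=> [|t IH] tk b B mB.
  rewrite [X in expR X]big_pred0// [X in cos (X + b)]big_pred0// add0r expR0 mul1r.
  under eq_Rintegral do rewrite [X in cos (X + b)]big_pred0// add0r.
  have E : (fun w => \prod_(i < k) \1_(B i) (N w (A i))) =
      \1_[set w | forall i, B i (N w (A i))] :> (O -> R).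
    apply/funext => w; rewrite indicE.
    have [h|/existsNP[i Bi]] := pselect (forall i, B i (N w (A i))).
      by rewrite mem_set//= big1// => i _; rewrite indicE mem_set.
    rewrite memNset/=; last by move=> h; exact: Bi.
    by rewrite (bigD1 i)//= indicE memNset ?mul0r.
  have mS : measurable [set w | forall i, B i (N w (A i))].
    have mE : measurable_fun setT (fun w => \prod_(i < k) \1_(B i) (N w (A i)) : R).
      by apply: measurable_prod => i _; exact: measurable_indicN.
    have := mE measurableT [set 1] (measurable_set1 _).
    rewrite setTI E; congr measurable; apply/seteqP; split=> w /=.
      rewrite indicE; have [/set_mem//|_ /eqP] := boolP (w \in _).
      by rewrite eq_sym oner_eq0.
    by move=> Sw; rewrite indicE mem_set.
  rewrite RintegralZl//=; last first.
    rewrite E; apply: (integrable_bounded (M := 1)); first exact: measurable_indic.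
    by move=> w; rewrite indicE; case: (_ \in _); rewrite ?normr1 ?normr0.
  congr (_ * _); rewrite E /Rintegral integral_indic// setIT.
  have /= -> := prm_indep prmN mA tA mB.
  under eq_bigr do rewrite pNE//.
  by rewrite prodEFin.
pose i0 := Ordinal tk.
have sumS (F : 'I_k -> R) : \sum_(i < k | (i < t.+1)%N) F i =
    \sum_(i < k | (i < t)%N) F i + F i0.
  rewrite (bigD1 i0)/=; last by rewrite ltnS.
  rewrite addrC; congr (_ + _); apply: eq_bigl => i.
  by rewrite ltnS [RHS]ltn_neqAle andbC -val_eqE.
have prodS (F : 'I_k -> R) : \prod_(i < k | (t <= i)%N) F i =
    F i0 * \prod_(i < k | (t.+1 <= i)%N) F i.
  rewrite (bigD1 i0)//=; congr (_ * _); apply: eq_bigl => i.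
  by rewrite [RHS]ltn_neqAle andbC eq_sym -val_eqE.
rewrite !sumS.
set Q := \prod_(i < k | (t < i)%N) _.
pose G w := cos (\sum_(i < k | (i < t.+1)%N) c i * fine (N w (A i)) + b) *
             \prod_(i < k | (t < i)%N) \1_(B i) (N w (A i)).
have mG : measurable_fun setT G.
  apply: measurable_funM.
    apply: (measurableT_comp (@measurable_cos R)); apply: measurable_funD => //.
    under eq_fun do rewrite big_mkcond /=.
    apply: measurable_sum => i; have [_|_] // := boolP (i < t.+1)%N.
    by apply: measurable_funM => //; exact: measurable_count.
  under eq_fun do rewrite big_mkcond /=.
  apply: measurable_prod => i _; have [_|_] // := boolP (t < i)%N.
  exact: measurable_indicN.
have G1 w : `|G w| <= 1.
  rewrite normrM -[leRHS]mulr1 ler_pM//; first by rewrite ler_norml cos_geN1 cos_le1.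
  rewrite normr_prod; apply: prodr_ile1 => i _; rewrite normr_ge0 indicE/=.
  by case: (_ \in _); rewrite ?normr1 ?normr0.
have h1 := cvg_prm_atoms (mA i0) (fA i0) mG G1.
pose a := expR (\sum_(i < k | (i < t)%N) fine (m (A i)) * (cos (c i) - 1)).
pose s := \sum_(i < k | (i < t)%N) fine (m (A i)) * sin (c i).
have h2 : \sum_(j < J) \int[P]_w (G w * \1_[set j%:R%:E] (N w (A i0))) @[J --> \oo] -->
    a * Q * (expR (fine (m (A i0)) * (cos (c i0) - 1)) *
      cos (fine (m (A i0)) * sin (c i0) + (s + b))).
  have -> : (fun J => \sum_(j < J) \int[P]_w (G w * \1_[set j%:R%:E] (N w (A i0)))) =
     (fun J => a * Q * \sum_(j < J)
       poisson_weight (fine (m (A i0))) j * cos (c i0 * j%:R + (s + b))).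
    apply/funext => J; rewrite mulr_sumr; apply: eq_bigr => j _.
    (* Forcing [N w (A i0) = j] by an indicator turns the new term of the cosine into the constant
       phase [c i0 * j], and the induction hypothesis applies with this phase added to [b]. *)
    pose B' i := if i == i0 then [set j%:R%:E] else B i.
    have mB' i : measurable (B' i) by rewrite /B'; case: ifP.
    have := IH (ltnW tk) (c i0 * j%:R + b) B' mB'.
    have B'0 : B' i0 = [set j%:R%:E] by rewrite /B' eqxx.
    rewrite prodS B'0 -/a -/s.
    have -> : \prod_(i < k | (t < i)%N) \int[P]_w \1_(B' i) (N w (A i)) = Q.
      apply: eq_bigr => i ti; rewrite /B' (_ : (i == i0) = false)//.
      by apply/negP => /eqP ii0; move: ti; rewrite ii0 ltnn.
    rewrite [X in _ * (X * Q)](pN_nat j (mA i0) (fA i0)).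
    rewrite addrCA => e.
    transitivity (a * cos (c i0 * j%:R + (s + b)) *
      (poisson_weight (fine (m (A i0))) j * Q)); last by ring.
    rewrite -e; apply: eq_Rintegral => w _.
    rewrite prodS B'0 /G sumS.
    have -> : \prod_(i < k | (t < i)%N)
        \1_(B' i) (N w (A i)) =
        \prod_(i < k | (t < i)%N) \1_(B i) (N w (A i)) :> R.
      apply: eq_bigr => i ti; rewrite /B' (_ : (i == i0) = false)//.
      by apply/negP => /eqP ii0; move: ti; rewrite ii0 ltnn.
    rewrite -/(atom j (N w (A i0))) atomE; case: eqP => [->|_].
      by rewrite mulr1 mul1r /= addrA.
    by rewrite mulr0 mul0r mulr0.
  by apply: cvgM; [exact: cvg_cst|exact: cvg_poisson_cos].
transitivity (\int[P]_w G w).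
  by apply: eq_Rintegral => w _; rewrite /G sumS.
rewrite (cvg_unique _ h1 h2) // expRD -/a -/s.
rewrite [X in _ = _ * cos X * _](_ : _ = fine (m (A i0)) * sin (c i0) + (s + b)).
  by ring.
by ring.
Qed.

Lemma prm_cos_disjoint k (A : 'I_k -> set T) (c : 'I_k -> R) b :
  (forall i, measurable (A i)) -> (forall i, (m (A i) < +oo)%E) ->
  trivIset setT A ->
  \int[P]_w cos (\sum_(i < k) c i * fine (N w (A i)) + b) =
  expR (\sum_(i < k) fine (m (A i)) * (cos (c i) - 1)) *
  cos (\sum_(i < k) fine (m (A i)) * sin (c i) + b).
Proof.
move=> mA fA tA.
have := @prm_cos_partial k A c mA fA tA k (leqnn k) b (fun=> setT) (fun=> measurableT).
have E (F : 'I_k -> R) : \sum_(i < k | (i < k)%N) F i = \sum_(i < k) F i.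
  by apply: eq_bigl => i; rewrite ltn_ord.
rewrite !E [X in _ = _ * X]big_pred0 ?mulr1 => [<-|i]; last by rewrite leqNgt ltn_ord.
apply: eq_Rintegral => w _; rewrite E [X in _ * X]big_pred0 ?mulr1// => i.
by rewrite leqNgt ltn_ord.
Qed.

(** For finite mass, [N w A] is almost surely a natural number because the Poisson weights sum to 1;
    the mean is then the series of [j] times the weight, shifted by [poisson_weight_mean]. *)
Lemma prm_mean A : measurable A -> (\int[P]_w N w A = m A)%E.
Proof.
move=> mA; have [fA|] := ltP (m A) +oo%E; last first.
  rewrite leye_eq => /eqP oA; rewrite oA.
  transitivity (\int[P]_w +oo)%E; last by rewrite integral_cst// [X in (_ * X)%E]probability_setT mule1.
  apply: ae_eq_integral => //; first exact: measurable_N.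
  by have := prm_infty prmN mA oA; apply: filterS => w ->.
(* The exceptional event that [N w A] is not a natural number. *)
pose S := \bigcap_j (fun w => N w A) @^-1` (~` [set (j : nat)%:R%:E]).
have mS : measurable S.
  apply: bigcapT_measurable => j; rewrite -[X in measurable X]setTI.
  by apply: measurable_N => //; exact: measurableC.
have S0 : P S = 0%E.
  have h (J : nat) : fine (P S) <= 1 - \sum_(j < J) poisson_weight (fine (m A)) j.
    rewrite -atoms_rest//.
    have -> : fine (P S) = \int[P]_w \1_S w.
      by rewrite /Rintegral integral_indic// setIT.
    apply: le_Rintegral => //.
    - apply: (integrable_bounded (M := 1)); first exact: measurable_indic.
      by move=> w; rewrite indicE; case: (_ \in _); rewrite ?normr1 ?normr0.
    - apply: (integrable_bounded (M := 1)).
        by apply: measurable_funB => //; exact: measurable_atoms.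
      move=> w; have /andP[h1 h2] := atoms01 J (N w A).
      by rewrite ger0_norm ?subr_ge0// gerBl.
    - move=> w _; rewrite indicE; have [/set_mem Sw|_] := boolP (w \in S).
        rewrite big1 ?subr0// => j _; rewrite atomE; case: eqP => // e.
        by have := Sw j I; rewrite /= e.
      by rewrite subr_ge0; have /andP[] := atoms01 J (N w A).
  have hc : 1 - \sum_(j < J) poisson_weight (fine (m A)) j @[J --> \oo] --> (0 : R).
    rewrite -[X in _ --> X](subrr (1 : R)).
    by apply: cvgB; [exact: cvg_cst|exact: cvg_poisson_weight].
  have : fine (P S) <= 0.
    by apply: (ler_cvg_to (cvg_cst _) hc); apply: nearW.
  rewrite -lee_fin fineK ?fin_num_measure// => PS.
  by apply/eqP; rewrite eq_le PS measure_ge0.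
transitivity (\int[P]_w \sum_(0 <= j <oo) (j%:R * atom j (N w A))%:E)%E.
  apply: ae_eq_integral => //.
  - exact: measurable_N.
  - apply: ge0_emeasurable_sum => j; first by move=> w _ _; rewrite lee_fin atomE.
    move=> _; apply/measurable_EFinP; apply: measurable_funM => //.
    exact: measurable_atom.
  exists S; split => // w /= h j _ Nj; apply: h => _.
  apply/esym/cvg_lim => //; apply: cvg_near_cst; exists j.+1 => // n /= jn.
  rewrite (bigD1_seq j)//= ?mem_index_iota ?iota_uniq//.
  rewrite atomE Nj eqxx mulr1 big1 ?adde0// => i ij.
  rewrite atomE (_ : (_ == _) = false) ?mulr0//.
  by apply/negP => /eqP[] /eqP; rewrite eqr_nat eq_sym (negbTE ij).
rewrite integral_nneseries//; last 2 first.
- move=> j; apply/measurable_EFinP; apply: measurable_funM => //.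
  exact: measurable_atom.
- by move=> j w _; rewrite lee_fin atomE mulr_ge0.
have E (j : nat) : (\int[P]_w (j%:R * atom j (N w A))%:E =
    (j%:R * poisson_weight (fine (m A)) j)%:E)%E.
  have ia : P.-integrable setT (EFin \o (fun w => atom j (N w A))).
    by apply: (integrable_bounded (M := 1)) => //; exact: measurable_atom.
  rewrite -EFin_Rintegral; last exact: (integrableZl measurableT j%:R ia).
  by rewrite RintegralZl// [X in _ * X]pN_nat.
under eq_eseriesr do rewrite E.
apply/cvg_lim => //; rewrite -cvg_shiftS /=.
have -> : (fun n => \sum_(0 <= i < n.+1) (i%:R * poisson_weight (fine (m A)) i)%:E)%E =
    EFin \o (fun n => fine (m A) * \sum_(j < n) poisson_weight (fine (m A)) j).
  apply/funext => n; rewrite /= sumEFin big_mkord big_ord_recl mul0r add0r.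
  congr EFin; rewrite mulr_sumr; apply: eq_bigr => i _.
  by rewrite /= -poisson_weight_mean.
rewrite -(fineK (_ : m A \is a fin_num)) ?ge0_fin_numE//.
apply: cvg_EFin; first exact: nearW.
rewrite -[X in _ --> X]mulr1.
by apply: cvgM; [exact: cvg_cst|exact: cvg_poisson_weight].
Qed.

End poisson_random_measure_theory.

Lemma integrable_indic_lty d (T : measurableType d) (R : realType)
    (mu : {measure set T -> \bar R}) (A : set T) :
  measurable A -> (mu A < +oo)%E -> mu.-integrable setT (EFin \o (\1_A : T -> R)).
Proof.
move=> mA fA; apply/integrableP; split.
  by apply/measurable_EFinP; exact: measurable_indic.
rewrite (_ : (fun x => _) = (fun x => (\1_A x)%:E)).
  by rewrite integral_indic// setIT.
by apply/funext => x /=; rewrite ger0_norm.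
Qed.

(** * Campbell's formula and the exponential formula *)

Section poisson_functional.
Variables (d d' : measure_display) (O : measurableType d) (T : measurableType d').
Variables (R : realType) (P : probability O R) (N : R.-ker O ~> T).
Variable m : {measure set T -> \bar R}.
Hypothesis prmN : poisson_random_measure P N m.

Let measurable_intN (g : T -> \bar R) : (forall x, 0 <= g x)%E ->
  measurable_fun setT g -> measurable_fun setT (fun w => \int[N w]_x g x)%E.
Proof.
move=> g0 mg; apply: measurable_fun_integral_kernel => // U mU.
exact: measurable_kernel.
Qed.

(** The iterated integral meets the hypotheses of [functional_eq_integral], monotone convergence
    being used once for [N w] and once for [P]; on indicators it is [prm_mean]. *)
Lemma prm_campbell (g : T -> \bar R) : (forall x, 0 <= g x)%E ->
  measurable_fun setT g ->
  (\int[P]_w \int[N w]_x g x = \int[m]_x g x)%E.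
Proof.
apply: (@functional_eq_integral _ _ _ m (fun g => \int[P]_w \int[N w]_x g x)%E).
- move=> A mA; rewrite -(prm_mean prmN mA); apply: eq_integral => w _.
  by rewrite integral_indic// setIT.
- move=> f h f0 h0 mf mh; rewrite -ge0_integralD//.
  + by apply: eq_integral => w _; rewrite ge0_integralD.
  + by move=> w _; exact: integral_ge0.
  + exact: measurable_intN.
  + by move=> w _; exact: integral_ge0.
  + exact: measurable_intN.
- move=> c f c0 f0 mf; rewrite -ge0_integralZl_EFin//.
  + by apply: eq_integral => w _; rewrite ge0_integralZl_EFin.
  + by move=> w _; exact: integral_ge0.
  + exact: measurable_intN.
- move=> f mf f0 fnd; rewrite -monotone_convergence//.
  + by apply: eq_integral => w _; rewrite monotone_convergence.
  + by move=> n; exact: measurable_intN.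
  + by move=> n w _; exact: integral_ge0.
  + by move=> w _ a b ab; apply: ge0_le_integral => // x _; exact: fnd.
Qed.

Implicit Types h g : T -> R.

Lemma prm_integrable_ae h : m.-integrable setT (EFin \o h) ->
  {ae P, forall w, (N w).-integrable setT (EFin \o h)}.
Proof.
move=> /integrableP[mh ih].
have ma : measurable_fun setT (fun x => `|(EFin \o h) x|)%E by exact: measurableT_comp.
have mI := measurable_intN (fun x => abse_ge0 ((EFin \o h) x)) ma.
have iP : P.-integrable setT (fun w => \int[N w]_x `|(EFin \o h) x|)%E.
  apply/integrableP; split => //.
  rewrite (eq_integral (fun w => \int[N w]_x `|(EFin \o h) x|)%E); last first.
    by move=> w _; rewrite gee0_abs// integral_ge0.
  by rewrite prm_campbell.
have := integrable_ae measurableT iP.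
apply: filterS => w /(_ I) fw; apply/integrableP; split => //.
by rewrite -ge0_fin_numE// integral_ge0.
Qed.

Lemma measurable_prm_functional h : measurable_fun setT h ->
  measurable_fun setT (fun w => \int[N w]_x h x).
Proof.
move=> mh; apply: measurableT_comp; first exact: fine_measurable.
have mEh : measurable_fun setT (EFin \o h) by exact/measurable_EFinP.
rewrite (_ : (fun w => _) = (fun w => \int[N w]_x (EFin \o h)^\+ x -
   \int[N w]_x (EFin \o h)^\- x)%E); last first.
  by apply/funext => w; rewrite integralE.
apply: emeasurable_funB; apply: measurable_intN => //.
- exact: measurable_funepos.
- exact: measurable_funeneg.
Qed.

Lemma prm_functional_norm h : m.-integrable setT (EFin \o h) ->
  P.-integrable setT (EFin \o (fun w => \int[N w]_x h x)) /\
  (\int[P]_w `|\int[N w]_x h x|%:E <= \int[m]_x `|h x|%:E)%E.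
Proof.
move=> ih; have /integrableP[mh ih'] := ih.
have ma : measurable_fun setT (fun x => `|(EFin \o h) x|)%E by exact: measurableT_comp.
have mI := measurable_intN (fun x => abse_ge0 ((EFin \o h) x)) ma.
have mX : measurable_fun setT (EFin \o (fun w => \int[N w]_x h x)).
  by apply/measurable_EFinP; apply: measurable_prm_functional; exact/measurable_EFinP.
have le : (\int[P]_w `|\int[N w]_x h x|%:E <= \int[m]_x `|h x|%:E)%E.
  rewrite -[leRHS](@prm_campbell (fun x => `|h x|%:E))//.
  apply: ae_ge0_le_integral => //.
  - apply/measurable_EFinP; apply: measurableT_comp => //.
    by apply: measurable_prm_functional; exact/measurable_EFinP.
  - by move=> w _; exact: integral_ge0.
  have := prm_integrable_ae ih; apply: filterS => w iw _.
  rewrite EFin_normr_Rintegral//.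
  apply: (le_trans (le_abse_integral _ measurableT _)) => //.
split => //; apply/integrableP; split => //.
exact: le_lt_trans le ih'.
Qed.

(** The map from [h] to its random integral contracts L1 distances. This carries the exponential
    formula from simple to integrable functions. *)
Lemma prm_functional_dist h g : m.-integrable setT (EFin \o h) ->
  m.-integrable setT (EFin \o g) ->
  (\int[P]_w `|\int[N w]_x h x - \int[N w]_x g x|%:E <=
   \int[m]_x `|h x - g x|%:E)%E.
Proof.
move=> ih ig.
have ihg : m.-integrable setT (EFin \o (fun x => h x - g x)).
  exact: (integrableB measurableT ih ig).
have [_] := prm_functional_norm ihg.
apply: le_trans.
rewrite le_eqVlt; apply/orP; left; apply/eqP; apply: ae_eq_integral => //.
- apply/measurable_EFinP; apply: measurableT_comp => //.
  apply: measurable_funB; apply: measurable_prm_functional.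
    by case/integrableP : ih => /measurable_EFinP.
  by case/integrableP : ig => /measurable_EFinP.
- apply/measurable_EFinP; apply: measurableT_comp => //.
  apply: measurable_prm_functional.
  by case/integrableP : ihg => /measurable_EFinP.
have := prm_integrable_ae ih; apply: filterS2 (prm_integrable_ae ig) => w iwg iwh _.
by rewrite RintegralB.
Qed.

(** Campbell's formula for the positive and the negative part. Both random integrals are almost
    surely finite, so passing through [fine] loses nothing outside a null set. *)
Lemma prm_functional_mean h : m.-integrable setT (EFin \o h) ->
  \int[P]_w (\int[N w]_x h x) = \int[m]_x h x.
Proof.
move=> ih; have /integrableP[mh ih'] := ih.
have part (k : T -> \bar R) : (forall x, 0 <= k x)%E -> measurable_fun setT k ->
    (\int[m]_x k x < +oo)%E ->
    P.-integrable setT (fun w => (fine (\int[N w]_x k x)%E)%:E) /\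
    (\int[P]_w (fine (\int[N w]_x k x)%E)%:E = \int[m]_x k x)%E.
  move=> k0 mk fk.
  have iP : P.-integrable setT (fun w => \int[N w]_x k x)%E.
    apply/integrableP; split; first exact: measurable_intN.
    rewrite (eq_integral (fun w => \int[N w]_x k x)%E); last first.
      by move=> w _; rewrite gee0_abs// integral_ge0.
    by rewrite prm_campbell.
  have mF : measurable_fun setT (fun w => (fine (\int[N w]_x k x)%E)%:E).
    apply/measurable_EFinP; apply: measurableT_comp; first exact: fine_measurable.
    exact: measurable_intN.
  have ae : {ae P, forall w, setT w ->
      (\int[N w]_x k x)%E = (fine (\int[N w]_x k x)%E)%:E}.
    have := integrable_ae measurableT iP.
    by apply: filterS => w /(_ I) fw _; rewrite fineK.
  split; last by rewrite -(prm_campbell k0 mk); apply: ae_eq_integral => //; [exact: measurable_intN|move: ae; apply: filterS => w h' ?; rewrite -h'].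
  apply: (le_integrable measurableT mF _ iP) => w _.
  by case: (\int[N w]_x k x)%E => [r||] //=; rewrite ?normr0 ?leey.
have [i1 e1] := part _ (funepos_ge0 (EFin \o h)) (measurable_funepos mh)
  (integrable_lty measurableT (integrable_funepos measurableT ih)).
have [i2 e2] := part _ (funeneg_ge0 (EFin \o h)) (measurable_funeneg mh)
  (integrable_lty measurableT (integrable_funeneg measurableT ih)).
apply: EFin_inj; rewrite -[RHS](_ : (\int[m]_x (EFin \o h) x)%E = _); last first.
  by rewrite /Rintegral fineK//; exact: integrable_fin_num.
rewrite EFin_Rintegral; last by have [] := prm_functional_norm ih.
rewrite [RHS]integralE -e1 -e2 -integralB//.
apply: ae_eq_integral => //.
- apply/measurable_EFinP; apply: measurable_prm_functional; exact/measurable_EFinP.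
- by apply: emeasurable_funB; [case/integrableP : i1|case/integrableP : i2].
have := prm_integrable_ae ih; apply: filterS => w iw _.
rewrite -EFinB /Rintegral integralE fineB//.
- exact: (integrable_fin_num measurableT (integrable_funepos measurableT iw)).
- exact: (integrable_fin_num measurableT (integrable_funeneg measurableT iw)).
Qed.

Import HBSimple.

Lemma prm_cos_sfun (g : {sfun T >-> R}) b : m.-integrable setT (EFin \o g) ->
  \int[P]_w cos (\int[N w]_x g x + b) =
  expR (\int[m]_x (cos (g x) - 1)) * cos (\int[m]_x sin (g x) + b).
Proof.
move=> ig.
pose s : seq R := enum_fset (fset_set (range g)).
have us : uniq s by exact: fset_uniq.
(* The level set of the value 0 may have infinite mass; it contributes nothing and is replaced by
   the empty set. *)
pose A (i : 'I_(size s)) := if s`_i == 0 then set0 else g @^-1` [set s`_i].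
have mA i : measurable (A i).
  by rewrite /A; case: ifP => // _; exact: measurable_funPTI.
have tA : trivIset setT A.
  apply/trivIsetP => i j _ _ ij; rewrite /A.
  case: ifP => _; first by rewrite set0I.
  case: ifP => _; first by rewrite setI0.
  rewrite -preimage_setI; apply/seteqP; split => // x /= [-> /eqP].
  by rewrite nth_uniq// => /eqP /val_inj/eqP; rewrite (negbTE ij).
have fA i : (m (A i) < +oo)%E.
  rewrite /A; case: ifPn => [_|s0]; first by rewrite measure0.
  have /integrableP[_] := ig.
  have mB : measurable (g @^-1` [set s`_i]) by exact: measurable_funPTI.
  have : (`|s`_i|%:E * m (g @^-1` [set s`_i]) <= \int[m]_x `|(EFin \o g) x|)%E.
    rewrite -[X in m X]setIT -integral_indic// -ge0_integralZl_EFin//; last first.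
      by apply/measurable_EFinP; exact: measurable_indic.
    apply: ge0_le_integral => //.
    + by apply: measurable_funeM; apply/measurable_EFinP; exact: measurable_indic.
    + by apply: measurableT_comp => //; case/integrableP : ig.
    + move=> x _; rewrite -EFinM lee_fin indicE.
      have [/set_mem/= ->|_] := boolP (x \in _); first by rewrite mulr1.
      by rewrite mulr0.
  move=> h1 /(le_lt_trans h1); rewrite !ltey; apply: contra => /eqP ->.
  by rewrite mulry gtr0_sg ?normr_gt0// mul1e.
(* Vanishing of [F] at 0 compensates for the discarded level set. The formula serves for
   [cos y - 1], [sin] and the identity. *)
have gE (F : R -> R) : F 0 = 0 ->
    (fun x => F (g x)) = (fun x => \sum_(i < size s) F s`_i * \1_(A i) x).
  move=> F0; apply/funext => x.
  have gs : g x \in s by rewrite -[_ \in s]/(g x \in fset_set (range g)) in_fset_set//; apply/mem_set; exists x.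
  have si : (index (g x) s < size s)%N by rewrite index_mem.
  rewrite (bigD1 (Ordinal si))//= big1 ?addr0; last first.
    move=> i /negP ii; rewrite /A; case: ifPn => [/eqP ->|_].
      by rewrite F0 mul0r.
    rewrite indicE memNset ?mulr0//= => gx; apply: ii; apply/eqP/val_inj => /=.
    by rewrite gx index_uniq.
  rewrite /A /= nth_index//; case: ifPn => [/eqP ->|_]; first by rewrite F0 mul0r.
  by rewrite indicE mem_set//= mulr1.
have intF (mu : {measure set T -> \bar R}) (F : R -> R) : F 0 = 0 ->
    (forall i, (mu (A i) < +oo)%E) ->
    \int[mu]_x F (g x) = \sum_(i < size s) F s`_i * fine (mu (A i)).
  move=> F0 fm; rewrite (gE F F0).
  have i1 i : mu.-integrable setT (EFin \o (\1_(A i) : T -> R)).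
    by apply: integrable_indic_lty.
  have i2 (i : 'I_(size s)) : mu.-integrable setT (EFin \o (fun x => F s`_i * \1_(A i) x)).
    exact: (integrableZl measurableT _ (i1 i)).
  apply: EFin_inj; rewrite /Rintegral; under eq_integral do rewrite -sumEFin.
  rewrite (integral_sum measurableT i2) fineK; last first.
    by apply/sum_fin_numP => i _ _; exact: (integrable_fin_num measurableT (i2 i)).
  rewrite -sumEFin; apply: eq_bigr => i _.
  transitivity ((F s`_i)%:E * \int[mu]_x (EFin \o (\1_(A i) : T -> R)) x)%E.
    by rewrite -integralZl.
  by rewrite integral_indic// setIT EFinM fineK// ge0_fin_numE.
have cos0' : cos 0 - 1 = 0 :> R by rewrite cos0 subrr.
rewrite (intF m (fun y => cos y - 1) cos0' fA) (intF m (@sin R) (@sin0 R) fA).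
have := @prm_cos_disjoint _ _ _ _ _ P N m prmN (size s) A (fun i => s`_i) b mA fA tA.
under [in X in _ = X -> _]eq_bigr do rewrite mulrC.
under [in X in _ = _ * cos (X + _) -> _]eq_bigr do rewrite mulrC.
move=> <-; rewrite /Rintegral; congr fine; apply: ae_eq_integral => //.
- apply/measurable_EFinP; apply: (measurableT_comp (@measurable_cos R)).
  by apply: measurable_funD => //; exact: measurable_prm_functional.
- apply/measurable_EFinP; apply: (measurableT_comp (@measurable_cos R)).
  apply: measurable_funD => //; apply: measurable_sum => i; apply: measurable_funM => //.
  by apply: measurableT_comp; [exact: fine_measurable|exact: measurable_kernel].
have : forall i, {ae P, forall w, (N w (A i) < +oo)%E}.
  move=> i; have i1 : m.-integrable setT (EFin \o (\1_(A i) : T -> R)).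
    by apply: integrable_indic_lty.
  have := prm_integrable_ae i1; apply: filterS => w /(integrable_lty measurableT).
  by rewrite integral_indic// setIT.
move=> /filter_forall; apply: filterS => w Nw _.
by rewrite [X in cos (X + _)](intF (N w) id erefl Nw).
Qed.

Lemma norm_sinB (x y : R) : `|sin x - sin y| <= `|x - y|.
Proof.
wlog xy : x y / x < y.
  move=> H; have [xy|yx|->] := ltgtP x y; first exact: H.
    by rewrite distrC [leRHS]distrC; exact: H.
  by rewrite !subrr.
have [|c _] := @MVT R sin cos x y xy _ _.
- by apply: continuous_subspaceT => z; exact: continuous_sin.
rewrite -normrN opprB => ->; rewrite normrM [leRHS]distrC ler_piMl//.
by rewrite ler_norml cos_geN1 cos_le1.
Qed.

Lemma norm_cosB (x y : R) : `|cos x - cos y| <= `|x - y|.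
Proof.
have e (z : R) : cos z = sin (z + pi / 2).
  by rewrite sinD cos_pihalf sin_pihalf mulr0 add0r mulr1.
rewrite !e (le_trans (norm_sinB _ _))//.
by rewrite opprD addrACA subrr addr0.
Qed.

Lemma Rintegral_cvg d1 (U : measurableType d1) (mu : {measure set U -> \bar R})
    (f : U -> R) (F : nat -> U -> R) :
  mu.-integrable setT (EFin \o f) ->
  (forall n, mu.-integrable setT (EFin \o F n)) ->
  (\int[mu]_x `|f x - F n x|%:E)%E @[n --> \oo] --> 0%E ->
  \int[mu]_x F n x @[n --> \oo] --> \int[mu]_x f x.
Proof.
move=> i_f iF h.
have ifF n : mu.-integrable setT (EFin \o (fun x => f x - F n x)).
  exact: (integrableB measurableT i_f (iF n)).
apply/cvgrPdist_le => e e0.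
have /fine_cvgP[_ /cvgrPdist_le/(_ _ e0)] := h.
apply: filterS => n /=; rewrite sub0r normrN => le.
rewrite -RintegralB// (le_trans (le_normr_Rintegral measurableT (ifF n)))//.
exact: le_trans (ler_norm _) le.
Qed.

(** Simple functions approximate [h] in L1. Both sides pass to the limit since sine and cosine are
    1-Lipschitz and the random integrals are contracted in L1. *)
Lemma prm_cos h b : m.-integrable setT (EFin \o h) ->
  \int[P]_w cos (\int[N w]_x h x + b) =
  expR (\int[m]_x (cos (h x) - 1)) * cos (\int[m]_x sin (h x) + b).
Proof.
move=> ih.
have mh : measurable_fun setT h by case/integrableP : ih => /measurable_EFinP.
have [g [ig _ hg]] := approximation_sfun_integrable measurableT ih.
have mg n : measurable_fun setT (g n) by [].
have lip (F : R -> R) (F1 : forall x y, `|F x - F y| <= `|x - y|)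
    (mF : measurable_fun setT F) (F0 : F 0 = 0) :
    \int[m]_x F (g n x) @[n --> \oo] --> \int[m]_x F (h x).
  have iF k : m.-integrable setT (EFin \o k) -> m.-integrable setT (EFin \o (fun x => F (k x))).
    move=> ik; apply: (le_integrable measurableT _ _ ik).
      apply/measurable_EFinP; apply: measurableT_comp => //.
      by case/integrableP : ik => /measurable_EFinP.
    by move=> x _ /=; rewrite lee_fin; have := F1 (k x) 0; rewrite F0 !subr0.
  apply: Rintegral_cvg; [exact: iF|by move=> n; exact: iF|].
  apply: (squeeze_cvge _ (cvg_cst 0%E) hg); apply: nearW => n; apply/andP; split.
    by apply: integral_ge0 => x _; rewrite lee_fin.
  apply: ge0_le_integral => //.
  - by apply/measurable_EFinP; apply: measurableT_comp => //;
      apply: measurable_funB; exact: measurableT_comp.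
  - apply: measurableT_comp => //; apply: emeasurable_funB; exact/measurable_EFinP.
  - by move=> x _; rewrite lee_fin F1.
have h1 : \int[m]_x (cos (g n x) - 1) @[n --> \oo] --> \int[m]_x (cos (h x) - 1).
  apply: (lip (fun y => cos y - 1)).
  - by move=> x y; rewrite opprB addrA subrK norm_cosB.
  - by apply: measurable_funB => //; exact: measurable_cos.
  - by rewrite cos0 subrr.
have h2 : \int[m]_x sin (g n x) @[n --> \oo] --> \int[m]_x sin (h x).
  apply: (lip sin); [exact: norm_sinB|exact: measurable_sin|exact: sin0].
have h3 : expR (\int[m]_x (cos (g n x) - 1)) * cos (\int[m]_x sin (g n x) + b)
    @[n --> \oo] -->
    expR (\int[m]_x (cos (h x) - 1)) * cos (\int[m]_x sin (h x) + b).
  apply: cvgM; first by apply: (continuous_cvg _ _ h1); exact: continuous_expR.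
  apply: (@continuous_cvg _ _ _ _ _ _ (@cos R)); first exact: continuous_cos.
  by apply: cvgD => //; exact: cvg_cst.
have icos k : measurable_fun setT k ->
    P.-integrable setT (EFin \o (fun w => cos (\int[N w]_x k x + b))).
  move=> mk; apply: (@bounded_integrable _ _ _ P _ 1).
    apply: (measurableT_comp (@measurable_cos R)).
    by apply: measurable_funD => //; exact: measurable_prm_functional.
  by move=> w; rewrite ler_norml cos_geN1 cos_le1.
have h4 : \int[P]_w cos (\int[N w]_x g n x + b) @[n --> \oo] -->
    \int[P]_w cos (\int[N w]_x h x + b).
  apply: Rintegral_cvg; [exact: icos|by move=> n; exact: icos|].
  apply: (squeeze_cvge _ (cvg_cst 0%E) hg); apply: nearW => n; apply/andP; split.
    by apply: integral_ge0 => x _; rewrite lee_fin.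
  apply: le_trans (prm_functional_dist ih (ig n)).
  apply: ge0_le_integral => //.
  - apply/measurable_EFinP; apply: measurableT_comp => //; apply: measurable_funB.
      by apply: (measurableT_comp (@measurable_cos R));
        apply: measurable_funD => //; exact: measurable_prm_functional.
    by apply: (measurableT_comp (@measurable_cos R));
      apply: measurable_funD => //; exact: measurable_prm_functional.
  - apply/measurable_EFinP; apply: measurableT_comp => //.
    by apply: measurable_funB; exact: measurable_prm_functional.
  - move=> w _; rewrite lee_fin (le_trans (norm_cosB _ _))//.
    by rewrite opprD addrACA subrr addr0.
apply: (cvg_unique _ h4) => //.
rewrite (_ : (fun n => _) = (fun n => expR (\int[m]_x (cos (g n x) - 1)) *
  cos (\int[m]_x sin (g n x) + b)))//.
by apply/funext => n; exact: (prm_cos_sfun b (ig n)).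
Qed.

End poisson_functional.

(** * Taylor bounds for sine and cosine *)

Section trigonometric_bounds.
Variable R : realType.
Implicit Types x y : R.

Lemma ge0_of_derive_ge0 (f df : R -> R) : f 0 = 0 ->
  (forall x, is_derive x (1 : R) f (df x)) -> (forall x, 0 <= x -> 0 <= df x) ->
  forall x, 0 <= x -> 0 <= f x.
Proof.
move=> f0 dF df0 x x0; rewrite -f0.
apply: (@ger0_derive1_le_cc _ f 0 x) => //.
- move=> y; rewrite in_itv/= => /andP[y0 _]; rewrite derive1E.
  by have [_ ->] := dF y; exact/df0/ltW.
- apply: continuous_subspaceT => y.
  by apply: differentiable_continuous; apply/derivable1_diffP; case: (dF y).
- by rewrite in_itv/= lexx.
- by rewrite in_itv/= lexx andbT.
Qed.

Lemma norm_sin_le x : `|sin x| <= `|x|.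
Proof. by have := norm_sinB x 0; rewrite sin0 !subr0. Qed.

Lemma onem_cosE x : 1 - cos x = 2 * sin (x / 2) ^+ 2.
Proof.
have -> : cos x = cos (x / 2 + x / 2) by rewrite -splitr.
rewrite cosD -!expr2; have := cos2Dsin2 (x / 2); lra.
Qed.

Lemma onem_cos_ge0 x : 0 <= 1 - cos x.
Proof. by rewrite subr_ge0 cos_le1. Qed.

Lemma onem_cos_le x : 1 - cos x <= x ^+ 2 / 2.
Proof.
rewrite onem_cosE -(real_normK (num_real (sin _))).
have h := norm_sin_le (x / 2).
have -> : x ^+ 2 / 2 = 2 * `|x / 2| ^+ 2.
  by rewrite real_normK ?num_real//; field.
by rewrite ler_wpM2l// lerXn2r// nnegrE.
Qed.

Let sub_sin_odd (F : R -> R) : (forall x, 0 <= x -> `|x - sin x| <= F x) ->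
  forall x, `|x - sin x| <= F `|x|.
Proof.
move=> h x; have [x0|x0] := leP 0 x; first by rewrite (ger0_norm x0) h.
rewrite (ltr0_norm x0); have := h (- x); rewrite oppr_ge0 (ltW x0) => /(_ erefl).
by rewrite sinN -opprD normrN.
Qed.

Lemma sub_sin_ge0 x : 0 <= x -> 0 <= x - sin x.
Proof.
apply: (@ge0_of_derive_ge0 (fun x => x - sin x) (fun x => 1 - cos x)).
- by rewrite sin0 subrr.
- move=> y; suff d : is_derive y (1 : R) (id - @sin R) (1 - cos y) by [].
  exact: is_derive_eq.
Qed.

Lemma norm_sub_sin_le3 x : `|x - sin x| <= `|x| ^+ 3 / 6.
Proof.
apply: (sub_sin_odd (F := fun x => x ^+ 3 / 6)) => {}x x0.
rewrite ger0_norm ?sub_sin_ge0// -subr_ge0; move: x x0.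
apply: (@ge0_of_derive_ge0 _ (fun x => x ^+ 2 / 2 - (1 - cos x))).
- by rewrite sin0 subrr expr0n /= mul0r subrr.
- move=> y; have d3 := is_derive_expn y 2.
  have -> : (fun x => x ^+ 3 / 6 - (x - sin x)) =
      6^-1 *: (fun x : R => x ^+ 3) - (id - @sin R).
    by apply/funext => z; rewrite /GRing.scale /= mulrC.
  by apply: is_derive_eq; rewrite /GRing.scale /=; field.
- by move=> y _; rewrite subr_ge0 onem_cos_le.
Qed.

Lemma norm_sub_sin_le2 x : `|x - sin x| <= x ^+ 2 / 2.
Proof.
rewrite -(real_normK (num_real x)).
apply: (sub_sin_odd (F := fun x => x ^+ 2 / 2)) => {}x x0.
rewrite ger0_norm ?sub_sin_ge0// -subr_ge0; move: x x0.
apply: (@ge0_of_derive_ge0 _ (fun x => x - (1 - cos x))).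
- by rewrite sin0 subrr expr0n /= mul0r subrr.
- move=> y; have d2 := is_derive_expn y 1.
  have -> : (fun x => x ^+ 2 / 2 - (x - sin x)) =
      2^-1 *: (fun x : R => x ^+ 2) - (id - @sin R).
    by apply/funext => z; rewrite /GRing.scale /= mulrC.
  by apply: is_derive_eq; rewrite /GRing.scale /= expr1; field.
- move=> y y0; rewrite subr_ge0.
  have := norm_cosB 0 y; rewrite cos0 sub0r normrN (ger0_norm y0).
  exact: le_trans (ler_norm _).
Qed.

(** With [y = x / 2] the left side factors as [2 * (sin y - y) * (sin y + y)], a term of second
    order times one of first order. *)
Lemma norm_onem_cos_sub x : `|1 - cos x - x ^+ 2 / 2| <= `|x| ^+ 3.
Proof.
pose y := x / 2.
have -> : 1 - cos x - x ^+ 2 / 2 = 2 * (sin y - y) * (sin y + y).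
  rewrite onem_cosE -/y (_ : x ^+ 2 / 2 = 2 * y ^+ 2); first by ring.
  by rewrite /y; field.
rewrite !normrM normr_nat distrC.
have h1 := norm_sub_sin_le2 y.
have h2 : `|sin y + y| <= 2 * `|y|.
  rewrite (le_trans (ler_normD _ _))// mulr_natl mulr2n lerD2r.
  exact: norm_sin_le.
have y0 : 0 <= `|y| by [].
have -> : `|x| = 2 * `|y|.
  by rewrite (_ : x = 2 * y) ?normrM ?normr_nat// /y; field.
apply: (@le_trans _ _ (2 * (y ^+ 2 / 2) * (2 * `|y|))).
  by rewrite ler_pM// ?mulr_ge0// ler_wpM2l.
rewrite -(real_normK (num_real y)).
have : 0 <= `|y| ^+ 3 by rewrite exprn_ge0.
rewrite !exprS !expr0; move: `|y| => z; nra.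
Qed.

End trigonometric_bounds.

(** * The compensated Poisson integral *)

Section centered_functional.
Variables (d d' : measure_display) (O : measurableType d) (T : measurableType d').
Variables (R : realType) (P : probability O R) (N : R.-ker O ~> T).
Variable m : {measure set T -> \bar R}.
Hypothesis prmN : poisson_random_measure P N m.
Variable h : T -> R.
Hypothesis ih : m.-integrable setT (EFin \o h).
Hypothesis ih2 : m.-integrable setT (EFin \o (fun x => h x ^+ 2)).

Let mh : measurable_fun setT h.
Proof. by case/integrableP : ih => /measurable_EFinP. Qed.

Definition prm_centered (w : O) : R := \int[N w]_x h x - \int[m]_x h x.

Lemma measurable_prm_centered : measurable_fun setT prm_centered.
Proof. by apply: measurable_funB => //; exact: measurable_prm_functional. Qed.

Let ihZ t : m.-integrable setT (EFin \o (fun x => t * h x)).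
Proof. exact: (integrableZl measurableT t ih). Qed.

Let mtu (F : R -> R) t : measurable_fun setT F -> measurable_fun setT (fun x => F (t * h x)).
Proof. by move=> mF; apply: (measurableT_comp mF); exact: measurable_funM. Qed.

Lemma integrable_onem_cos t : m.-integrable setT (EFin \o (fun x => 1 - cos (t * h x))).
Proof.
apply: (le_integrable measurableT _ _ (integrableZl measurableT (t ^+ 2 / 2) ih2)).
  apply/measurable_EFinP; apply: measurable_funB => //.
  exact: mtu (@measurable_cos R).
move=> x _ /=; rewrite lee_fin ger0_norm ?onem_cos_ge0//.
rewrite (le_trans (onem_cos_le _))// exprMn mulrAC; exact: ler_norm.
Qed.

Lemma integrable_sub_sin t :
  m.-integrable setT (EFin \o (fun x => t * h x - sin (t * h x))).
Proof.
apply: (le_integrable measurableT _ _ (integrableZl measurableT (t ^+ 2 / 2) ih2)).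
  apply/measurable_EFinP; apply: measurable_funB; first exact: measurable_funM.
  exact: mtu (@measurable_sin R).
move=> x _ /=; rewrite lee_fin.
rewrite (le_trans (norm_sub_sin_le2 _))// exprMn mulrAC; exact: ler_norm.
Qed.

(** The subtracted mean merges with the integral of the sine into that of [t * h x - sin (t * h x)],
    so that both integrals on the right are controlled by the integral of [h ^+ 2]. *)
Lemma prm_centered_cos t b :
  \int[P]_w cos (t * prm_centered w + b) =
  expR (- \int[m]_x (1 - cos (t * h x))) *
  cos (b - \int[m]_x (t * h x - sin (t * h x))).
Proof.
have isin : m.-integrable setT (EFin \o (fun x => sin (t * h x))).
  have -> : (fun x => sin (t * h x)) =
      (fun x => t * h x - (t * h x - sin (t * h x))).
    by apply/funext => x; ring.
  exact: (integrableB measurableT (ihZ t) (integrable_sub_sin t)).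
have := prm_cos prmN (b - t * \int[m]_x h x) (ihZ t).
have -> : \int[m]_x (cos (t * h x) - 1) = - \int[m]_x (1 - cos (t * h x)).
  rewrite -[RHS]mulN1r -RintegralZl//; last exact: integrable_onem_cos.
  by apply: eq_Rintegral => x _; rewrite mulN1r opprB.
have -> : \int[m]_x sin (t * h x) + (b - t * \int[m]_x h x) =
    b - \int[m]_x (t * h x - sin (t * h x)).
  by rewrite RintegralB// RintegralZl//; ring.
move=> <-; rewrite /Rintegral; congr fine; apply: ae_eq_integral => //.
- apply/measurable_EFinP; apply: (measurableT_comp (@measurable_cos R)).
  by apply: measurable_funD => //; apply: measurable_funM => //; exact: measurable_prm_centered.
- apply/measurable_EFinP; apply: (measurableT_comp (@measurable_cos R)).
  apply: measurable_funD => //; apply: measurable_prm_functional.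
  exact: measurable_funM.
have := prm_integrable_ae prmN ih; apply: filterS => w iw _.
congr (EFin (cos _)); rewrite [X in _ = X + _]RintegralZl// /prm_centered.
rewrite -/(\int[m]_x h x).
by ring.
Qed.

(* Fatou's lemma for [2 (1 - cos (t Y)) / t ^+ 2], as [t] tends to [0]. *)
Lemma prm_centered_sqr_le :
  (\int[P]_w (prm_centered w ^+ 2)%:E <= (\int[m]_x (h x ^+ 2))%:E)%E.
Proof.
set V := \int[m]_x (h x ^+ 2).
have V0 : 0 <= V by apply: Rintegral_ge0 => x _; exact: sqr_ge0.
pose t (n : nat) : R := n.+1%:R^-1.
have t0 n : 0 < t n by rewrite invr_gt0.
pose F (n : nat) w : R := 2 / t n ^+ 2 * (1 - cos (t n * prm_centered w)).
have F0 n w : 0 <= F n w.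
  by rewrite mulr_ge0 ?onem_cos_ge0// divr_ge0// sqr_ge0.
have mF n : measurable_fun setT (F n).
  apply: measurable_funM => //; apply: measurable_funB => //.
  apply: (measurableT_comp (@measurable_cos R)).
  by apply: measurable_funM => //; exact: measurable_prm_centered.
have tcvg : t n @[n --> \oo] --> 0 by exact: cvg_harmonic.
have Fcvg w : F n w @[n --> \oo] --> prm_centered w ^+ 2.
  set y := prm_centered w.
  have key n : `|y ^+ 2 - F n w| <= 2 * `|y| ^+ 3 * t n.
    have -> : y ^+ 2 - F n w =
        - (2 / t n ^+ 2) * (1 - cos (t n * y) - (t n * y) ^+ 2 / 2).
      by rewrite /F -/y; field; rewrite gt_eqF.
    have c0 : 0 <= 2 / t n ^+ 2 by rewrite divr_ge0 ?sqr_ge0.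
    rewrite normrM normrN (ger0_norm c0).
    apply: (@le_trans _ _ (2 / t n ^+ 2 * `|t n * y| ^+ 3)).
      by rewrite ler_wpM2l// norm_onem_cos_sub.
    rewrite normrM (gtr0_norm (t0 n)) le_eqVlt; apply/orP; left; apply/eqP.
    by field; rewrite gt_eqF.
  apply/cvgrPdist_le => e e0.
  have h2 : 2 * `|y| ^+ 3 * t n @[n --> \oo] --> 0.
    rewrite -[X in _ --> X](mulr0 (2 * `|y| ^+ 3)).
    by apply: cvgM => //; exact: cvg_cst.
  move/cvgrPdist_le : h2 => /(_ _ e0); apply: filterS => n.
  rewrite sub0r normrN => /(le_trans (ler_norm _)) h2.
  exact: le_trans (key n) h2.
have mean n : \int[P]_w F n w <= V + t n ^+ 2 * (V ^+ 2 / 4).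
  have ic : P.-integrable setT (EFin \o (fun w => cos (t n * prm_centered w))).
    apply: (@bounded_integrable _ _ _ P _ 1).
      apply: (measurableT_comp (@measurable_cos R)).
      by apply: measurable_funM => //; exact: measurable_prm_centered.
    by move=> w; rewrite ler_norml cos_geN1 cos_le1.
  have i1 : P.-integrable setT (EFin \o (fun w => 1 - cos (t n * prm_centered w))).
    apply: (@bounded_integrable _ _ _ P _ 2).
      apply: measurable_funB => //; apply: (measurableT_comp (@measurable_cos R)).
      by apply: measurable_funM => //; exact: measurable_prm_centered.
    move=> w; rewrite ger0_norm ?onem_cos_ge0//.
    have := cos_geN1 (t n * prm_centered w); lra.
  rewrite RintegralZl// RintegralB//; last first.
    by apply: (@bounded_integrable _ _ _ P (cst 1) 1) => // w; rewrite normr1.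
  rewrite Rintegral_prob_cst.
  have := prm_centered_cos (t n) 0.
  under eq_Rintegral do rewrite addr0.
  move=> ->.
  set A := \int[m]_x _; set B := \int[m]_x _; rewrite add0r cosN.
  have A0 : 0 <= A by apply: Rintegral_ge0 => x _; exact: onem_cos_ge0.
  have AV : A <= t n ^+ 2 / 2 * V.
    rewrite -RintegralZl//; apply: le_Rintegral => //.
    - exact: integrable_onem_cos.
    - exact: (integrableZl measurableT _ ih2).
    - by move=> x _; rewrite (le_trans (onem_cos_le _))// exprMn mulrAC.
  have BV : `|B| <= t n ^+ 2 / 2 * V.
    rewrite (le_trans (le_normr_Rintegral measurableT (integrable_sub_sin _)))//.
    rewrite -RintegralZl//; apply: le_Rintegral => //.
    - exact: integrable_abse (integrable_sub_sin _).
    - exact: (integrableZl measurableT _ ih2).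
    - by move=> x _; rewrite (le_trans (norm_sub_sin_le2 _))// exprMn mulrAC.
  (* Both [A] and the absolute value of [B] are at most [t n ^+ 2 / 2 * V]. Hence [B ^+ 2] is of
     order 4 in [t n], and only [A] survives the division by [t n ^+ 2]. *)
  have e1 : 1 - expR (- A) * cos B <= A + B ^+ 2 / 2.
    have h1 := expR_ge1Dx (- A).
    have h2 := onem_cos_le B; have h3 := onem_cos_ge0 B.
    have h4 : expR (- A) <= 1 by rewrite -expR0 ler_expR oppr_le0.
    have h5 := expR_ge0 (- A).
    move: h1 h2 h3 h4 h5; move: (expR _) (cos B) (B ^+ 2) => x y z; nra.
  have B2 : B ^+ 2 <= (t n ^+ 2 / 2 * V) ^+ 2.
    rewrite -(real_normK (num_real B)) lerXn2r// nnegrE//.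
    by rewrite mulr_ge0// divr_ge0// sqr_ge0.
  rewrite mulrAC ler_pdivrMr ?exprn_gt0//.
  apply: (@le_trans _ _ (2 * (A + B ^+ 2 / 2))); first by rewrite ler_wpM2l.
  rewrite (_ : _ * t n ^+ 2 = 2 * (t n ^+ 2 / 2 * V + (t n ^+ 2 / 2 * V) ^+ 2 / 2)); last by field.
  by rewrite ler_wpM2l// lerD// ler_wpM2r.
have iF n : P.-integrable setT (EFin \o F n).
  apply: (@bounded_integrable _ _ _ P _ (2 / t n ^+ 2 * 2)) => // w.
  have c0 : 0 <= 2 / t n ^+ 2 by apply: divr_ge0 => //; exact: sqr_ge0.
  rewrite ger0_norm// ler_wpM2l//.
  have := cos_geN1 (t n * prm_centered w); lra.
apply/lee_addgt0Pr => e e0.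
pose K n := V + t n ^+ 2 * (V ^+ 2 / 4).
have Kcvg : K n @[n --> \oo] --> V.
  rewrite -[X in _ --> X]addr0 -[X in _ + X](mul0r (V ^+ 2 / 4)).
  apply: cvgD; first exact: cvg_cst.
  apply: cvgM; last exact: cvg_cst.
  rewrite -[X in _ --> X](mulr0 (0 : R)); under eq_fun do rewrite expr2.
  exact: cvgM.
(* Fatou's lemma is applied beyond the index [n0] from which the bound on the means is at most
   [V + e]. *)
have [n0 _ Kn0] : \forall n \near \oo, K n <= V + e.
  move/cvgrPdist_le : Kcvg => /(_ _ e0); apply: filterS => n.
  by rewrite ler_distlC => /andP[].
have mF' n : measurable_fun setT (EFin \o F (n + n0)%N) by exact/measurable_EFinP.
have := fatou P measurableT mF' (fun n w _ => F0 (n + n0)%N w).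
have -> : (\int[P]_w limn_einf ((fun n => (EFin \o F (n + n0)%N) w)) =
    \int[P]_w (prm_centered w ^+ 2)%:E)%E.
  apply: eq_integral => w _.
  have c : (EFin \o F (n + n0)%N) w @[n --> \oo] --> (prm_centered w ^+ 2)%:E.
    apply: cvg_EFin; first exact: nearW.
    by have := Fcvg w; rewrite -(cvg_shiftn n0).
  by rewrite is_cvg_limn_einfE; [exact/cvg_lim|apply/cvg_ex; eexists; exact: c].
move/le_trans; apply; rewrite limn_einf_lim; apply: lime_le.
  exact: is_cvg_einfs.
apply: nearW => n; apply: (@le_trans _ _ (\int[P]_w (F (n + n0)%N w)%:E)%E).
  by apply: ereal_inf_lbound; exists n => /=.
rewrite -EFin_Rintegral// -EFinD lee_fin (le_trans (mean _))// Kn0//=.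
exact: leq_addl.
Qed.

End centered_functional.

(** * Normalized integrals against a sequence of Poisson random measures *)

Section poisson_limit.
Variables (d' : measure_display) (T : measurableType d') (R : realType).
Variable M : {measure set T -> \bar R}.
Variables (d : nat -> measure_display) (O : forall n, measurableType (d n)).
Variable P : forall n, probability (O n) R.
Variable N : forall n, R.-ker (O n) ~> T.
Variable m : nat -> {measure set T -> \bar R}.
Hypothesis prmN : forall n, poisson_random_measure (P n) (N n) (m n).
Variables (g : nat -> T -> R) (g' : T -> R) (s : nat -> R) (K : R) (h : T -> R).
Hypothesis mg : forall n, measurable_fun setT (g n).
Hypothesis g0 : forall n x, 0 <= g n x.
Hypothesis mE : forall n A, measurable A -> m n A = (\int[M]_(x in A) (g n x)%:E)%E.
Hypothesis s0 : forall n, 0 < s n.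
Hypothesis sy : s n @[n --> \oo] --> +oo.
Hypothesis mg' : measurable_fun setT g'.
Hypothesis gle : forall n x, g n x / s n ^+ 2 <= K * g' x.
Hypothesis gcvg : forall x, g n x / s n ^+ 2 @[n --> \oo] --> g' x.
Hypothesis ih : forall n, (m n).-integrable setT (EFin \o h).
Hypothesis ih2 : M.-integrable setT (EFin \o (fun x => h x ^+ 2 * g' x)).

Let mh : measurable_fun setT h.
Proof. by case/integrableP : (ih 0) => /measurable_EFinP. Qed.

Let K0 x : 0 <= K * g' x.
Proof. by apply: le_trans (gle 0 x); rewrite divr_ge0// sqr_ge0. Qed.

Let ihs n : (m n).-integrable setT (EFin \o (fun x => (s n)^-1 * h x)).
Proof. exact: (integrableZl measurableT _ (ih n)). Qed.

Let ihs2 n : (m n).-integrable setT (EFin \o (fun x => ((s n)^-1 * h x) ^+ 2)).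
Proof.
have mX : measurable_fun setT (fun x => ((s n)^-1 * h x) ^+ 2).
  by apply: measurable_funX; exact: measurable_funM.
apply/(integrable_density (mg n) (g0 n) (mE n) mX).
have iK := integrableZl measurableT K ih2.
apply: le_integrable iK => //.
  by apply/measurable_EFinP; exact: measurable_funM.
move=> x _ /=; rewrite lee_fin ger0_norm; last first.
  exact: mulr_ge0 (sqr_ge0 _) (g0 n x).
rewrite (le_trans _ (ler_norm _))//.
rewrite (_ : _ * g n x = h x ^+ 2 * (g n x / s n ^+ 2)); last first.
  by rewrite exprMn exprVn; ring.
by rewrite [leRHS]mulrCA ler_wpM2l ?sqr_ge0.
Qed.

Let Y n (w : O n) : R := (\int[N n w]_x h x - \int[P n]_w (\int[N n w]_x h x)) / s n.

(** Campbell's formula identifies the mean, and almost sure integrability of [h] lets the factor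
    [(s n)^-1] enter the random integral. *)
Lemma poisson_limit_ae n :
  {ae P n, forall w, Y w = prm_centered (N n) (m n) (fun x => (s n)^-1 * h x) w}.
Proof.
have := prm_integrable_ae (prmN n) (ih n); apply: filterS => w iw.
rewrite /Y /prm_centered (prm_functional_mean (prmN n) (ih n)) !RintegralZl//.
by rewrite mulrBl ![_ / s n]mulrC.
Qed.

Lemma measurable_poisson_limit n : measurable_fun setT (@Y n).
Proof.
apply: measurable_funM => //; apply: measurable_funB => //.
exact: measurable_prm_functional.
Qed.

(** The factor [s n ^- 2] of the squared integrand is moved onto the density, where [gle] bounds it
    by [K * g']. *)
Lemma poisson_limit_sqr n :
  (\int[P n]_w (Y w ^+ 2)%:E <= (K * \int[M]_x (h x ^+ 2 * g' x))%:E)%E.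
Proof.
have := prm_centered_sqr_le (prmN n) (ihs n) (ihs2 n).
rewrite (Rintegral_density (mg n) (g0 n) (mE n)); last first.
  by apply: measurable_funX; exact: measurable_funM.
move=> le1; apply: (le_trans _ (le_trans le1 _)).
  rewrite le_eqVlt; apply/orP; left; apply/eqP; apply: ae_eq_integral => //.
  - by apply/measurable_EFinP; apply: measurable_funX; exact: measurable_poisson_limit.
  - apply/measurable_EFinP; apply: measurable_funX.
    by apply: measurable_prm_centered; exact: ihs.
  by have := poisson_limit_ae n; apply: filterS => w ->.
rewrite lee_fin -RintegralZl//; apply: le_Rintegral => //.
- apply: (integrable_density (mg n) (g0 n) (mE n) _).1; last exact: ihs2.
  by apply: measurable_funX; exact: measurable_funM.
- exact: (integrableZl measurableT K ih2).
move=> x _; rewrite (_ : _ * g n x = h x ^+ 2 * (g n x / s n ^+ 2)); last first.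
  by rewrite exprMn exprVn; ring.
by rewrite [leRHS]mulrCA ler_wpM2l ?sqr_ge0.
Qed.

Let scvg (F : R -> R) (c a : R) x : 0 <= c ->
  (forall y, `|F y - a * y ^+ 2| <= c * `|y| ^+ 3) ->
  s n ^+ 2 * F ((s n)^-1 * h x) @[n --> \oo] --> a * h x ^+ 2.
Proof.
move=> c0 Fa.
have key n : `|a * h x ^+ 2 - s n ^+ 2 * F ((s n)^-1 * h x)| <= c * `|h x| ^+ 3 * (s n)^-1.
  have -> : a * h x ^+ 2 - s n ^+ 2 * F ((s n)^-1 * h x) =
     - (s n ^+ 2) * (F ((s n)^-1 * h x) - a * ((s n)^-1 * h x) ^+ 2).
    by field; rewrite gt_eqF.
  rewrite normrM normrN (ger0_norm (sqr_ge0 _)).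
  apply: (@le_trans _ _ (s n ^+ 2 * (c * `|(s n)^-1 * h x| ^+ 3))).
    by rewrite ler_wpM2l ?sqr_ge0.
  rewrite normrM gtr0_norm ?invr_gt0// le_eqVlt; apply/orP; left; apply/eqP.
  by field; rewrite gt_eqF.
have sV : (s n)^-1 @[n --> \oo] --> 0.
  by apply/gtr0_cvgV0 => //; near=> n.
have h2 : c * `|h x| ^+ 3 * (s n)^-1 @[n --> \oo] --> 0.
  rewrite -[X in _ --> X](mulr0 (c * `|h x| ^+ 3)).
  by apply: cvgM => //; exact: cvg_cst.
apply/cvgrPdist_le => e e0.
move/cvgrPdist_le : h2 => /(_ _ e0); apply: filterS => n.
rewrite sub0r normrN => /(le_trans (ler_norm _)) h2.
exact: le_trans (key n) h2.
Unshelve. all: by end_near. Qed.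

(** Written against [M], the integrand is [s n ^+ 2 * F (h x / s n)] times [g n x / s n ^+ 2]; it
    converges pointwise and is dominated by [K / 2 * (h x ^+ 2 * g' x)]. The coefficient [a] is half
    of the second derivative of [F] at 0: [1 / 2] for [1 - cos y], and 0 for [y - sin y]. *)
Let exponent_cvg (F : R -> R) (c a : R) : measurable_fun setT F -> 0 <= c ->
  (forall y, `|F y - a * y ^+ 2| <= c * `|y| ^+ 3) ->
  (forall y, `|F y| <= y ^+ 2 / 2) ->
  \int[m n]_x F ((s n)^-1 * h x) @[n --> \oo] -->
  a * \int[M]_x (h x ^+ 2 * g' x).
Proof.
move=> mF c0 Fa F2.
have mFh n : measurable_fun setT (fun x => F ((s n)^-1 * h x)).
  by apply: (measurableT_comp mF); exact: measurable_funM.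
have mFg n : measurable_fun setT (EFin \o (fun x => F ((s n)^-1 * h x) * g n x)).
  by apply/measurable_EFinP; exact: measurable_funM.
have mhg : measurable_fun setT (EFin \o (fun x => a * (h x ^+ 2 * g' x))).
  by apply/measurable_EFinP; apply: measurable_funM => //; apply: measurable_funM => //; exact: measurable_funX.
have bound n x : `|F ((s n)^-1 * h x) * g n x| <= K / 2 * (h x ^+ 2 * g' x).
  rewrite normrM (ger0_norm (g0 n x)).
  apply: (@le_trans _ _ (((s n)^-1 * h x) ^+ 2 / 2 * g n x)).
    by rewrite ler_wpM2r.
  rewrite (_ : _ * g n x = h x ^+ 2 / 2 * (g n x / s n ^+ 2)); last first.
    by rewrite exprMn exprVn; ring.
  rewrite (_ : K / 2 * _ = h x ^+ 2 / 2 * (K * g' x)); last by ring.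
  by rewrite ler_wpM2l ?divr_ge0 ?sqr_ge0.
have ptw x : F ((s n)^-1 * h x) * g n x @[n --> \oo] --> a * (h x ^+ 2 * g' x).
  rewrite mulrA.
  rewrite (_ : (fun n => _) = (fun n => (s n ^+ 2 * F ((s n)^-1 * h x)) *
    (g n x / s n ^+ 2))).
    by apply: cvgM => //; exact: (@scvg F c a x c0 Fa).
  by apply/funext => n; field; rewrite gt_eqF.
have aec : {ae M, forall x, setT x ->
    (EFin \o (fun x => F ((s n)^-1 * h x) * g n x)) x @[n --> \oo] -->
    (EFin \o (fun x => a * (h x ^+ 2 * g' x))) x}.
  by apply: aeW => x _; apply: cvg_EFin; [exact: nearW|exact: ptw].
have ael : {ae M, forall x n, setT x ->
    (`|(F ((s n)^-1 * h x) * g n x)%:E| <= (K / 2 * (h x ^+ 2 * g' x))%:E)%E}.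
  by apply: aeW => x n _; rewrite /= lee_fin.
have idom := integrableZl measurableT (K / 2) ih2.
have [_ _] := dominated_convergence measurableT mFg mhg aec idom ael.
have ia := integrableZl measurableT a ih2.
rewrite -[X in _ --> X](fineK (integrable_fin_num measurableT ia)).
move=> /fine_cvgP[_].
rewrite -[X in _ --> X -> _]/(\int[M]_x (a * (h x ^+ 2 * g' x))) RintegralZl//.
move=> hc; rewrite (_ : (fun n => \int[m n]_x F ((s n)^-1 * h x)) =
  (fun n => \int[M]_x (F ((s n)^-1 * h x) * g n x))); first exact: hc.
by apply/funext => n; rewrite (Rintegral_density (mg n) (g0 n) (mE n)).
Qed.

Lemma poisson_limit_cos b :
  \int[P n]_w cos (@Y n w + b) @[n --> \oo] -->
  expR (- (\int[M]_x (h x ^+ 2 * g' x) / 2)) * cos b.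
Proof.
set V := \int[M]_x _.
have hA : \int[m n]_x (1 - cos ((s n)^-1 * h x)) @[n --> \oo] --> V / 2.
  rewrite mulrC; apply: (exponent_cvg (F := fun y => 1 - cos y) (c := 1)) => //.
  - by apply: measurable_funB => //; exact: measurable_cos.
  - by move=> y; rewrite mul1r [_^-1 * _]mulrC norm_onem_cos_sub.
  - by move=> y; rewrite ger0_norm ?onem_cos_ge0// onem_cos_le.
have hB : \int[m n]_x ((s n)^-1 * h x - sin ((s n)^-1 * h x)) @[n --> \oo] --> (0 : R).
  rewrite -[X in _ --> X](mul0r V).
  apply: (exponent_cvg (F := fun y => y - sin y) (c := 6^-1)).
  - by apply: measurable_funB => //; exact: measurable_sin.
  - by rewrite invr_ge0.
  - by move=> y; rewrite mul0r subr0 mulrC norm_sub_sin_le3.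
  - exact: norm_sub_sin_le2.
have E n : \int[P n]_w cos (@Y n w + b) =
    expR (- \int[m n]_x (1 - cos ((s n)^-1 * h x))) *
    cos (b - \int[m n]_x ((s n)^-1 * h x - sin ((s n)^-1 * h x))).
  have := prm_centered_cos (prmN n) (ihs n) (ihs2 n) 1 b.
  under [X in expR (- X)]eq_Rintegral do rewrite mul1r.
  under [X in cos (b - X)]eq_Rintegral do rewrite mul1r.
  move=> <-; rewrite /Rintegral; congr fine; apply: ae_eq_integral => //.
  - apply/measurable_EFinP; apply: (measurableT_comp (@measurable_cos R)).
    by apply: measurable_funD => //; exact: measurable_poisson_limit.
  - apply/measurable_EFinP; apply: (measurableT_comp (@measurable_cos R)).
    apply: measurable_funD => //; apply: measurable_funM => //.
    by apply: measurable_prm_centered; exact: ihs.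
  by have := poisson_limit_ae n; apply: filterS => w -> _; rewrite mul1r.
rewrite (_ : (fun n => _) = (fun n => expR (- \int[m n]_x (1 - cos ((s n)^-1 * h x))) *
    cos (b - \int[m n]_x ((s n)^-1 * h x - sin ((s n)^-1 * h x))))); last first.
  by apply/funext => n; exact: E.
apply: cvgM.
  apply: (@continuous_cvg _ _ _ _ _ _ (@expR R)); first exact: continuous_expR.
  exact: cvgN.
rewrite -[X in _ --> cos X]subr0.
apply: (@continuous_cvg _ _ _ _ _ _ (@cos R)); first exact: continuous_cos.
by apply: cvgB => //; exact: cvg_cst.
Qed.

End poisson_limit.

(** * Lebesgue measure and the sphere *)

(* The sigma-finite structure of a product measure is not found by unification,
   being shadowed by that of subprobabilities. *)
Section sigma_finite_pack.
Variables (d : measure_display) (T : measurableType d) (R : realType).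
Variables (mu : {measure set T -> \bar R}) (smu : sigma_finite setT mu).

Definition sigma_finite_fun of sigma_finite setT mu : set T -> \bar R := mu.

HB.instance Definition _ := Measure.copy (sigma_finite_fun smu) mu.
HB.instance Definition _ :=
  Measure_isSigmaFinite.Build _ _ _ (sigma_finite_fun smu) smu.

Definition sigma_finite_pack : {sigma_finite_measure set T -> \bar R} :=
  sigma_finite_fun smu.

End sigma_finite_pack.

(** * Lebesgue measure on tuples: translations and cubes *)

Section translation.
Context {R : realType}.

Definition tuple_add n (x v : n.-tuple R) : n.-tuple R :=
  [tuple tnth x i + tnth v i | i < n].

Definition tuple_opp n (x : n.-tuple R) : n.-tuple R := [tuple - tnth x i | i < n].

Lemma measurable_tuple_add n d (T : measurableType d) (f g : T -> n.-tuple R) :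
  measurable_fun setT f -> measurable_fun setT g ->
  measurable_fun setT (fun x => tuple_add (f x) (g x)).
Proof.
move=> /measurable_fun_tnthP mf /measurable_fun_tnthP mg.
apply/measurable_fun_tnthP => i.
rewrite (_ : _ \o _ = fun x => tnth (f x) i + tnth (g x) i).
  by apply: measurable_funD; [exact: mf|exact: mg].
by apply/funext => x /=; rewrite tnth_mktuple.
Qed.

Lemma measurable_tuple_opp n d (T : measurableType d) (f : T -> n.-tuple R) :
  measurable_fun setT f -> measurable_fun setT (fun x => tuple_opp (f x)).
Proof.
move=> /measurable_fun_tnthP mf.
apply/measurable_fun_tnthP => i.
rewrite (_ : _ \o _ = fun x => - tnth (f x) i).
  by apply: measurableT_comp => //; exact: mf.
by apply/funext => x /=; rewrite tnth_mktuple.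
Qed.

Lemma lebesgue_measure_translation (v : R) (A : set R) : measurable A ->
  lebesgue_measure [set t | A (t + v)] = lebesgue_measure A.
Proof.
move=> mA.
have mv : measurable_fun setT ((fun t => t + v) : measurableTypeR R -> measurableTypeR R).
  exact: measurable_funD.
pose nu : {measure set (measurableTypeR R) -> \bar R} :=
  measure_function_pushforward__canonical__measure_function_Measure lebesgue_measure mv.
rewrite -[LHS]/(nu A); apply/esym/(lebesgue_measure_unique (mu := nu)) => // _ [[a b]] _ <-.
rewrite /nu /= /pushforward.
have -> : (fun t => t + v) @^-1` `]a, b] = `]a - v, b - v]%classic.
  by apply/seteqP; split => t /=; rewrite !in_itv/= ltrBlDr lerBrDr.
rewrite !lebesgue_measure_itv/= !lte_fin ltrD2r.
by case: ifP => // _; rewrite -!EFinB; congr EFin; ring.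
Qed.

Lemma lebesgue_tupleSE n (A : set (n.+1.-tuple R)) : measurable A ->
  lebesgue_tuple n.+1 A =
  (\int[lebesgue_tuple n]_x lebesgue_measure [set t | A (tuple_cons (x, t))])%E.
Proof.
move=> mA; rewrite /= /lebesgue_tuple_step /pushforward /product_measure1.
apply: eq_integral => x _ /=; congr (lebesgue_measure _).
by apply/seteqP; split => t /=; [move/xsectionP|move=> ?; exact/xsectionP].
Qed.

Let measurable_section n (A : set (n.+1.-tuple R)) : measurable A ->
  measurable_fun setT (fun x => lebesgue_measure [set t : R | A (tuple_cons (x, t))]).
Proof.
move=> mA.
have mB : measurable ((@tuple_cons R n) @^-1` A).
  by rewrite -[X in measurable X]setTI; exact: measurable_tuple_cons.
have := measurable_fun_xsection (@lebesgue_measure R) mB.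
apply: eq_measurable_fun => x _ /=; congr (lebesgue_measure _).
by apply/seteqP; split => t /=; [move/xsectionP|move=> ?; exact/xsectionP].
Qed.

Lemma measurable_translate n (v : n.-tuple R) (A : set (n.-tuple R)) :
  measurable A -> measurable [set x | A (tuple_add x v)].
Proof.
move=> mA; rewrite -[X in measurable X]setTI.
by apply: (measurable_tuple_add (f := id) (g := cst v)).
Qed.

Lemma ge0_integral_invariant d (T : measurableType d) (nu : {measure set T -> \bar R})
    (h : T -> T) (f : T -> \bar R) : measurable_fun setT h ->
  (forall A, measurable A -> nu (h @^-1` A) = nu A) ->
  measurable_fun setT f -> (forall x, 0 <= f x)%E ->
  (\int[nu]_x f (h x) = \int[nu]_x f x)%E.
Proof.
move=> mh nuh mf f0.
rewrite -[LHS](ge0_integral_pushforward mh nu measurableT mf (fun x _ => f0 x)).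
by apply: eq_measure_integral => A mA _; exact: nuh.
Qed.

Lemma inord_lift0 n (j : 'I_n) : inord j.+1 = lift ord0 j.
Proof. by apply/val_inj; rewrite /= inordK// ltnS. Qed.

Lemma tuple_add_cons n (x : n.-tuple R) t (v : n.+1.-tuple R) :
  tuple_add (tuple_cons (x, t)) v =
  tuple_cons (tuple_add x [tuple of behead v], t + thead v).
Proof.
apply: eq_from_tnth => i; rewrite tnth_mktuple /tuple_cons.
case: (unliftP ord0 i) => [j ->|->]; last by rewrite !tnth0.
by rewrite !tnthS tnth_mktuple tnth_behead inord_lift0.
Qed.

Lemma measurable_tuple_section n (A : set (n.+1.-tuple R)) (x : n.-tuple R) :
  measurable A -> measurable [set t : R | A (tuple_cons (x, t))].
Proof.
move=> mA.
have mB : measurable ((@tuple_cons R n) @^-1` A).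
  by rewrite -[X in measurable X]setTI; exact: measurable_tuple_cons.
have := measurable_xsection x mB.
by congr measurable; apply/seteqP; split => t /=; [move/xsectionP|move=> ?; exact/xsectionP].
Qed.

(** By induction on the dimension: the head is translated inside each section, and the tail by
    translating the variable of integration. *)
Lemma lebesgue_tuple_translation n (v : n.-tuple R) (A : set (n.-tuple R)) :
  measurable A -> lebesgue_tuple n [set x | A (tuple_add x v)] = lebesgue_tuple n A.
Proof.
elim: n v A => [|n IH] v A mA.
  congr (lebesgue_tuple 0 _); apply/seteqP; split => x /=;
    by rewrite (tuple0 x) (tuple0 (tuple_add _ _)).
rewrite !lebesgue_tupleSE//; last exact: measurable_translate.
pose f x := lebesgue_measure [set t : R | A (tuple_cons (x, t))].
transitivity (\int[lebesgue_tuple n]_x f (tuple_add x [tuple of behead v]))%E.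
  apply: eq_integral => x _; rewrite /f.
  rewrite -[RHS](lebesgue_measure_translation (thead v)); last exact: measurable_tuple_section.
  congr (lebesgue_measure _); apply/seteqP; split => t /=;
  by rewrite tuple_add_cons.
apply: (ge0_integral_invariant (h := fun x => tuple_add x [tuple of behead v])) => //.
- exact: measurable_tuple_add.
- by move=> B mB; exact: IH.
- exact: measurable_section.
Qed.

Definition tuple_cube n (a : n.-tuple R) (c : R) : set (n.-tuple R) :=
  [set x | forall i, tnth a i <= tnth x i <= tnth a i + c].

Lemma measurable_tuple_cube n (a : n.-tuple R) c : measurable (tuple_cube a c).
Proof.
have -> : tuple_cube a c =
    \big[setI/setT]_(i < n) ((@tnth n R)^~ i @^-1` `[tnth a i, tnth a i + c]).
  rewrite -bigcap_seq; apply/seteqP; split => x /=.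
    by move=> h i _ /=; rewrite in_itv/= h.
  by move=> h i; have := h i (mem_index_enum _); rewrite /= in_itv.
apply: bigsetI_measurable => i _; rewrite -[X in measurable X]setTI.
exact: measurable_tnth.
Qed.

Lemma lebesgue_tuple_cube n (a : n.-tuple R) c : 0 <= c ->
  lebesgue_tuple n (tuple_cube a c) = (c ^+ n)%:E.
Proof.
move=> c0; elim: n a => [|n IH] a.
  by rewrite /= diracE mem_set//= => i; case: i.
rewrite lebesgue_tupleSE; last exact: measurable_tuple_cube.
pose a' := [tuple of behead a].
transitivity (\int[lebesgue_tuple n]_x (c%:E * (\1_(tuple_cube a' c) x)%:E))%E.
  apply: eq_integral => x _.
  have E t : tuple_cube a c (tuple_cons (x, t)) <->
      (tuple_cube a' c x /\ thead a <= t <= thead a + c).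
    split=> [h|[h ht] i].
      split=> [i|]; last by have := h ord0; rewrite tnth0.
      by have := h (lift ord0 i); rewrite tnthS tnth_behead inord_lift0.
    case: (unliftP ord0 i) => [j ->|->]; last by rewrite tnth0.
    by rewrite tnthS; have := h j; rewrite tnth_behead inord_lift0.
  rewrite indicE; have [/set_mem Cx|Cx] := boolP (x \in tuple_cube a' c).
    rewrite mule1 (_ : [set t | _] = `[thead a, thead a + c]%classic).
      rewrite lebesgue_measure_itv/= lte_fin ltrDl; case: ltP => [_|c1].
        by rewrite -EFinB addrAC subrr add0r.
      by congr EFin; apply/eqP; rewrite eq_le c0 c1.
    by apply/seteqP; split => t /=; rewrite in_itv/= => h; [case/E: h|exact/E].
  rewrite mule0 (_ : [set t | _] = set0) ?measure0//.
  by apply/seteqP; split => // t /= /E[Cx' _]; move/negP : Cx; apply; exact/mem_set.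
rewrite ge0_integralZl_EFin//; last first.
  by apply/measurable_EFinP; apply: measurable_indic; exact: measurable_tuple_cube.
rewrite integral_indic ?setIT; [|exact: measurableT|exact: measurable_tuple_cube].
by rewrite IH -EFinM exprS.
Qed.

Lemma lebesgue_tuple_sigma_finite n : sigma_finite setT (@lebesgue_tuple R n).
Proof.
pose C (k : nat) := tuple_cube [tuple (- k%:R : R) | i < n] (2 * k%:R).
exists C => [|k]; last first.
  split; first exact: measurable_tuple_cube.
  by rewrite /C lebesgue_tuple_cube ?mulr_ge0// ltry.
apply/esym; rewrite -subTset => x _.
pose k := Num.bound (\sum_i `|tnth x i|).
exists k => // i; rewrite tnth_mktuple.
have xk : `|tnth x i| <= k%:R.
  apply: (@le_trans _ _ (\sum_i `|tnth x i|)).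
    by rewrite (bigD1 i)//= lerDl sumr_ge0.
  by rewrite ltW// archi_boundP// sumr_ge0.
by move: xk; rewrite ler_norml => /andP[]; lra.
Qed.

End translation.

(** * Invariance under linear isometric involutions *)

Section orthogonal_invariance.
Context {R : realType}.
Variable n : nat.
Implicit Types (A B : set (n.-tuple R)).

Let T := n.-tuple R.

Definition tuple_dot (x y : T) : R := \sum_i tnth x i * tnth y i.

Lemma tuple_addK (v x : T) : tuple_add (tuple_add x v) (tuple_opp v) = x.
Proof.
by apply: eq_from_tnth => i; rewrite !tnth_mktuple addrK.
Qed.

Lemma measurable_tuple_preimage (h : T -> T) A :
  measurable_fun setT h -> measurable A -> measurable (h @^-1` A).
Proof. by move=> mh mA; rewrite -[X in measurable X]setTI; exact: mh. Qed.

(* Both sides compute the integral of [1_A(x) 1_B(x + y)] against nu(dx) la(dy). *)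
Lemma translation_invariant_unique (nu la : {sigma_finite_measure set T -> \bar R}) A B :
  (forall v C, measurable C -> nu [set x | C (tuple_add x v)] = nu C) ->
  (forall v C, measurable C -> la [set x | C (tuple_add x v)] = la C) ->
  measurable A -> measurable B ->
  (nu A * la B = nu B * la (tuple_opp (n := n) @^-1` A))%E.
Proof.
move=> nuT laT mA mB.
have mI C : measurable C -> measurable_fun setT (fun x : T => (\1_C x)%:E : \bar R).
  by move=> mC; apply/measurable_EFinP; exact: measurable_indic.
have maddT : measurable_fun setT (fun p : T * T => tuple_add p.1 p.2).
  exact: measurable_tuple_add.
have msubT : measurable_fun setT (fun p : T * T => tuple_add p.1 (tuple_opp p.2)).
  by apply: measurable_tuple_add => //; exact: measurable_tuple_opp.
pose F (p : T * T) : \bar R := ((\1_A p.1)%:E * (\1_B (tuple_add p.1 p.2))%:E)%E.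
have mF : measurable_fun setT F.
  apply: emeasurable_funM.
    by apply: (measurableT_comp (mI _ mA)).
  by apply: (measurableT_comp (mI _ mB)).
have F0 p : (0 <= F p)%E by rewrite mule_ge0// lee_fin.
pose G (p : T * T) : \bar R := ((\1_A (tuple_add p.1 (tuple_opp p.2)))%:E * (\1_B p.1)%:E)%E.
have mG : measurable_fun setT G.
  apply: emeasurable_funM.
    by apply: (measurableT_comp (mI _ mA)).
  by apply: (measurableT_comp (mI _ mB)).
have G0 p : (0 <= G p)%E by rewrite mule_ge0// lee_fin.
have e1 : (\int[nu]_x \int[la]_y F (x, y) = nu A * la B)%E.
  transitivity (\int[nu]_x ((\1_A x)%:E * la B))%E.
    apply: eq_integral => x _; rewrite /F /= ge0_integralZl_EFin//; last first.
      by apply: (measurableT_comp (mI _ mB)); exact: measurable_tuple_add.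
    congr (_ * _)%E; rewrite -(laT x B mB).
    rewrite (_ : (fun y => _) = EFin \o \1_[set y | B (tuple_add y x)]).
      rewrite integral_indic ?setIT//; exact: measurable_translate.
    apply/funext => y /=; congr EFin; rewrite !indicE; congr (nat_of_bool _)%:R.
    have -> : tuple_add x y = tuple_add y x.
      by apply: eq_from_tnth => i; rewrite !tnth_mktuple addrC.
    by apply/idP/idP => /set_mem h; exact/mem_set.
  rewrite ge0_integralZr//; last exact: mI.
  by rewrite integral_indic// setIT.
have e2 : (\int[la]_y \int[nu]_x F (x, y) = \int[la]_y \int[nu]_x G (x, y))%E.
  apply: eq_integral => y _.
  rewrite -(@ge0_integral_invariant _ _ _ nu (fun x => tuple_add x y) (fun x => G (x, y))).
  - by apply: eq_integral => x _; rewrite /G /F /= tuple_addK.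
  - exact: measurable_tuple_add.
  - by move=> C mC; exact: nuT.
  - by apply: (measurableT_comp mG); exact: measurable_fun_pair.
  - by [].
have e3 : (\int[nu]_x \int[la]_y G (x, y) = nu B * la (tuple_opp (n := n) @^-1` A))%E.
  have mO : measurable (tuple_opp (n := n) @^-1` A).
    by apply: measurable_tuple_preimage => //; exact: measurable_tuple_opp.
  transitivity (\int[nu]_x ((\1_B x)%:E * la (tuple_opp (n := n) @^-1` A)))%E.
    apply: eq_integral => x _; rewrite /G /= ge0_integralZr//; last first.
      apply: (measurableT_comp (mI _ mA)); apply: measurable_tuple_add => //.
      exact: measurable_tuple_opp.
    rewrite muleC; congr (_ * _)%E; rewrite -(laT (tuple_opp x) _ mO).
    rewrite (_ : (fun y => _) = EFin \o
      \1_[set y | (tuple_opp (n := n) @^-1` A) (tuple_add y (tuple_opp x))]).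
      rewrite integral_indic ?setIT//; exact: measurable_translate.
    apply/funext => y /=; congr EFin; rewrite !indicE; congr (nat_of_bool _)%:R.
    have -> : tuple_add x (tuple_opp y) = tuple_opp (tuple_add y (tuple_opp x)).
      by apply: eq_from_tnth => i; rewrite !tnth_mktuple; ring.
    by apply/idP/idP => /set_mem h; exact/mem_set.
  rewrite ge0_integralZr//; last exact: mI.
  by rewrite integral_indic// setIT.
by rewrite -e1 (fubini_tonelli F mF F0) e2 -(fubini_tonelli G mG G0).
Qed.

Hypothesis n0 : (0 < n)%N.

(* The image measure is translation invariant, hence proportional to Lebesgue
   measure, and both agree on the unit ball. *)
Lemma lebesgue_tuple_orthogonal (h : T -> T) A :
  measurable_fun setT h -> (forall x y, h (tuple_add x y) = tuple_add (h x) (h y)) ->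
  involutive h -> (forall x, tuple_dot (h x) (h x) = tuple_dot x x) ->
  measurable A -> lebesgue_tuple n (h @^-1` A) = lebesgue_tuple n A.
Proof.
move=> mh hD hK hdot mA.
pose la : {sigma_finite_measure set T -> \bar R} :=
  sigma_finite_pack (lebesgue_tuple_sigma_finite n).
pose nu0 : {measure set T -> \bar R} :=
  measure_function_pushforward__canonical__measure_function_Measure (lebesgue_tuple n) mh.
have snu : sigma_finite setT nu0.
  have [F FT Ff] := @lebesgue_tuple_sigma_finite R n.
  exists (fun k => h @^-1` F k) => [|k].
    by rewrite -preimage_bigcup -FT preimage_setT.
  have [mF fF] := Ff k; split; first exact: measurable_tuple_preimage.
  rewrite /nu0 /= /pushforward (_ : h @^-1` (h @^-1` F k) = F k)//.
  by apply/seteqP; split => x /=; rewrite hK.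
pose nu : {sigma_finite_measure set T -> \bar R} := sigma_finite_pack snu.
have laT v C : measurable C -> la [set x | C (tuple_add x v)] = la C.
  exact: lebesgue_tuple_translation.
have nuT v C : measurable C -> nu [set x | C (tuple_add x v)] = nu C.
  move=> mC; rewrite -[RHS](laT (h v)); last exact: measurable_tuple_preimage.
  rewrite -[LHS]/(la (h @^-1` [set x | C (tuple_add x v)])); congr (la _).
  by apply/seteqP; split => x /=; rewrite hD hK.
pose B := [set x : T | tuple_dot x x <= 1].
have mB : measurable B.
  have mdot : measurable_fun setT (fun x : T => tuple_dot x x).
    by apply: measurable_sum => i; apply: measurable_funM; exact: measurable_tnth.
  rewrite (_ : B = (fun x : T => tuple_dot x x) @^-1` `]-oo, 1]); last first.
    by apply/seteqP; split => x /=; rewrite in_itv.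
  by rewrite -[X in measurable X]setTI; exact: mdot.
have nuB : nu B = la B.
  rewrite -[LHS]/(la (h @^-1` B)); congr (la _).
  by apply/seteqP; split => x; rewrite /B /= hdot.
have laB0 : (0 < la B)%E.
  (* The cube of side [1 / n] with a corner at the origin lies in the ball: as [c <= 1], each of the
     [n] squares is at most [c]. *)
  pose c : R := n%:R^-1.
  have c0 : 0 < c by rewrite invr_gt0 ltr0n.
  apply: (@lt_le_trans _ _ (la (tuple_cube [tuple (0 : R) | i < n] c))).
    by rewrite [X in (_ < X)%E]lebesgue_tuple_cube ?(ltW c0)// lte_fin exprn_gt0.
  have mC := measurable_tuple_cube [tuple (0 : R) | i < n] c.
  apply: (le_measure la); [rewrite in_setE; exact: mC|rewrite in_setE; exact: mB|].
  move=> x hx; rewrite /B /= /tuple_dot.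
  apply: (@le_trans _ _ (\sum_(i < n) c)).
    apply: ler_sum => i _; have := hx i; rewrite tnth_mktuple add0r => /andP[x0 xc].
    have c1 : c <= 1 by rewrite invf_le1 ?ltr0n// ler1n.
    by rewrite -[leRHS]mulr1 ler_pM// (le_trans xc).
  by rewrite sumr_const card_ord -mulr_natl mulfV// pnatr_eq0 -lt0n.
have laBy : (la B < +oo)%E.
  apply: (@le_lt_trans _ _ (la (tuple_cube [tuple (- 1 : R) | i < n] 2))).
    have mC := measurable_tuple_cube [tuple (- 1 : R) | i < n] 2.
    apply: (le_measure la); [rewrite in_setE; exact: mB|rewrite in_setE; exact: mC|].
    move=> x; rewrite /B /= /tuple_dot => x1 i; rewrite tnth_mktuple.
    have : tnth x i ^+ 2 <= 1.
      apply: le_trans x1; rewrite (bigD1 i)//= expr2 lerDl sumr_ge0// => j _.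
      by rewrite -expr2 sqr_ge0.
    by move=> ?; nra.
  by rewrite [X in (X < _)%E]lebesgue_tuple_cube// ltry.
(* Both [nu A * la B] and [la A * la B] equal [la B] times the measure of the opposite of [A]; the
   positive finite factor [la B] cancels. *)
have := translation_invariant_unique nuT laT mA mB.
have := translation_invariant_unique laT laT mA mB.
rewrite nuB => <-.
have laBf : la B \is a fin_num by rewrite ge0_fin_numE.
rewrite -(fineK laBf) => e.
have b0 : fine (la B) != 0 by rewrite gt_eqF// fine_gt0// laB0 laBy.
have := congr1 (fun z => z * (fine (la B))^-1%:E)%E e.
by rewrite -!muleA -EFinM mulfV// !mule1.
Qed.

End orthogonal_invariance.

(** * Geodesic distance and reflections of the sphere *)

Section sphere_geometry.
Context {R : realType} {n : nat}.
Local Notation S := (sphere R n).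
Local Notation T := (n.+1.-tuple R).
Local Notation dot := (@tuple_dot R n.+1).
Implicit Types (x y z : S) (u v : T).

Lemma tuple_dotC u v : dot u v = dot v u.
Proof. by apply: eq_bigr => i _; rewrite mulrC. Qed.

Lemma sphere_dot x : dot (val x) (val x) = 1.
Proof. exact/eqP/(valP x). Qed.

Lemma sphere_dist_sqr x y :
  \sum_i (tnth (val x) i - tnth (val y) i) ^+ 2 = 2 - 2 * dot (val x) (val y).
Proof.
have -> : 2 - 2 * dot (val x) (val y) =
    dot (val x) (val x) + dot (val y) (val y) - 2 * dot (val x) (val y).
  by rewrite !sphere_dot.
rewrite /tuple_dot mulr_sumr -big_split -sumrB /=.
by apply: eq_bigr => i _; ring.
Qed.

Lemma sphere_dot_itv x y : -1 <= dot (val x) (val y) <= 1.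
Proof.
have h1 : 0 <= \sum_i (tnth (val x) i - tnth (val y) i) ^+ 2.
  by apply: sumr_ge0 => i _; exact: sqr_ge0.
have h2 : 0 <= \sum_i (tnth (val x) i + tnth (val y) i) ^+ 2.
  by apply: sumr_ge0 => i _; exact: sqr_ge0.
have E : \sum_i (tnth (val x) i + tnth (val y) i) ^+ 2 =
    dot (val x) (val x) + dot (val y) (val y) + 2 * dot (val x) (val y).
  rewrite /tuple_dot mulr_sumr -!big_split /=.
  by apply: eq_bigr => i _; ring.
by move: h1 h2; rewrite sphere_dist_sqr E !sphere_dot; lra.
Qed.

Lemma cos_geodist x y : cos (geodist x y) = dot (val x) (val y).
Proof. by rewrite /geodist acosK// in_itv/= sphere_dot_itv. Qed.

Lemma geodist_ge0 x y : 0 <= geodist x y.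
Proof. by rewrite /geodist acos_ge0// sphere_dot_itv. Qed.

Lemma geodist_lepi x y : geodist x y <= pi.
Proof. by rewrite /geodist acos_lepi// sphere_dot_itv. Qed.

Lemma geodistC x y : geodist x y = geodist y x.
Proof. by rewrite /geodist; congr acos; exact: tuple_dotC. Qed.

(** The chord is shorter than the arc, by [1 - cos d <= d ^+ 2 / 2]. *)
Lemma geodist_coord x y i : `|tnth (val x) i - tnth (val y) i| <= geodist x y.
Proof.
rewrite -(ler_pXn2r (n := 2)) ?nnegrE ?geodist_ge0// real_normK ?num_real//.
apply: (@le_trans _ _ (\sum_i (tnth (val x) i - tnth (val y) i) ^+ 2)).
  by rewrite (bigD1 i)//= lerDl sumr_ge0// => j _; exact: sqr_ge0.
rewrite sphere_dist_sqr -cos_geodist.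
by have := onem_cos_le (geodist x y); lra.
Qed.

Lemma measurable_sphere_val : measurable_fun setT (fun x : S => val x).
Proof. by move=> _ B mB; exists B. Qed.

Lemma measurable_sphere d (U : measurableType d) (f : U -> S) :
  measurable_fun setT (fun t => val (f t)) -> measurable_fun setT f.
Proof.
move=> mf _ _ [B mB <-]; rewrite !setTI.
have := mf measurableT B mB; rewrite setTI; exact.
Qed.

Lemma measurable_tuple_dot d (U : measurableType d) (f g : U -> T) :
  measurable_fun setT f -> measurable_fun setT g ->
  measurable_fun setT (fun t => dot (f t) (g t)).
Proof.
move=> /measurable_fun_tnthP mf /measurable_fun_tnthP mg.
by apply: measurable_sum => i; apply: measurable_funM; [exact: mf|exact: mg].
Qed.

Lemma measurable_geodist d (U : measurableType d) (f g : U -> S) :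
  measurable_fun setT f -> measurable_fun setT g ->
  measurable_fun setT (fun t => geodist (f t) (g t)).
Proof.
move=> mf mg.
(* Clamping to [[-1, 1]] makes [acos] nonincreasing on the whole line, hence measurable, without
   changing its values at scalar products of unit vectors. *)
pose cl (c : R) := Num.max (- 1) (Num.min 1 c).
have cl1 c : -1 <= cl c <= 1.
  by rewrite /cl le_max lexx/= ge_max ge_min lexx/= andbT; lra.
have clE c : -1 <= c <= 1 -> cl c = c.
  by move=> /andP[c0 c1]; rewrite /cl; rewrite (min_idPr c1); apply/max_idPr.
have clm : {homo cl : a b / a <= b}.
  by move=> a b ab; rewrite /cl; exact: le_max2 (lexx _) (le_min2 (lexx _) ab).
have mac : measurable_fun setT (fun c => acos (cl c)).
  apply: nonincreasing_measurable => // a b ab.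
  rewrite leNgt; apply/negP => lt.
  have := clm _ _ ab.
  rewrite -[X in X <= _](acosK (_ : cl a \in `[-1, 1])) ?in_itv//=.
  rewrite -[X in _ <= X](acosK (_ : cl b \in `[-1, 1])) ?in_itv//=.
  apply/negP; rewrite -ltNge ltr_cos ?in_itv/= ?acos_ge0 ?acos_lepi//.
rewrite (_ : (fun t => _) = (fun c => acos (cl c)) \o (fun t => dot (val (f t)) (val (g t)))).
  apply: measurableT_comp => //; apply: measurable_tuple_dot.
    exact: (measurableT_comp measurable_sphere_val mf).
  exact: (measurableT_comp measurable_sphere_val mg).
by apply/funext => t /=; rewrite clE// sphere_dot_itv.
Qed.

(** The orthogonal reflection in the hyperplane normal to [v]. For [v = 0] it is the identity, as
    the inverse of 0 is 0. *)
Definition reflection v u : T :=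
  [tuple tnth u i - 2 * dot u v / dot v v * tnth v i | i < n.+1].

Lemma reflection_dotl v u w :
  dot (reflection v u) w = dot u w - 2 * dot u v / dot v v * dot v w.
Proof.
rewrite /tuple_dot mulr_sumr -sumrB; apply: eq_bigr => i _.
by rewrite tnth_mktuple mulrBl mulrA.
Qed.

Lemma reflection_dot v u w : dot (reflection v u) (reflection v w) = dot u w.
Proof.
rewrite reflection_dotl !(tuple_dotC _ (reflection v w)) !reflection_dotl.
rewrite (tuple_dotC w u) (tuple_dotC w v) (tuple_dotC v u).
have [->|v0] := eqVneq (dot v v) 0; first by rewrite invr0; ring.
by field.
Qed.

Lemma reflectionD v u w :
  reflection v (tuple_add u w) = tuple_add (reflection v u) (reflection v w).
Proof.
have dotD : dot (tuple_add u w) v = dot u v + dot w v.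
  rewrite /tuple_dot -big_split; apply: eq_bigr => i _.
  by rewrite tnth_mktuple mulrDl.
apply: eq_from_tnth => i; rewrite !tnth_mktuple dotD.
by ring.
Qed.

Lemma reflectionK v : involutive (reflection v).
Proof.
move=> u; apply: eq_from_tnth => i; rewrite !tnth_mktuple reflection_dotl.
have [->|v0] := eqVneq (dot v v) 0; first by rewrite invr0; ring.
by field.
Qed.

Lemma reflectionZ v t u : reflection v [tuple t * tnth u i | i < n.+1] =
  [tuple t * tnth (reflection v u) i | i < n.+1].
Proof.
have dotZ : dot [tuple t * tnth u i | i < n.+1] v = t * dot u v.
  rewrite /tuple_dot mulr_sumr; apply: eq_bigr => i _.
  by rewrite tnth_mktuple mulrA.
apply: eq_from_tnth => i; rewrite !tnth_mktuple dotZ.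
by ring.
Qed.

Lemma measurable_reflection v : measurable_fun setT (reflection v).
Proof.
apply/measurable_fun_tnthP => i.
rewrite (_ : _ \o _ = fun u => tnth u i - 2 * dot u v / dot v v * tnth v i).
  apply: measurable_funB; first exact: measurable_tnth.
  do 3! (apply: measurable_funM => //).
  exact: measurable_tuple_dot.
by apply/funext => u /=; rewrite tnth_mktuple.
Qed.

Let sphere_reflection_subproof v x :
  \sum_(i < n.+1) tnth (reflection v (val x)) i ^+ 2 == 1.
Proof. by apply/eqP; exact: etrans (reflection_dot v _ _) (sphere_dot x). Qed.

Definition sphere_reflection v x : S :=
  exist _ (reflection v (val x)) (sphere_reflection_subproof v x).

Lemma geodist_reflection v x y :
  geodist (sphere_reflection v x) (sphere_reflection v y) = geodist x y.
Proof. by rewrite /geodist; congr acos; exact: reflection_dot. Qed.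

Lemma measurable_sphere_reflection v : measurable_fun setT (sphere_reflection v).
Proof.
apply: measurable_sphere.
exact: (measurableT_comp (measurable_reflection v) measurable_sphere_val).
Qed.

Definition tuple_sub u v : T := tuple_add u (tuple_opp v).

(** The mirror is the bisecting hyperplane of [x] and [y]; when its normal vanishes, [x = y] and the
    reflection is the identity. *)
Lemma reflection_swap x y :
  sphere_reflection (tuple_sub (val x) (val y)) x = y.
Proof.
apply/val_inj/eq_from_tnth => i; rewrite tnth_mktuple.
set v := tuple_sub _ _.
have vE j : tnth v j = tnth (val x) j - tnth (val y) j by rewrite !tnth_mktuple.
have vv : dot v v = 2 - 2 * dot (val x) (val y).
  by rewrite -sphere_dist_sqr; apply: eq_bigr => j _; rewrite vE -expr2.
have xv : dot (val x) v = 1 - dot (val x) (val y).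
  transitivity (dot (val x) (val x) - dot (val x) (val y)); last by rewrite sphere_dot.
  rewrite /tuple_dot -sumrB; apply: eq_bigr => j _.
  by rewrite vE mulrBr.
have [v0|v0] := eqVneq (dot v v) 0.
  have : \sum_j (tnth (val x) j - tnth (val y) j) ^+ 2 = 0.
    by rewrite sphere_dist_sqr -vv.
  move/eqP; rewrite psumr_eq0; last by move=> j _; exact: sqr_ge0.
  move=> /allP/(_ i (mem_index_enum _)); rewrite sqrf_eq0 => /eqP e.
  by rewrite v0 invr0 mulr0 mul0r subr0; apply/eqP; rewrite -subr_eq0 e.
rewrite (_ : 2 * dot (val x) v / dot v v = 1) ?mul1r ?vE; first by rewrite opprB addrC subrK.
apply: (mulIf v0); rewrite divfK// mul1r xv vv; ring.
Qed.

Lemma reflection_fix v x : dot (val x) v = 0 -> sphere_reflection v x = x.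
Proof.
move=> xv; apply/val_inj/eq_from_tnth => i; rewrite tnth_mktuple.
by rewrite xv mulr0 !mul0r subr0.
Qed.

Let normalize u : T := [tuple tnth u i * (dot u u) `^ (- 2^-1) | i < n.+1].

Let coneE (A : set S) (B : set T) : A = (fun x => val x) @^-1` B ->
  cone A = ((fun u => dot u u) @^-1` `]0, 1]) `&` (normalize @^-1` B).
Proof.
move=> ->; apply/seteqP; split => u.
  move=> [t [y [/andP[t0 t1] By ->]]].
  have tt : dot [tuple t * tnth (val y) i | i < n.+1]
      [tuple t * tnth (val y) i | i < n.+1] = t ^+ 2.
    transitivity (t ^+ 2 * dot (val y) (val y)); last by rewrite sphere_dot mulr1.
    rewrite /tuple_dot mulr_sumr.
    by apply: eq_bigr => i _; rewrite tnth_mktuple; ring.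
  split; first by rewrite /= in_itv/= tt exprn_gt0//= expr_le1// ltW.
  rewrite /= /normalize tt powRN -powR_mulrn ?(ltW t0)// -powRrM mulfV// powRr1 ?(ltW t0)//.
  set v := (X in B X); suff -> : v = val y by [].
  apply: eq_from_tnth => i.
  by rewrite !tnth_mktuple mulrAC mulfV ?mul1r// gt_eqF.
move=> [/=]; rewrite in_itv/= => /andP[u0 u1] Bu.
pose t := dot u u `^ (2^-1).
have t0 : 0 < t by rewrite powR_gt0.
have tt : t ^+ 2 = dot u u.
  by rewrite -powR_mulrn ?(ltW t0)// -powRrM mulVf// powRr1// ltW.
have nE : normalize u = [tuple tnth u i / t | i < n.+1].
  by apply: eq_from_tnth => i; rewrite !tnth_mktuple powRN.
have yS : \sum_(i < n.+1) tnth (normalize u) i ^+ 2 == 1.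
  apply/eqP; rewrite nE; under eq_bigr do rewrite tnth_mktuple expr_div_n.
  rewrite -mulr_suml tt (_ : \sum_i _ = dot u u).
    by rewrite mulfV// gt_eqF.
  by apply: eq_bigr => i _; rewrite expr2.
exists t, (exist _ (normalize u) yS); split => //.
  rewrite t0 /= -(@expr_le1 _ 2)// ?tt//; exact: ltW.
apply: eq_from_tnth => i.
by rewrite tnth_mktuple /= nE tnth_mktuple mulrC divfK// gt_eqF.
Qed.

Lemma measurable_cone (A : set S) : measurable A -> measurable (cone A).
Proof.
move=> [B mB]; rewrite setTI => /esym/coneE ->.
have mdd : measurable_fun setT (fun u : T => dot u u) by exact: measurable_tuple_dot.
apply: measurableI; rewrite -[X in measurable X]setTI; first exact: mdd.
have mn : measurable_fun setT normalize; last exact: mn.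
apply/measurable_fun_tnthP => i.
rewrite (_ : _ \o _ = fun u => tnth u i * (dot u u) `^ (- 2^-1)).
  apply: measurable_funM; first exact: measurable_tnth.
  exact: (measurableT_comp (measurable_powR _)).
by apply/funext => u /=; rewrite tnth_mktuple.
Qed.

(** Reflections commute with scaling, so the cone over a preimage is the preimage of the cone, and
    the invariance of Lebesgue measure applies. *)
Lemma surface_measure_reflection v (A : set S) : measurable A ->
  surface_measure (sphere_reflection v @^-1` A) = surface_measure A.
Proof.
move=> mA; rewrite /surface_measure; congr (_ * _)%E.
rewrite -[RHS](@lebesgue_tuple_orthogonal R n.+1 isT (reflection v)).
- congr (lebesgue_tuple n.+1 _); apply/seteqP; split => u.
    move=> [t [y [t01 Ay ->]]]; exists t, (sphere_reflection v y); split => //.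
    by rewrite reflectionZ.
  move=> [t [y [t01 Ay e]]]; exists t, (sphere_reflection v y); split => //.
    rewrite /= (_ : sphere_reflection v _ = y)//; apply/val_inj => /=.
    exact: reflectionK.
  by rewrite -[u](reflectionK v) e reflectionZ.
- exact: measurable_reflection.
- exact: reflectionD.
- exact: reflectionK.
- by move=> x; exact: reflection_dot.
- exact: measurable_cone.
Qed.

(* Two reflections move any pair of points onto any other pair of points at the
   same distance. *)
Lemma psiE z z' r : psi n (geodist z z') r =
  \int[@surface_measure R n]_x
    (\1_[set y | geodist y z < r] x * \1_[set y | geodist y z' < r] x).
Proof.
pose f (z z' x : S) : R := \1_[set y | geodist y z < r] x * \1_[set y | geodist y z' < r] x.
have mi (a : S) : measurable_fun setT (fun x => \1_[set y | geodist y a < r] x : R).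
  apply: measurable_indic; rewrite -[X in measurable X]setTI.
  have mg : measurable_fun setT (fun y : S => geodist y a) by exact: measurable_geodist.
  rewrite (_ : [set y | _] = (fun y : S => geodist y a) @^-1` `]-oo, r[); first exact: mg.
  by apply/seteqP; split => y /=; rewrite in_itv.
have inv v a b : \int[@surface_measure R n]_x f a b x =
    \int[@surface_measure R n]_x
      f (sphere_reflection v a) (sphere_reflection v b) x.
  rewrite /Rintegral; congr fine.
  rewrite -[RHS](@ge0_integral_invariant _ _ _ _ (sphere_reflection v)).
  - have E c x : (\1_[set y | geodist y (sphere_reflection v c) < r]
        (sphere_reflection v x) : R) = \1_[set y | geodist y c < r] x.
      rewrite !indicE; congr (nat_of_bool _)%:R.
      by apply/idP/idP => /set_mem /= h; apply/mem_set => /=; move: h;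
        rewrite geodist_reflection.
    by apply: eq_integral => x _; rewrite /f !E.
  - exact: measurable_sphere_reflection.
  - by move=> A mA; exact: surface_measure_reflection.
  - by apply/measurable_EFinP; apply: measurable_funM; exact: mi.
  - by move=> x; rewrite lee_fin mulr_ge0.
rewrite /psi; set P := (X in xget 0 X).
have P0 : P (\int[@surface_measure R n]_x f z z' x) by exists z, z'.
have [a [b [dab ->]]] := xgetPex 0 (ex_intro P _ P0).
pose v1 := tuple_sub (val a) (val z).
pose w := sphere_reflection v1 b.
have az : sphere_reflection v1 a = z by exact: reflection_swap.
have dzw : dot (val z) (val w) = dot (val z) (val z').
  by rewrite -!cos_geodist -dab -(geodist_reflection v1 a b) az.
rewrite -[LHS]/(\int[_]_x f a b x) (inv v1) az -/w.
(* Since [w] and [z'] are at the same distance from [z], the vector [w - z'] is orthogonal to [z],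
   which the second reflection therefore fixes. *)
pose v2 := tuple_sub (val w) (val z').
rewrite (inv v2) reflection_swap reflection_fix//.
transitivity (dot (val z) (val w) - dot (val z) (val z')); last by rewrite dzw subrr.
rewrite /tuple_dot -sumrB; apply: eq_bigr => i _.
by rewrite !tnth_mktuple mulrBr.
Qed.

End sphere_geometry.

(** * Measure of spherical caps *)

Section surface_bounds.
Context {R : realType} {n : nat}.
Local Notation S := (sphere R n).
Local Notation T := (n.+1.-tuple R).
Implicit Types (x y z : S).

Lemma sphere_coord_le1 x i : `|tnth (val x) i| <= 1.
Proof.
rewrite -(ler_pXn2r (n := 2)) ?nnegrE// real_normK ?num_real// expr1n.
apply: (@le_trans _ _ (\sum_j tnth (val x) j ^+ 2)).
  rewrite (bigD1 i)//= lerDl.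
  by apply: sumr_ge0 => j _; exact: sqr_ge0.
by rewrite (eqP (valP x)).
Qed.

Lemma measurable_geoball z r : measurable (geoball z r).
Proof.
have mg : measurable_fun setT (fun y : S => geodist z y) by exact: measurable_geodist.
rewrite (_ : geoball z r = (fun y : S => geodist z y) @^-1` `]-oo, r]).
  by rewrite -[X in measurable X]setTI; exact: mg.
by apply/seteqP; split => y /=; rewrite in_itv.
Qed.

Lemma surface_measure_lty : (@surface_measure R n setT < +oo)%E.
Proof.
rewrite /surface_measure lte_mul_pinfty ?lee_fin ?ltry// .
pose C : set T := tuple_cube [tuple (- 1 : R) | i < n.+1] 2.
apply: (@le_lt_trans _ _ (lebesgue_tuple n.+1 C)).
  apply: (le_measure (lebesgue_tuple n.+1)).
  - by rewrite in_setE; exact: measurable_cone.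
  - by rewrite in_setE; exact: measurable_tuple_cube.
  move=> x [t [y [/andP[t0 t1] _ ->]]] i; rewrite !tnth_mktuple.
  have := sphere_coord_le1 y i; rewrite ler_norml => /andP[h1 h2].
  by apply/andP; split; nra.
by rewrite /C lebesgue_tuple_cube ?ltry.
Qed.

Lemma surface_measure_fin_num_fun : fin_num_fun (@surface_measure R n).
Proof.
move=> A mA; rewrite ge0_fin_numE//; apply: le_lt_trans surface_measure_lty.
by apply: (le_measure (@surface_measure R n)); rewrite ?in_setE.
Qed.

HB.instance Definition _ := Measure_isFinite.Build _ _ _
  (@surface_measure R n) surface_measure_fin_num_fun.

(* The cone over a cap of radius [r <= 1] is covered by [O(1 / r)] cubes of
   side [4 r] centred on the segment from the origin to the centre [z]. *)
Lemma surface_measure_small_cap z r : 0 < r -> r <= 1 ->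
  (surface_measure (geoball z r) <= (n.+1%:R * (3 * 4 ^+ n.+1) * r ^+ n)%:E)%E.
Proof.
move=> r0 r1.
(* [J] exceeds [1 / r]: consecutive centres [j / J * z] are less than [r] apart, and there are at
   most [1 / r + 2] of them. *)
pose J := (Num.trunc r^-1).+1.
have J0 : 0 < (J%:R : R) by rewrite ltr0n.
have ri0 : 0 <= r^-1 by rewrite invr_ge0 ltW.
have /andP[Jl Ju] := truncn_itv ri0; rewrite -/J in Ju.
pose a (j : nat) : T := [tuple j%:R / J%:R * tnth (val z) i - 2 * r | i < n.+1].
have cov : cone (geoball z r) `<=`
    \big[setU/set0]_(j < J.+1) tuple_cube (a j) (4 * r).
  move=> _ [t [y [/andP[t0 t1] zy ->]]].
  have tJ0 : 0 <= t * J%:R by rewrite mulr_ge0// ltW.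
  pose j := Num.trunc (t * J%:R).
  have /andP[jl ju] := truncn_itv tJ0; rewrite -/j in jl ju.
  have jJ : (j < J.+1)%N.
    rewrite ltnS -(ler_nat R); apply: (le_trans jl).
    by rewrite ler_piMl// ltW.
  rewrite -(bigcup_mkord J.+1 (fun j => tuple_cube (a j) (4 * r))); exists j => // i; rewrite !tnth_mktuple.
  have := geodist_coord z y i; rewrite ler_norml => /andP[h1 h2].
  have hr := zy : geodist z y <= r.
  have := sphere_coord_le1 z i; rewrite ler_norml => /andP[h3 h4].
  (* The point [t * y] differs from the centre [j / J * z] by [e * z + t * (y - z)]; every
     coordinate of either term is at most [r], whence the half side [2 * r]. *)
  pose e := t - j%:R / J%:R.
  have e0 : 0 <= e by rewrite subr_ge0 ler_pdivrMr.
  have e1 : e <= r.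
    have : e <= J%:R^-1.
      rewrite lerBlDr -[X in X + _]mul1r -mulrDl ler_pdivlMr// addrC.
      by rewrite -natr1 in ju; exact: ltW.
    move/le_trans; apply; rewrite -[r]invrK lef_pV2 ?posrE ?invr_gt0//; exact: ltW.
  have tE : j%:R / J%:R = t - e by rewrite /e; ring.
  rewrite tE; move: e e0 e1 {tE} => e e0 e1.
  set zi := tnth (val z) i in h1 h2 h3 h4 *; set yi := tnth (val y) i in h1 h2 h3 h4 *.
  clearbody zi yi.
  have b1 : `|t * (yi - zi)| <= r.
    rewrite normrM (gtr0_norm t0) -[r]mul1r ler_pM//; first exact: ltW.
    by rewrite ler_norml; apply/andP; split; lra.
  have b2 : `|e * zi| <= r.
    rewrite normrM (ger0_norm e0) -[r]mulr1 ler_pM//.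
    by rewrite ler_norml h3 h4.
  move: b1 b2; rewrite !ler_norml => /andP[b1 b2] /andP[b3 b4].
  by apply/andP; split; nra.
have le1 : (lebesgue_tuple n.+1 (cone (geoball z r)) <=
    (((4 * r) ^+ n.+1) *+ J.+1)%:E)%E.
  apply: (@le_trans _ _
      (\sum_(j < J.+1) lebesgue_tuple n.+1 (tuple_cube (a j) (4 * r)))%E).
    have := @content_subadditive _ _ _ (lebesgue_tuple n.+1) (cone (geoball z r))
      (fun j => tuple_cube (a j) (4 * r)) J.+1.
    apply; [by move=> j _; exact: measurable_tuple_cube| |exact: cov].
    by apply: measurable_cone; exact: measurable_geoball.
  rewrite (eq_bigr (fun=> ((4 * r) ^+ n.+1)%:E)) => [|j _].
    by rewrite sumEFin sumr_const card_ord.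
  by rewrite lebesgue_tuple_cube// mulr_ge0// ltW.
rewrite /surface_measure -mulrA EFinM lee_pmul2l// ?lte_fin ?ltr0n//.
apply: (le_trans le1); rewrite lee_fin -mulr_natr exprMn [r ^+ n.+1]exprS.
have rn : 0 <= r ^+ n by rewrite exprn_ge0// ltW.
rewrite (_ : _ * J.+1%:R = 4 ^+ n.+1 * r ^+ n * (r * J.+1%:R)); last first.
  by move: (4 ^+ n.+1) (r ^+ n) J.+1%:R => A B D; ring.
rewrite (_ : 3 * _ * _ = 4 ^+ n.+1 * r ^+ n * 3); last first.
  by move: (4 ^+ n.+1) (r ^+ n) => A B; ring.
apply: ler_wpM2l; first by rewrite mulr_ge0.
(* [r * (J + 1)] is at most [1 + 2 * r], hence at most 3: the factor 3 of the constant. *)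
rewrite /J -!natr1 !mulrDr !mulr1.
have : r * (Num.trunc r^-1)%:R <= 1.
  by rewrite mulrC -ler_pdivlMr// mul1r.
lra.
Qed.

(** The covering handles [r <= 1]; for larger [r] the total mass times [r ^+ n] is enough. *)
Lemma surface_measure_cap : exists2 C : R, 0 <= C & forall z r, 0 < r ->
  (surface_measure (geoball z r) <= (C * r ^+ n)%:E)%E.
Proof.
pose s := fine (@surface_measure R n setT).
have s0 : 0 <= s by exact: fine_ge0.
pose C0 : R := n.+1%:R * (3 * 4 ^+ n.+1).
have C00 : 0 <= C0 by rewrite !mulr_ge0// exprn_ge0.
exists (C0 + s) => [|z r r0]; first exact: addr_ge0.
have rn : 0 <= r ^+ n by rewrite exprn_ge0// ltW.
have [r1|/ltW r1] := leP r 1.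
  apply: (le_trans (surface_measure_small_cap z r0 r1)); rewrite lee_fin.
  by rewrite ler_wpM2r// lerDl.
apply: (@le_trans _ _ (@surface_measure R n setT)).
  by apply: (le_measure (@surface_measure R n)); rewrite ?in_setE//; exact: measurable_geoball.
rewrite -[leLHS]fineK; last exact: fin_num_measure.
rewrite lee_fin -/s mulrDl.
have : s * 1 <= s * r ^+ n by rewrite ler_wpM2l// exprn_ege1.
by have := mulr_ge0 C00 rn; lra.
Qed.

End surface_bounds.

(** * The covariance kernel *)

Section power_integrals.
Context {R : realType}.
Implicit Types (a b u v : R).
Local Notation mu := (@lebesgue_measure R).

Lemma within_continuous_powR u v a : 0 < u -> {within `[u, v], continuous (fun x => x `^ a)}.
Proof.
move=> u0; apply: continuous_in_subspaceT => x /set_mem /=; rewrite in_itv/= => /andP[ux _].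
apply: differentiable_continuous; apply/derivable1_diffP; apply: derivable_powR.
by rewrite in_itv/= andbT; exact: lt_le_trans ux.
Qed.

Lemma integral_powR u v a : 0 < u -> u < v -> a + 1 != 0 ->
  (\int[mu]_(x in `[u, v]) (x `^ a)%:E =
   ((v `^ (a + 1) - u `^ (a + 1)) / (a + 1))%:E)%E.
Proof.
move=> u0 uv a1.
pose F x := x `^ (a + 1) / (a + 1).
have dF (x : R) : 0 < x -> is_derive x 1 F (x `^ a).
  move=> x0; have := is_derive1_powR (a + 1) x0; rewrite addrK => h.
  rewrite /F (_ : (fun _ => _) = (fun y => y `^ (a + 1)) * cst (a + 1)^-1)//.
  by apply: is_derive_eq; rewrite /GRing.scale /=; field.
rewrite (continuous_FTC2 (F := F) uv); first by rewrite -EFinB /F mulrBl.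
- exact: within_continuous_powR.
- have cF x : 0 < x -> {for x, continuous F}.
    move=> x0; apply: differentiable_continuous; apply/derivable1_diffP.
    by have [] := dF _ x0.
  split.
  + move=> x; rewrite in_itv/= => /andP[ux _].
    by have [] := dF _ (lt_trans u0 ux).
  + by apply: cvg_at_right_filter; exact: cF.
  + by apply: cvg_at_left_filter; apply: cF; exact: lt_trans uv.
- move=> x; rewrite in_itv/= => /andP[ux _].
  by rewrite derive1E; have [_ ->] := dF _ (lt_trans u0 ux).
Qed.

Let measurable_powR_EFin (D : set R) a : measurable_fun D (fun x => (x `^ a)%:E).
Proof. by apply/measurable_EFinP; apply: measurable_funTS; exact: measurable_powR. Qed.

Let integral_bigcup_le (F : (set R)^nat) a (c : R) : (forall k, measurable (F k)) ->
  nondecreasing_seq F -> (forall k, \int[mu]_(x in F k) (x `^ a)%:E <= c%:E)%E ->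
  (\int[mu]_(x in \bigcup_k F k) (x `^ a)%:E <= c%:E)%E.
Proof.
move=> mF ndF le.
have := ge0_nondecreasing_set_cvg_integral (mu := mu) ndF mF
  (fun k => @measurable_powR_EFin (F k) a) (fun k x _ => powR_ge0 x a).
move=> h; have <- := cvg_lim _ h => //; apply: lime_le.
  by apply/cvg_ex; eexists; exact: h.
by apply: nearW.
Qed.

Lemma integral_powR_near0 a b : -1 < a -> 0 < b ->
  (\int[mu]_(x in `]0%R, b]) (x `^ a)%:E < +oo)%E.
Proof.
move=> a1 b0; have a10 : 0 < a + 1 by lra.
apply: (@le_lt_trans _ _ (b `^ (a + 1) / (a + 1))%:E); last exact: ltry.
(* The lower end point is already [b / 2] at [k = 0], because [integral_powR] asks for a
   nondegenerate interval. *)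
pose F (k : nat) := `[b / k.+2%:R, b]%classic.
have -> : `]0, b]%classic = \bigcup_k F k.
  apply/seteqP; split => [x|x [k _]]; rewrite /F/= !in_itv/= => /andP[x0 xb].
    exists (Num.trunc (b / x)) => //=; rewrite in_itv/= xb andbT.
    rewrite ler_pdivrMr ?ltr0n// mulrC -ler_pdivrMr//.
    have /andP[_ /ltW h] := truncn_itv (divr_ge0 (ltW b0) (ltW x0)).
    by apply: (le_trans h); rewrite ler_nat.
  by rewrite xb andbT (lt_le_trans _ x0)// divr_gt0// ltr0n.
apply: integral_bigcup_le => [k||k]; first exact: measurable_itv.
  move=> i j ij; rewrite subsetEset => x; rewrite /F/= !in_itv/= => /andP[h ->].
  rewrite andbT (le_trans _ h)// ler_pM2l// lef_pV2 ?posrE ?ltr0n//.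
  by rewrite ler_nat ltnS.
rewrite integral_powR ?gt_eqF ?divr_gt0 ?ltr0n//; last first.
  by rewrite ltr_pdivrMr ?ltr0n// ltr_pMr// ltr1n.
by rewrite lee_fin ler_wpM2r ?invr_ge0 ?(ltW a10)// lerBlDr lerDl powR_ge0.
Qed.

Lemma integral_powR_infty a : a < -1 ->
  (\int[mu]_(x in `]1%R, +oo[) (x `^ a)%:E < +oo)%E.
Proof.
move=> a1; have a10 : 0 < - (a + 1) by lra.
apply: (@le_lt_trans _ _ (- (a + 1))^-1%:E); last exact: ltry.
pose F (k : nat) := `[1, k.+2%:R]%classic : set R.
apply: (@le_trans _ _ (\int[mu]_(x in \bigcup_k F k) (x `^ a)%:E)%E).
  apply: ge0_subset_integral => //.
  - by apply: bigcupT_measurable => k; exact: measurable_itv.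
  - exact: measurable_powR_EFin.
  - by move=> x _; rewrite lee_fin powR_ge0.
  move=> x; rewrite /= in_itv/= andbT => x1.
  exists (Num.trunc x) => //; rewrite /F/= in_itv/= (ltW x1)/=.
  have /andP[_ /ltW h] := truncn_itv (le_trans ler01 (ltW x1)).
  by apply: (le_trans h); rewrite ler_nat.
apply: integral_bigcup_le => [k||k]; first exact: measurable_itv.
  move=> i j ij; rewrite subsetEset => x; rewrite /F/= !in_itv/= => /andP[-> h]/=.
  by rewrite (le_trans h)// ler_nat !ltnS.
rewrite integral_powR ?ltr1n// ?lt_eqF ?oppr_gt0 -?oppr_gt0//.
rewrite lee_fin powR1 -mulrNN -invrN ler_piMl ?invr_ge0 ?(ltW a10)//.
Qed.

End power_integrals.

Lemma sigma_finite_product (d1 d2 : measure_display) (T1 : measurableType d1)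
    (T2 : measurableType d2) (R : realType)
    (m1 : {sigma_finite_measure set T1 -> \bar R})
    (m2 : {sigma_finite_measure set T2 -> \bar R}) :
  sigma_finite setT (m1 \x m2)%E.
Proof.
have /sigma_finiteP[F [TF ndF Foo]] := sigma_finiteT m1.
have /sigma_finiteP[G [TG ndG Goo]] := sigma_finiteT m2.
exists (fun i => F i `*` G i).
  apply/seteqP; split => // -[x y] _.
  have [i _ Fx] : (\bigcup_i F i) x by rewrite -TF.
  have [j _ Gy] : (\bigcup_i G i) y by rewrite -TG.
  exists (maxn i j) => //; split => /=.
    by move: x Fx; exact/subsetPset/ndF/leq_maxl.
  by move: y Gy; exact/subsetPset/ndG/leq_maxr.
move=> i; have [? ?] := Foo i; have [? ?] := Goo i.
split; first exact: measurableX.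
by rewrite product_measure1E// lte_mul_pinfty// ge0_fin_numE.
Qed.

(** * The nonnegative kernel and its uniform bound *)

Section ball_kernel.
Context {R : realType} {n : nat}.
Variable H : R.
Hypotheses (H0 : 0 < H) (Hn : 2 * H != n%:R).
Local Notation S := (sphere R n).
Local Notation sigma := (@surface_measure R n).
Local Notation leb := (@lebesgue_measure R).

(** Vanishing for [r <= 0], so that integrals over radii become integrals over the whole line. *)
Definition radial_weight (r : R) : R :=
  if 0 < r then r `^ (2 * H - n%:R - 1) else 0.
Local Notation w := radial_weight.

Lemma radial_weight_ge0 r : 0 <= w r.
Proof. by rewrite /w; case: ifP => // _; exact: powR_ge0. Qed.

Lemma measurable_radial_weight : measurable_fun setT w.
Proof.
apply: measurable_fun_ifT => //; first exact: measurable_fun_ltr.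
Qed.

(* The integrand of [psiH], up to the sign [ball_sign], made nonnegative.  The
   comparison [c] is strict in [psi] and large in [geoball]. *)
Definition ball_kernel (c : rel R) (z z' x : S) (r : R) : R :=
  ((2 * H < n%:R) == (c (geodist x z) r && c (geodist x z') r))%:R.
Local Notation k := ball_kernel.

Lemma ball_kernel_ge0 c z z' x r : 0 <= k c z z' x r.
Proof. exact: ler0n. Qed.

Lemma ball_kernel_le1 c z z' x r : k c z z' x r <= 1.
Proof. by rewrite /k; case: eqP. Qed.

Definition ball_sign : R := if 2 * H < n%:R then 1 else -1.

(** The strict and the large comparison are treated at once. *)
Definition measurable_rel (c : rel R) := forall d (U : measurableType d)
  (f g : U -> R), measurable_fun setT f -> measurable_fun setT g ->
  measurable_fun setT (fun t => c (f t) (g t)).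

Lemma measurable_rel_lt : measurable_rel <%R.
Proof. by move=> d U f g; exact: measurable_fun_ltr. Qed.

Lemma measurable_rel_le : measurable_rel <=%R.
Proof. by move=> d U f g; exact: measurable_fun_ler. Qed.

Lemma measurable_ball_kernel c d (U : measurableType d) (z z' x : U -> S)
    (r : U -> R) : measurable_rel c ->
  measurable_fun setT z -> measurable_fun setT z' -> measurable_fun setT x ->
  measurable_fun setT r ->
  measurable_fun setT (fun t => k c (z t) (z' t) (x t) (r t)).
Proof.
move=> mc mz mz' mx mr.
pose b t := c (geodist (x t) (z t)) (r t) && c (geodist (x t) (z' t)) (r t).
have mb : measurable_fun setT b.
  by apply: measurable_and; apply: mc => //; exact: measurable_geodist.
have mb' : measurable_fun setT (fun t => (2 * H < n%:R) == b t).
  case: (2 * H < n%:R); first by under eq_fun do rewrite eq_sym eqb_id.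
  by under eq_fun do rewrite eq_sym eqbF_neg; exact: measurable_neg.
rewrite (_ : (fun t => _) = fun t => if (2 * H < n%:R) == b t then 1 else 0).
  exact: measurable_fun_ifT.
by apply/funext => t; rewrite /k -/(b t); case: ifP.
Qed.

Let L := measurableTypeR R.

Definition weighted_kernel c (q : S * S) (p : S * L) : \bar R :=
  (k c q.1 q.2 p.1 p.2 * w p.2)%:E.

Lemma weighted_kernel_ge0 c q p : (0 <= weighted_kernel c q p)%E.
Proof. by rewrite lee_fin mulr_ge0 ?ball_kernel_ge0 ?radial_weight_ge0. Qed.

Lemma measurable_weighted_kernel2 c : measurable_rel c ->
  measurable_fun setT (fun t : (S * S) * (S * L) => weighted_kernel c t.1 t.2).
Proof.
move=> mc; apply/measurable_EFinP; apply: measurable_funM.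
  apply: measurable_ball_kernel => //.
  - exact: (measurableT_comp measurable_fst measurable_fst).
  - exact: (measurableT_comp measurable_snd measurable_fst).
  - exact: (measurableT_comp measurable_fst measurable_snd).
  - exact: (measurableT_comp measurable_snd measurable_snd).
apply: (measurableT_comp measurable_radial_weight).
exact: (measurableT_comp measurable_snd measurable_snd).
Qed.

Lemma measurable_weighted_kernel c q : measurable_rel c ->
  measurable_fun setT (weighted_kernel c q).
Proof.
move=> /measurable_weighted_kernel2 mk.
exact: (measurableT_comp mk (measurable_pair1 q)).
Qed.

Definition kernel_integral (q : S * S) : \bar R :=
  (\int[sigma \x leb]_p weighted_kernel <=%R q p)%E.

(** For a fixed centre [x] the two kernels differ only at the two radii [geodist x q.1] and
    [geodist x q.2], a null set. *)
Lemma kernel_integral_lt q :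
  (\int[sigma \x leb]_p weighted_kernel <%R q p = kernel_integral q)%E.
Proof.
rewrite /kernel_integral.
have mlt := measurable_weighted_kernel q measurable_rel_lt.
have mle := measurable_weighted_kernel q measurable_rel_le.
rewrite (fubini_tonelli1 _ mlt (weighted_kernel_ge0 _ _)) (fubini_tonelli1 _ mle (weighted_kernel_ge0 _ _)).
apply: eq_integral => x _; apply: ae_eq_integral => //.
- exact: (measurableT_comp mlt (measurable_pair1 x)).
- exact: (measurableT_comp mle (measurable_pair1 x)).
exists [set geodist x q.1; geodist x q.2]; split => //.
- exact: measurableU.
- apply/eqP; rewrite eq_le measure_ge0 andbT.
  have := @measureU2 _ _ _ leb [set geodist x q.1] [set geodist x q.2].
  move=> /(_ (measurable_set1 _) (measurable_set1 _)) /le_trans; apply.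
  have l1 (t : R) : leb [set t] = 0%E by exact: lebesgue_measure_set1.
  rewrite [X in (X + _)%E](_ : _ = 0%E); last exact: l1.
  by rewrite [X in (_ + X)%E](_ : _ = 0%E) ?adde0//; exact: l1.
move=> r /=; apply: contra_notP => /not_orP[d1 d2] _.
have lt (y : S) : r <> geodist x y -> (geodist x y < r :> R) = (geodist x y <= r :> R).
  move=> e; rewrite le_eqVlt; case: eqVneq => // e'.
  by case: e; exact/esym.
by rewrite /weighted_kernel /k /= !lt.
Qed.

Lemma kernel_integral_ge0 q : (0 <= kernel_integral q)%E.
Proof. by apply: integral_ge0 => p _; exact: weighted_kernel_ge0. Qed.

Lemma measurable_kernel_integral : measurable_fun setT kernel_integral.
Proof.
pose f (t : (S * S) * (S * L)) := weighted_kernel <=%R t.1 t.2.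
have mf : measurable_fun setT f by exact: measurable_weighted_kernel2 measurable_rel_le.
have f0 t : (0 <= f t)%E by exact: weighted_kernel_ge0.
exact: (@measurable_fun_fubini_tonelli_F _ _ _ _ _
  (sigma_finite_pack (sigma_finite_product sigma leb)) f mf f0).
Qed.

(** If [2 * H < n%:R], the kernel lives in a ball: [C * r ^+ n] leaves the exponent [2 * H - 1] near
    0, and the total mass leaves [2 * H - n - 1] at infinity. Otherwise the kernel vanishes for
    [r > pi], and [2 * H - n - 1] is integrable near 0. *)
Lemma radial_bound : exists b : R -> R, [/\ measurable_fun setT b,
  (forall r, 0 <= b r), (\int[leb]_r (b r)%:E < +oo)%E &
  forall q r, (\int[sigma]_x weighted_kernel <=%R q (x, r) <= (b r)%:E)%E].
Proof.
pose s := fine (sigma setT).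
have sE : s%:E = sigma setT by rewrite /s fineK//; exact: fin_num_measure.
have s0 : 0 <= s by exact: fine_ge0.
pose a := 2 * H - n%:R - 1.
have mk q r : measurable_fun setT (fun x : S => k <=%R q.1 q.2 x r).
  exact: (measurable_ball_kernel measurable_rel_le).
have kE q r : (\int[sigma]_x weighted_kernel <=%R q (x, r) =
    \int[sigma]_x (k <=%R q.1 q.2 x r)%:E * (w r)%:E)%E.
  under eq_integral do rewrite /weighted_kernel EFinM /=.
  rewrite ge0_integralZr//; first exact/measurable_EFinP.
    by move=> x _; rewrite lee_fin ball_kernel_ge0.
  by rewrite lee_fin radial_weight_ge0.
have ks q r : (\int[sigma]_x (k <=%R q.1 q.2 x r)%:E <= s%:E)%E.
  rewrite sE -[leRHS]mul1e -integral_cst//.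
  apply: ge0_le_integral => //; first by move=> x _; rewrite lee_fin ball_kernel_ge0.
  - exact/measurable_EFinP.
  - by move=> x _; rewrite lee_fin ball_kernel_le1.
have mind (D : set R) (e : R) : measurable D ->
    measurable_fun setT (fun r : R => r `^ e * \1_D r).
  by move=> mD; apply: measurable_funM; [exact: measurable_powR|exact: measurable_indic].
have fin (D : set R) (e : R) : measurable D ->
    (\int[leb]_(r in D) (r `^ e)%:E < +oo)%E ->
    (\int[leb]_r (r `^ e * \1_D r)%:E < +oo)%E.
  move=> mD; rewrite integral_mkcond; congr (_ < _)%E; apply: eq_integral => r _.
  rewrite patchE indicE; case: ifP => _; first by rewrite mulr1.
  by rewrite mulr0.
have [C C0 cap] := @surface_measure_cap R n.
have [lt|ge] := ltP (2 * H) n%:R.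
  pose b1 r : R := r `^ (2 * H - 1) * \1_(`]0, 1]%classic : set R) r.
  pose b2 r : R := r `^ a * \1_(`]1, +oo[%classic : set R) r.
  have b10 r : 0 <= b1 r by rewrite mulr_ge0// powR_ge0.
  have b20 r : 0 <= b2 r by rewrite mulr_ge0// powR_ge0.
  have mb1 : measurable_fun setT b1 by exact: mind.
  have mb2 : measurable_fun setT b2 by exact: mind.
  exists (fun r => C * b1 r + s * b2 r); split.
  - by apply: measurable_funD; apply: measurable_funM.
  - by move=> r; rewrite addr_ge0// mulr_ge0.
  - under eq_integral do rewrite EFinD.
    rewrite ge0_integralD//=; last 4 first.
    + by move=> r _; rewrite lee_fin mulr_ge0.
    + by apply/measurable_EFinP; apply: measurable_funM.
    + by move=> r _; rewrite lee_fin mulr_ge0.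
    + by apply/measurable_EFinP; apply: measurable_funM.
    rewrite lte_add_pinfty//.
      under eq_integral do rewrite EFinM.
      rewrite ge0_integralZl_EFin//; last 2 first.
      + by move=> r _; rewrite lee_fin.
      + exact/measurable_EFinP.
      apply: lte_mul_pinfty => //; apply: fin => //.
      by apply: integral_powR_near0 => //; rewrite ltrBrDr addNr mulr_gt0.
    under eq_integral do rewrite EFinM.
    rewrite ge0_integralZl_EFin//; last 2 first.
    + by move=> r _; rewrite lee_fin.
    + exact/measurable_EFinP.
    apply: lte_mul_pinfty => //; apply: fin => //.
    by apply: integral_powR_infty; rewrite /a; lra.
  move=> q r; rewrite kE /w; case: ltP => r0; last first.
    by rewrite mule0 lee_fin addr_ge0// mulr_ge0.
  have [r1|r1] := leP r 1; last first.
    rewrite /b1 /b2 !indicE (memNset (A := `]0, 1]%classic)); last first.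
      by apply/negP; rewrite /= in_itv/= r0 leNgt r1.
    rewrite (mem_set (A := `]1, +oo[%classic)); last by rewrite /= in_itv/= r1.
    rewrite mulr0 mulr0 add0r mulr1 EFinM lee_pmul2r ?lte_fin ?powR_gt0//.
  rewrite /b1 /b2 !indicE (memNset (A := `]1, +oo[%classic)); last first.
    by apply/negP; rewrite /= in_itv/= andbT -leNgt.
  rewrite (mem_set (A := `]0, 1]%classic)); last by rewrite /= in_itv/= r0 r1.
  rewrite mulr0 mulr0 addr0 mulr1.
  have -> : C * r `^ (2 * H - 1) = (C * r ^+ n) * r `^ a.
    rewrite -mulrA -powR_mulrn ?(ltW r0)// -powRD; first by congr (_ * _ `^ _); rewrite /a; ring.
    by rewrite (gt_eqF r0) implybT.
  rewrite EFinM lee_pmul2r ?lte_fin ?powR_gt0//.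
  apply: le_trans (cap q.1 r r0).
  have <- : (\int[sigma]_x (\1_(geoball q.1 r) x)%:E = sigma (geoball q.1 r))%E.
    by rewrite integral_indic ?setIT//; exact: measurable_geoball.
  apply: ge0_le_integral => //.
  - by move=> x _; rewrite lee_fin ball_kernel_ge0.
  - exact/measurable_EFinP.
  - apply/measurable_EFinP; apply: measurable_indic; exact: measurable_geoball.
  move=> x _; rewrite lee_fin /k lt indicE ler_nat.
  case: (boolP (geodist x q.1 <= r)) => //= h.
  by rewrite mem_set ?leq_b1// /geoball /= geodistC.
pose b1 r : R := r `^ a * \1_(`]0, pi]%classic : set R) r.
have b10 r : 0 <= b1 r by rewrite mulr_ge0// powR_ge0.
have mb1 : measurable_fun setT b1 by exact: mind.
exists (fun r => s * b1 r); split.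
- by apply: measurable_funM.
- by move=> r; rewrite mulr_ge0.
- under eq_integral do rewrite EFinM.
  rewrite ge0_integralZl_EFin//; last 2 first.
  + by move=> r _; rewrite lee_fin.
  + exact/measurable_EFinP.
  apply: lte_mul_pinfty => //; apply: fin => //.
  apply: integral_powR_near0; last exact: pi_gt0.
  have : 2 * H > n%:R by rewrite lt_neqAle ge eq_sym Hn.
  by rewrite /a; lra.
move=> q r; rewrite kE /w; case: ltP => r0; last first.
  by rewrite mule0 lee_fin mulr_ge0.
have [rpi|rpi] := leP r pi.
  rewrite /b1 indicE mem_set /= ?in_itv/= ?r0 ?rpi// mulr1 EFinM.
  by rewrite lee_pmul2r ?lte_fin ?powR_gt0//; exact: ks.
rewrite integral0_eq => [|x _]; first by rewrite mul0e lee_fin; exact: mulr_ge0.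
by rewrite /k ltNge ge /= !(le_trans (geodist_lepi _ _) (ltW rpi)).
Qed.

Lemma kernel_integral_bound : exists2 B : R, 0 <= B &
  forall q, (kernel_integral q <= B%:E)%E.
Proof.
have [b [mb b0 bfin bP]] := radial_bound.
exists (fine (\int[leb]_r (b r)%:E)%E).
  by apply/fine_ge0/integral_ge0 => r _; rewrite lee_fin.
move=> q; rewrite fineK; last first.
  by rewrite ge0_fin_numE//; apply/integral_ge0 => r _; rewrite lee_fin.
have mle := measurable_weighted_kernel q measurable_rel_le.
rewrite /kernel_integral (fubini_tonelli2 _ mle (weighted_kernel_ge0 _ _)).
apply: ge0_le_integral => //.
- by move=> r _; apply: integral_ge0 => x _; exact: weighted_kernel_ge0.
- exact: (measurable_fun_fubini_tonelli_G _ mle (weighted_kernel_ge0 _ _)).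
- exact/measurable_EFinP.
- by move=> r _; exact: bP.
Qed.

End ball_kernel.

(** * [KH] as an integral over centres and radii *)

Section kernel_representation.
Context {R : realType} {n : nat}.
Variable H : R.
Hypotheses (H0 : 0 < H) (Hn : 2 * H != n%:R).
Local Notation S := (sphere R n).
Local Notation sigma := (@surface_measure R n).
Local Notation leb := (@lebesgue_measure R).
Local Notation w := (radial_weight (n := n) H).
Local Notation k := (ball_kernel (n := n) H).
Local Notation sgn := (ball_sign (n := n) H).
Let L := measurableTypeR R.

Let integrable_kernel c z z' r : measurable_rel c ->
  sigma.-integrable setT (EFin \o (fun x => k c z z' x r)).
Proof.
move=> mc; apply: (le_integrable measurableT (g := EFin \o cst (1 : R))).
- apply/measurable_EFinP; exact: (measurable_ball_kernel H mc).
- move=> x _; rewrite /= lee_fin normr1 ger0_norm; first exact: ball_kernel_le1.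
  exact: ball_kernel_ge0.
- exact: finite_measure_integrable_cst.
Qed.

Lemma psiHE z z' r : psiH n H (geodist z z') r =
  sgn * \int[sigma]_x k <%R z z' x r.
Proof.
have E x : \1_[set y | geodist y z < r] x * \1_[set y | geodist y z' < r] x =
    ((geodist x z < r) && (geodist x z' < r))%:R :> R.
  rewrite !indicE -natrM mulnb; congr ((_ && _)%:R);
    by apply/idP/idP => [/set_mem|h]; last exact/mem_set.
rewrite /psiH /ball_sign; case: ifPn => h.
  rewrite psiE mul1r; apply: eq_Rintegral => x _.
  by rewrite E /ball_kernel h.
rewrite psiE mulN1r.
pose P (x : S) : R := ((geodist x z < r) && (geodist x z' < r))%:R.
have kE x : k <%R z z' x r = 1 - P x.
  by rewrite /ball_kernel (negbTE h) /P; case: (_ && _); rewrite /= ?subrr ?subr0.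
have iP : sigma.-integrable setT (EFin \o P).
  rewrite (_ : P = fun x => 1 - k <%R z z' x r); last first.
    by apply/funext => x; rewrite kE opprB addrC subrK.
  have := integrableB measurableT (finite_measure_integrable_cst sigma 1 measurableT)
    (integrable_kernel z z' r measurable_rel_lt).
  exact.
under [X in _ = - X]eq_Rintegral do rewrite kE.
rewrite RintegralB//; last exact: finite_measure_integrable_cst.
rewrite Rintegral_cst// mul1r opprB.
by under eq_Rintegral do rewrite E.
Qed.

(** Tonelli's theorem exchanges [x] and [r] in the nonnegative kernel; the uniform bound makes the
    radial integrand integrable, so the sign can be taken out. *)
Lemma KHE q : KH n H (geodist q.1 q.2) = sgn * fine (kernel_integral (n := n) H q).
Proof.
have mlt := measurable_weighted_kernel H q measurable_rel_lt.
have klt0 := weighted_kernel_ge0 (n := n) H <%R q.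
pose c r := \int[sigma]_x k <%R q.1 q.2 x r.
have GE r : (\int[sigma]_x weighted_kernel H <%R q (x, r) = (c r * w r)%:E)%E.
  rewrite /weighted_kernel /=; under eq_integral do rewrite EFinM.
  rewrite ge0_integralZr//; last 3 first.
  - apply/measurable_EFinP; exact: (measurable_ball_kernel H measurable_rel_lt).
  - by move=> x _; rewrite lee_fin ball_kernel_ge0.
  - by rewrite lee_fin radial_weight_ge0.
  rewrite EFinM /c /Rintegral fineK//.
  exact: integrable_fin_num (integrable_kernel _ _ _ measurable_rel_lt).
have mc : measurable_fun setT (fun r => (c r * w r)%:E).
  under eq_fun do rewrite -GE.
  exact: (measurable_fun_fubini_tonelli_G _ mlt klt0).
have intE : (\int[leb]_r (c r * w r)%:E = kernel_integral H q)%E.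
  rewrite -kernel_integral_lt (fubini_tonelli2 _ mlt klt0).
  by apply: eq_integral => r _; rewrite -GE.
have cw0 r : 0 <= c r * w r.
  rewrite -lee_fin -GE; apply: integral_ge0 => x _; exact: weighted_kernel_ge0.
have [B B0 Bk] := kernel_integral_bound H0 Hn.
have icw : leb.-integrable setT (EFin \o (fun r => c r * w r)).
  apply/integrableP; split => //.
  under eq_integral do rewrite /= ger0_norm//.
  by rewrite intE (le_lt_trans (Bk q))// ltry.
have -> : fine (kernel_integral H q) = \int[leb]_r (c r * w r).
  by rewrite -intE.
rewrite -RintegralZl// /KH /Rintegral; congr fine.
pose F r := (psiH n H (geodist q.1 q.2) r * r `^ (2 * H - n%:R - 1))%:E.
have FE r : 0 < r -> F r = (sgn * (c r * w r))%:E.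
  by move=> r0; rewrite /F psiHE /radial_weight r0 mulrA.
(* The integrand of [KH] and the weighted one may differ at [r = 0], so this end point is
   dropped. *)
rewrite -[LHS]/(\int[leb]_(r in `[0%R, +oo[) F r)%E -integral_itv_obnd_cbnd; last first.
  apply: (eq_measurable_fun (fun r => (sgn * (c r * w r))%:E)).
    by move=> r /set_mem /=; rewrite in_itv/= andbT => /FE.
  apply: measurable_funTS; apply/measurable_EFinP; apply: measurable_funM => //.
  exact/measurable_EFinP.
rewrite [LHS]integral_mkcond; apply: eq_integral => r _; rewrite patchE.
case: ifPn => [/set_mem /=|/negP h]; first by rewrite in_itv/= andbT => /FE.
rewrite /radial_weight; case: ifPn => [r0|_]; last by rewrite !mulr0.
by case: h; apply/mem_set; rewrite /= in_itv/= r0.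
Qed.

Variables (nu1 nu2 : {finite_measure set S -> \bar R}).

(** What is obtained from the kernel, up to sign and weight, by integrating over the two points:
    pairs in the ball give a product of masses. The subtracted total masses come from the
    complement. *)
Definition ball_product (p : S * L) : R :=
  fine (nu1 (geoball p.1 p.2)) * fine (nu2 (geoball p.1 p.2)) -
  (if 2 * H < n%:R then 0 else fine (nu1 setT) * fine (nu2 setT)).

Lemma kernel_product p : (\int[nu1 \x nu2]_q weighted_kernel H <=%R q p =
  (sgn * ball_product p * w p.2)%:E)%E.
Proof.
set B := geoball p.1 p.2.
have mB : measurable B by exact: measurable_geoball.
have mBB : measurable (B `*` B) by exact: measurableX.
have f1 A : measurable A -> nu1 A \is a fin_num by exact: fin_num_measure.
have f2 A : measurable A -> nu2 A \is a fin_num by exact: fin_num_measure.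
have EB q : (geodist p.1 q.1 <= p.2) && (geodist p.1 q.2 <= p.2) = (q \in B `*` B).
  by apply/idP/idP => [/andP[h1 h2]|/set_mem[h1 h2]]; [apply/mem_set; split|apply/andP; split].
pose D := if 2 * H < n%:R then B `*` B else ~` (B `*` B).
have mD : measurable D by rewrite /D; case: ifP => // _; exact: measurableC.
have kE q : weighted_kernel H <=%R q p = ((\1_D q : R)%:E * (w p.2)%:E)%E.
  rewrite /weighted_kernel EFinM; congr ((_%:R)%:E * _)%E.
  rewrite EB /D; case: ifP => _; first by case: (_ \in _).
  by rewrite in_setC; case: (_ \in _).
under eq_integral do rewrite kE.
rewrite ge0_integralZr//; last 2 first.
- by apply/measurable_EFinP; exact: measurable_indic.
- by rewrite lee_fin radial_weight_ge0.
rewrite integral_indic// setIT EFinM; congr (_ * _)%E.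
have BE : ((nu1 \x nu2) (B `*` B) = (fine (nu1 B) * fine (nu2 B))%:E)%E.
  rewrite product_measure1E// EFinM !fineK//; [exact: f2|exact: f1].
rewrite /ball_product -/B /D /ball_sign; case: ifP => _; first by rewrite subr0 mul1r.
have TE : ((nu1 \x nu2) setT = (fine (nu1 setT) * fine (nu2 setT))%:E)%E.
  by rewrite -setXTT product_measure1E// EFinM !fineK//; [exact: f2|exact: f1].
have -> : ~` (B `*` B) = setT `\` (B `*` B) by rewrite setTD.
have Tfin : ((nu1 \x nu2) setT < +oo)%E by rewrite TE ltry.
have h := measureD measurableT mBB Tfin; apply: (etrans h).
rewrite setTI [X in (X - _)%E](_ : _ = (fine (nu1 setT) * fine (nu2 setT))%:E)//.
rewrite [X in (_ - X)%E](_ : _ = (fine (nu1 B) * fine (nu2 B))%:E)//.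
by rewrite -EFinB mulN1r opprB.
Qed.

(** Tonelli's theorem between the pairs of points and the balls. The common value is finite because
    the kernel integral is bounded and [nu1], [nu2] are finite, which gives the integrability; the
    sign squares to 1. *)
Lemma KH_product_integral :
  (sigma \x leb)%E.-integrable setT (EFin \o (fun p => ball_product p * w p.2)) /\
  \int[(nu1 \x nu2)%E]_q KH n H (geodist q.1 q.2) =
  \int[(sigma \x leb)%E]_p (ball_product p * w p.2).
Proof.
pose f (t : (S * S) * (S * L)) := weighted_kernel H <=%R t.1 t.2.
have mf : measurable_fun setT f.
  exact: measurable_weighted_kernel2 measurable_rel_le.
have f0 t : (0 <= f t)%E by exact: weighted_kernel_ge0.
pose m1 := sigma_finite_pack (sigma_finite_product nu1 nu2).
pose m2 := sigma_finite_pack (sigma_finite_product sigma leb).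
have J : (\int[nu1 \x nu2]_q kernel_integral H q =
    \int[sigma \x leb]_p (sgn * ball_product p * w p.2)%:E)%E.
  have := @fubini_tonelli _ _ _ _ _ m1 m2 f mf f0.
  rewrite -[X in X = _ -> _]/(\int[nu1 \x nu2]_q kernel_integral H q)%E => ->.
  by apply: eq_integral => p _; rewrite -kernel_product.
have mq : measurable_fun setT (fun p => (sgn * ball_product p * w p.2)%:E).
  under eq_fun do rewrite -kernel_product.
  exact: (@measurable_fun_fubini_tonelli_G _ _ _ _ _ m1 f mf f0).
have [B B0 Bk] := kernel_integral_bound H0 Hn.
have mk := measurable_kernel_integral (n := n) H.
have Jfin : (\int[nu1 \x nu2]_q kernel_integral H q < +oo)%E.
  apply: (@le_lt_trans _ _ (\int[nu1 \x nu2]_q B%:E)%E).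
    apply: ge0_le_integral => //.
    by move=> q _; exact: kernel_integral_ge0.
  have Tfin : ((nu1 \x nu2) setT < +oo)%E.
    rewrite -setXTT product_measure1E// lte_mul_pinfty//; first exact: fin_num_measure.
    by rewrite -ge0_fin_numE//; exact: fin_num_measure.
  by rewrite integral_cst// lte_mul_pinfty.
have q0 p : 0 <= sgn * ball_product p * w p.2.
  by rewrite -lee_fin -kernel_product; apply: integral_ge0 => q _; exact: weighted_kernel_ge0.
have s2 : sgn * sgn = 1 by rewrite /ball_sign; case: ifP => _; rewrite ?mulrNN mulr1.
have iq : (sigma \x leb)%E.-integrable setT
    (EFin \o (fun p => sgn * ball_product p * w p.2)).
  apply/integrableP; split => //.
  under eq_integral do rewrite /= ger0_norm//.
  by rewrite -J.
have qE : (fun p => ball_product p * w p.2) =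
    (fun p => sgn * (sgn * ball_product p * w p.2)).
  by apply/funext => p; rewrite !mulrA s2 mul1r.
split.
  rewrite qE; have := integrableZl measurableT sgn iq.
  by apply: eq_integrable => // p _ /=; rewrite EFinM.
rewrite qE RintegralZl//.
under eq_Rintegral do rewrite KHE.
have kfin (q : S * S) : kernel_integral H q \is a fin_num.
  by rewrite ge0_fin_numE ?kernel_integral_ge0// (le_lt_trans (Bk q))// ltry.
rewrite RintegralZl//; last first.
  apply/integrableP; split.
    by apply/measurable_EFinP; apply: measurableT_comp mk.
  under eq_integral do rewrite /= ger0_norm ?fine_ge0 ?kernel_integral_ge0// fineK//.
  exact: Jfin.
congr (_ * _); rewrite /Rintegral -J; congr fine.
by apply: eq_integral => q _; rewrite fineK.
Qed.

End kernel_representation.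

(** * Ball masses of a signed measure *)

Section charge_representation.
Context {R : realType} {n : nat}.
Variable H : R.
Hypotheses (H0 : 0 < H) (Hn : 2 * H != n%:R).
Local Notation S := (sphere R n).
Local Notation sigma := (@surface_measure R n).
Local Notation leb := (@lebesgue_measure R).
Local Notation w := (radial_weight (n := n) H).
Let L := measurableTypeR R.

Section ball_measure.
Variable nu : {finite_measure set S -> \bar R}.

Let ind (t : S * (S * L)) : R := (geodist t.2.1 t.1 <= (t.2.2 : R))%R%:R.

Let measurable_ind : measurable_fun setT ind.
Proof.
rewrite (_ : ind = fun t => if geodist t.2.1 t.1 <= (t.2.2 : R) then 1 else 0).
  apply: measurable_fun_ifT => //; apply: measurable_fun_ler.
    apply: measurable_geodist => //.
    exact: (measurableT_comp measurable_fst measurable_snd).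
  exact: (measurableT_comp measurable_snd measurable_snd).
by apply/funext => t; rewrite /ind; case: ifP.
Qed.

Let integral_ind (p : S * L) : (\int[nu]_z (ind (z, p))%:E = nu (geoball p.1 p.2))%E.
Proof.
have E z : ind (z, p) = \1_(geoball p.1 p.2) z.
  rewrite indicE; congr (nat_of_bool _)%:R.
  by apply/idP/idP => [h|/set_mem]; first exact/mem_set.
under eq_integral do rewrite E.
by rewrite integral_indic ?setIT//; exact: measurable_geoball.
Qed.

Lemma measurable_ball_measure :
  measurable_fun setT (fun p : S * L => fine (nu (geoball p.1 p.2))).
Proof.
apply: measurableT_comp => //.
have mi : measurable_fun setT (fun t => (ind t)%:E) by exact/measurable_EFinP.
have i0 t : (0 <= (ind t)%:E)%E by rewrite lee_fin.
have := @measurable_fun_fubini_tonelli_G _ _ _ _ _ nu _ mi i0.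
by apply: eq_measurable_fun => p _; rewrite /fubini_G integral_ind.
Qed.

(** Integrating over the centres first, the cap bound [C * r ^+ n] leaves the exponent [2 * H - 1],
    integrable near 0 as [H] is positive. This yields the first moment of the ball masses. *)
Lemma integral_ball_measure_lty b : 0 < b ->
  (\int[sigma \x leb]_p
     (fine (nu (geoball p.1 p.2)) * (w p.2 * \1_(`]0, b]%classic : set R) p.2))%:E < +oo)%E.
Proof.
move=> b0.
pose v (r : R) : R := w r * \1_(`]0, b]%classic : set R) r.
have v0 r : 0 <= v r by apply: mulr_ge0 => //; exact: radial_weight_ge0.
have mv : measurable_fun setT v.
  by apply: measurable_funM; [exact: measurable_radial_weight|exact: measurable_indic].
pose f t := (ind t * v t.2.2)%:E.
have mf : measurable_fun setT f.
  apply/measurable_EFinP/measurable_funM => //; apply: (measurableT_comp mv).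
  exact: (measurableT_comp measurable_snd measurable_snd).
have f0 t : (0 <= f t)%E by rewrite lee_fin mulr_ge0.
pose m2 := sigma_finite_pack (sigma_finite_product sigma leb).
have := @fubini_tonelli _ _ _ _ _ nu m2 f mf f0.
rewrite -[X in _ = X -> _]/(\int[sigma \x leb]_p \int[nu]_z f (z, p))%E.
have -> : (\int[sigma \x leb]_p \int[nu]_z f (z, p) =
    \int[sigma \x leb]_p (fine (nu (geoball p.1 p.2)) * v p.2)%:E)%E.
  apply: eq_integral => p _; rewrite /f; under eq_integral do rewrite EFinM /=.
  rewrite ge0_integralZr//; last 3 first.
  - by apply/measurable_EFinP; exact: (measurableT_comp measurable_ind (measurable_pair2 p)).
  - by move=> z _; rewrite lee_fin.
  - by rewrite lee_fin.
  rewrite integral_ind [in RHS]EFinM fineK//; apply: fin_num_measure; exact: measurable_geoball.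
move=> <-.
have [C C0 cap] := @surface_measure_cap R n.
pose I := (\int[leb]_(r in `]0%R, b]) (r `^ (2 * H - 1))%:E)%E.
have Ifin : (I < +oo)%E.
  by apply: integral_powR_near0 => //; rewrite ltrBrDr addNr mulr_gt0.
have I0 : (0 <= I)%E by apply: integral_ge0 => r _; rewrite lee_fin powR_ge0.
have mI : measurable_fun setT
    ((fun r : L => (r `^ (2 * H - 1))%:E) \_ (`]0, b]%classic : set R)).
  apply/(measurable_restrictT (fun r : L => (r `^ (2 * H - 1))%:E)).
    exact: measurable_itv.
  apply: measurable_funTS; apply/measurable_EFinP; exact: measurable_powR.
have inner z : (\int[m2]_p f (z, p) <= C%:E * I)%E.
  have mfz : measurable_fun setT (fun p => f (z, p)).
    exact: (measurableT_comp mf (measurable_pair1 z)).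
  rewrite -[X in (X <= _)%E]/(\int[sigma \x leb]_p f (z, p))%E.
  rewrite (fubini_tonelli2 _ mfz)// /I [X in (_ <= _ * X)%E]integral_mkcond.
  rewrite -ge0_integralZl//; last first.
  - by move=> r _; rewrite patchE; case: ifP => _; rewrite ?lee_fin ?powR_ge0.
  apply: ge0_le_integral => //.
  - by move=> r _; apply: integral_ge0.
  - exact: (measurable_fun_fubini_tonelli_G _ mfz).
  - exact: emeasurable_funM.
  move=> r _; rewrite /fubini_G /f /=; under eq_integral do rewrite EFinM.
  rewrite ge0_integralZr//; last 3 first.
  - apply/measurable_EFinP.
    apply: (measurableT_comp measurable_ind) => //.
    by apply: measurable_fun_pair => //; apply: measurable_fun_pair.
  - by move=> x _; rewrite lee_fin.
  - by rewrite lee_fin.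
  rewrite patchE /v indicE; case: ifPn => [/set_mem /=|_]; last by rewrite !mulr0 !mule0.
  rewrite in_itv/= => /andP[r0 rb]; rewrite mulr1 /radial_weight r0.
  have -> : r `^ (2 * H - 1) = r ^+ n * r `^ (2 * H - n%:R - 1).
    rewrite -powR_mulrn ?(ltW r0)// -powRD; first by congr (_ `^ _); ring.
    by rewrite (gt_eqF r0) implybT.
  rewrite -EFinM mulrA [leRHS]EFinM lee_pmul2r ?lte_fin ?powR_gt0//.
  apply: le_trans (cap z r r0).
  have <- : (\int[sigma]_x (\1_(geoball z r) x)%:E = sigma (geoball z r))%E.
    by rewrite integral_indic ?setIT//; exact: measurable_geoball.
  rewrite le_eqVlt; apply/orP; left; apply/eqP; apply: eq_integral => x _.
  congr EFin; rewrite indicE; congr (nat_of_bool _)%:R; rewrite /= geodistC.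
  by apply/idP/idP => [h|/set_mem]; first exact/mem_set.
apply: (@le_lt_trans _ _ (\int[nu]_z (C%:E * I))%E).
  apply: ge0_le_integral => //.
  - by move=> z _; exact: integral_ge0.
  - exact: (@measurable_fun_fubini_tonelli_F _ _ _ _ _ m2 f mf f0).
rewrite integral_cst// lte_mul_pinfty//; last by rewrite -ge0_fin_numE// fin_num_measure.
- by rewrite mule_ge0.
- by rewrite fin_numM// ge0_fin_numE.
Qed.

End ball_measure.

Variable mu : {charge set S -> \bar R}.

(** Cut off at negative radii, so that the restricted integral in [ball_functional] becomes an
    integral over the whole product. *)
Definition ball_charge (p : S * R) : R :=
  if 0 <= p.2 then fine (mu (geoball p.1 p.2)) else 0.

Lemma fine_chargeE A : measurable A ->
  fine (mu A) = fine (charge_pos mu A) - fine (charge_neg mu A).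
Proof.
move=> mA; rewrite (jordan_decomp (projT2 (hahn_sets mu)) mA).
rewrite /cadd /= cscaleN1 -/(charge_pos mu A) -/(charge_neg mu A).
by rewrite fineB//; exact: fin_num_measure.
Qed.

Lemma measurable_ball_charge : measurable_fun setT (ball_charge : S * L -> R).
Proof.
apply: measurable_fun_ifT => //; first exact: measurable_fun_ler.
rewrite (_ : (fun _ => _) = fun p => fine (charge_pos mu (geoball p.1 p.2)) -
    fine (charge_neg mu (geoball p.1 p.2))).
  by apply: measurable_funB; exact: measurable_ball_measure.
by apply/funext => p; apply: fine_chargeE; exact: measurable_geoball.
Qed.

(** Expanding the charge in its Jordan parts, the four ball products add up to [mu (B) ^ 2], minus
    [mu (S_n) ^ 2] in the case where total masses were subtracted. *)
Lemma charge_integral2E : MH H mu ->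
  (sigma \x leb)%E.-integrable setT (EFin \o (fun p => ball_charge p ^+ 2 * w p.2)) /\
  charge_integral2 mu mu (fun q => KH n H (geodist q.1 q.2)) =
  \int[(sigma \x leb)%E]_p (ball_charge p ^+ 2 * w p.2).
Proof.
move=> Mmu.
have [i11 e11] := KH_product_integral H0 Hn (charge_pos mu) (charge_pos mu).
have [i12 e12] := KH_product_integral H0 Hn (charge_pos mu) (charge_neg mu).
have [i21 e21] := KH_product_integral H0 Hn (charge_neg mu) (charge_pos mu).
have [i22 e22] := KH_product_integral H0 Hn (charge_neg mu) (charge_neg mu).
have iB1 := integrableB measurableT i11 i12.
have iB2 := integrableB measurableT iB1 i21.
have iD := integrableD measurableT iB2 i22.
pose q (nu1 nu2 : {finite_measure set S -> \bar R}) (p : S * L) := ball_product H nu1 nu2 p * w p.2.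
have qE p : ball_charge p ^+ 2 * w p.2 =
    q (charge_pos mu) (charge_pos mu) p - q (charge_pos mu) (charge_neg mu) p -
    q (charge_neg mu) (charge_pos mu) p + q (charge_neg mu) (charge_neg mu) p.
  rewrite /q /ball_charge; case: (leP 0 p.2) => p0; last first.
    by rewrite /radial_weight ltNge (ltW p0)/= !mulr0 !subr0 addr0.
  rewrite fine_chargeE; last exact: measurable_geoball.
  rewrite /ball_product; case: ltP => h; first by ring.
  (* The two Jordan parts have the same total mass, so the subtracted products cancel. *)
  have : fine (mu setT) = 0 by rewrite Mmu// lt_neqAle h eq_sym Hn.
  rewrite fine_chargeE// => /eqP; rewrite subr_eq0 => /eqP ->; ring.
split.
  by apply: eq_integrable iD => // p _ /=; rewrite qE.
rewrite /charge_integral2 e11 e12 e21 e22.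
under [RHS]eq_Rintegral do rewrite qE.
set q11 := q (charge_pos mu) (charge_pos mu).
set q12 := q (charge_pos mu) (charge_neg mu).
set q21 := q (charge_neg mu) (charge_pos mu).
have j1 : (sigma \x leb)%E.-integrable setT (EFin \o (fun p => q11 p - q12 p)).
  exact: iB1.
have j2 : (sigma \x leb)%E.-integrable setT (EFin \o (fun p => q11 p - q12 p - q21 p)).
  exact: iB2.
by rewrite RintegralD// RintegralB// RintegralB.
Qed.

End charge_representation.

(** * Measures defined by a density *)

Section density_measure.
Variables (d : measure_display) (T : measurableType d) (R : realType).
Variables (mu : {measure set T -> \bar R}) (g : T -> R).
Hypotheses (mg : measurable_fun setT g) (g0 : forall x, 0 <= g x).

Definition density_measure of measurable_fun setT g & (forall x, 0 <= g x) :=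
  fun A : set T => (\int[mu]_(x in A) (g x)%:E)%E.
Local Notation nu := (density_measure mg g0).

Let nu0 : nu set0 = 0%E.
Proof. exact: integral_set0. Qed.

Let nu_ge0 A : (0 <= nu A)%E.
Proof. by apply: integral_ge0 => x _; rewrite lee_fin. Qed.

Let nu_sigma_additive : semi_sigma_additive nu.
Proof.
move=> F mF tF mUF; rewrite /density_measure ge0_integral_bigcup//.
- apply: is_cvg_ereal_nneg_natsum_cond => i _ _; exact: nu_ge0.
- by apply/measurable_EFinP; exact: measurable_funTS.
- by move=> x _; rewrite lee_fin.
Qed.

HB.instance Definition _ := isMeasure.Build _ _ _ nu nu0 nu_ge0 nu_sigma_additive.

End density_measure.

(** * The space of centres and radii *)

Section ball_space.
Context {R : realType} {n : nat}.
Local Notation S := (sphere R n).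
Local Notation sigma := (@surface_measure R n).
Local Notation leb := (@lebesgue_measure R).
Let L := measurableTypeR R.

(* The Poisson measures live on [S * R] with the measurable structure of a real
   type, while Lebesgue measure is defined on [measurableTypeR R]. *)
Lemma measurable_ball_id : measurable_fun setT ((fun p => p) : S * L -> S * R).
Proof.
apply/measurable_fun_pairP; split; first exact: measurable_fst.
exact: measurable_snd.
Qed.

Lemma measurable_ball_id' : measurable_fun setT ((fun p => p) : S * R -> S * L).
Proof.
apply/measurable_fun_pairP; split; first exact: measurable_fst.
exact: measurable_snd.
Qed.

Definition ball_space : {measure set (S * R) -> \bar R} :=
  measure_function_pushforward__canonical__measure_function_Measure
    (sigma \x leb)%E measurable_ball_id.

Lemma ge0_integral_ball_space A (f : S * R -> \bar R) : measurable A ->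
  measurable_fun setT f -> (forall p, 0 <= f p)%E ->
  (\int[ball_space]_(p in A) f p = \int[sigma \x leb]_(p in A) f p)%E.
Proof.
move=> mA mf f0.
rewrite /ball_space /= (ge0_integral_pushforward measurable_ball_id)//.
exact: measurable_funTS.
Qed.

Lemma integrable_ball_space (f : S * R -> R) : measurable_fun setT f ->
  (sigma \x leb)%E.-integrable setT (EFin \o f) ->
  ball_space.-integrable setT (EFin \o f).
Proof.
move=> mf intf; apply: (integrable_pushforward measurable_ball_id) => //.
exact/measurable_EFinP.
Qed.

Lemma Rintegral_ball_space (f : S * R -> R) : measurable_fun setT f ->
  (sigma \x leb)%E.-integrable setT (EFin \o f) ->
  \int[ball_space]_p f p = \int[(sigma \x leb)%E]_p f p.
Proof.
move=> mf intf; rewrite /Rintegral /ball_space /=.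
have mf' : measurable_fun setT (EFin \o f) by exact/measurable_EFinP.
by rewrite (integral_pushforward measurable_ball_id mf').
Qed.

End ball_space.

(** * Global bounds on the radius density *)

Section profile.
Context {R : realType} {n : nat}.
Variables (H : R) (f : R -> R).
Hypothesis Af : assumptionA n H f.

(** The closed support misses [pi], hence a whole neighbourhood of it. *)
Lemma assumptionA_eq0 : exists2 b : R, 0 < b < pi & forall r, b <= r -> f r = 0.
Proof.
set D := closure [set r | 0 <= r /\ f r != 0].
have Dpi : ~ D pi by move=> /(assumptionA_support Af) /=; rewrite in_itv/= ltxx andbF.
have : nbhs (pi : R) (~` D) by apply: open_nbhs_nbhs; split => //; exact/closed_openC/closed_closure.
move=> /nbhs_ballP[e /= e0 eD].
(* The minimum with [pi] keeps [b] positive even when the radius [e] is large. *)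
pose b : R := pi - Num.min e pi / 2.
have pi0 := @pi_gt0 R.
have m0 : 0 < Num.min e pi by rewrite lt_min e0.
have me : Num.min e pi <= e by rewrite ge_min lexx.
have mp : Num.min e pi <= pi by rewrite ge_min lexx orbT.
exists b; first by rewrite /b; apply/andP; split; lra.
move=> r br; apply/eqP; apply: contrapT => /negP fr.
have r0 : 0 <= r by rewrite (le_trans _ br)// /b; lra.
have Dr : D r by apply: subset_closure.
have [pr|rp] := leP pi r.
  by have := assumptionA_support Af Dr; rewrite /= in_itv/= ltNge pr andbF.
apply: (eD r) Dr; rewrite /ball/= gtr0_norm ?subr_gt0//.
by rewrite /b in br; lra.
Qed.

(** The equivalent at 0 gives the constant 2 on some []0, e[], boundedness on compact sets handles
    [[e, b]], and beyond [b] the function vanishes. This is the domination of the rescaled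
    intensities by their limit. *)
Lemma assumptionA_le : exists2 K : R, 0 <= K &
  forall r, 0 < r -> f r <= K * r `^ (2 * H - n%:R - 1).
Proof.
set a := 2 * H - n%:R - 1.
have [b /andP[b0 bpi] fb] := assumptionA_eq0.
have aE : - n%:R - 1 + 2 * H = a by rewrite /a; ring.
have [e e0 fe] : exists2 e : R, 0 < e & forall r, 0 < r -> r < e -> f r <= 2 * r `^ a.
  have := assumptionA_equiv Af; rewrite aE => h.
  have {h} : \forall r \near 0^'+, f r / r `^ a <= 2 by apply: (cvgr_le _ h); lra.
  move=> [e /= e0 he]; exists e => // r r0 re.
  have := he r; rewrite /ball_/= sub0r normrN gtr0_norm// => /(_ re r0).
  by rewrite ler_pdivrMr ?powR_gt0.
have [le|lt] := leP e b; last first.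
  exists 2 => // r r0; have [re|er] := ltP r e; first exact: fe.
  by rewrite fb ?(le_trans (ltW lt))// mulr_ge0// powR_ge0.
have Keb : `[e, b]%classic `<=` (`]0, pi[ : set R).
  move=> r /=; rewrite !in_itv/= => /andP[er rb].
  by rewrite (lt_le_trans e0 er) (le_lt_trans rb bpi).
have [M fM] := assumptionA_bounded Af (@segment_compact _ e b) Keb.
(* The power with exponent [a] is bounded below on [[e, b]] through the maximum of the one with
   exponent [- a], whatever the sign of [a]. *)
have [c cI cmax] := EVT_max le (within_continuous_powR (v := b) (a := - a) e0).
pose K := Num.max 2 (Num.max 0 M * c `^ (- a)).
exists K => [|r r0]; first by rewrite le_max ler0n.
have ra0 : 0 <= r `^ a by exact: powR_ge0.
have [re|er] := ltP r e.
  by apply: (le_trans (fe r r0 re)); rewrite ler_wpM2r// le_max lexx.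
have [rb|br] := leP r b; last first.
  by rewrite fb ?(ltW br)// mulr_ge0// le_max ler0n.
have rI : r \in `[e, b] by rewrite in_itv/= er rb.
have M0 : 0 <= Num.max 0 M by rewrite le_max lexx.
apply: (@le_trans _ _ (Num.max 0 M)).
  by apply: (le_trans (fM r _)) => //; rewrite le_max lexx orbT.
apply: (@le_trans _ _ (Num.max 0 M * c `^ (- a) * r `^ a)); last first.
  by rewrite ler_wpM2r// le_max lexx orbT.
rewrite -mulrA ler_peMr//.
rewrite -[X in X <= _](_ : r `^ (- a) * r `^ a = 1); last first.
  by rewrite -powRD ?addNr ?powRr0// (gt_eqF r0) implybT.
by rewrite ler_wpM2r//; exact: cmax.
Qed.

End profile.

(** * Convergence to the Gaussian functional *)

Lemma Rintegral_linear (d : measure_display) (T : measurableType d) (R : realType)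
    (m : {measure set T -> \bar R}) (k : nat) (a : 'I_k -> R) (F : 'I_k -> T -> R) :
  (forall i, m.-integrable setT (EFin \o F i)) ->
  \int[m]_x (\sum_i a i * F i x) = \sum_i a i * \int[m]_x F i x.
Proof.
move=> iF.
have iaF i : m.-integrable setT (EFin \o (fun x => a i * F i x)).
  exact: (integrableZl measurableT _ (iF i)).
rewrite {1}/Rintegral; under eq_integral do rewrite -sumEFin.
rewrite integral_sum// -sum_fine; last by move=> i _; exact: integrable_fin_num (iaF i).
by apply: eq_bigr => i _; rewrite -RintegralZl.
Qed.

Lemma ae_eq_Rintegral (d : measure_display) (T : measurableType d) (R : realType)
    (m : {measure set T -> \bar R}) (f g : T -> R) :
  measurable_fun setT f -> measurable_fun setT g -> {ae m, forall x, f x = g x} ->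
  \int[m]_x f x = \int[m]_x g x.
Proof.
move=> mf mg fg; rewrite /Rintegral; congr fine; apply: ae_eq_integral => //.
- exact/measurable_EFinP.
- exact/measurable_EFinP.
- by apply: filterS fg => x /= -> _.
Qed.

Lemma poisson_random_measure_ext (d d' : measure_display) (O : measurableType d)
    (T : measurableType d') (R : realType) (P : probability O R) (N : R.-ker O ~> T)
    (m m' : set T -> \bar R) :
  (forall A, measurable A -> m A = m' A) ->
  poisson_random_measure P N m -> poisson_random_measure P N m'.
Proof.
move=> mm' [h1 h2 h3]; split => // A mA; rewrite -mm'//; [exact: h1|exact: h2].
Qed.

(** * Linear combinations of charges and the limit functional *)

Section gaussian_combination.
Variables (R : realType) (n : nat) (H : R).
Variables (d' : measure_display) (O' : measurableType d') (P' : probability O' R).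
Variable W : {charge set (sphere R n) -> \bar R} -> {RV P' >-> R}.
Variable C : {charge set (sphere R n) -> \bar R} ->
  {charge set (sphere R n) -> \bar R} -> R.
Hypothesis GW : centered_gaussian_functional (MH H) C W.

Lemma MH_combination a b (mu nu : {charge set (sphere R n) -> \bar R}) :
  MH H mu -> MH H nu -> MH H (cadd (cscale a mu) (cscale b nu)).
Proof.
move=> Mmu Mnu h; transitivity (a%:E * 0 + b%:E * 0 : \bar R)%E.
  by congr (_ * _ + _ * _)%E; [exact: Mmu|exact: Mnu].
by rewrite !mule0 adde0.
Qed.

Lemma fine_combination a b (mu nu : {charge set (sphere R n) -> \bar R}) A :
  measurable A -> fine (cadd (cscale a mu) (cscale b nu) A) =
  a * fine (mu A) + b * fine (nu A).
Proof.
move=> mA; have f1 := fin_num_measure mu _ mA; have f2 := fin_num_measure nu _ mA.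
rewrite /cadd /= /cscale fineD; [|exact: fin_numM|exact: fin_numM].
by rewrite !fineM.
Qed.

(** The device that reduces joint laws to one charge. Linearity of [W] is an almost sure statement
    about two charges at a time, so the combination is built term by term. *)
Lemma charge_combination (k : nat) (a : 'I_k -> R)
    (mu : 'I_k -> {charge set (sphere R n) -> \bar R}) :
  (0 < k)%N -> (forall i, MH H (mu i)) ->
  exists nu : {charge set (sphere R n) -> \bar R}, [/\ MH H nu,
    forall A, measurable A -> fine (nu A) = \sum_i a i * fine (mu i A) &
    {ae P', forall w, W nu w = \sum_i a i * W (mu i) w}].
Proof.
move=> k0 Mmu.
suff: forall s : seq 'I_k, exists nu : {charge set (sphere R n) -> \bar R}, [/\ MH H nu,
    forall A, measurable A -> fine (nu A) = \sum_(i <- s) a i * fine (mu i A) &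
    {ae P', forall w, W nu w = \sum_(i <- s) a i * W (mu i) w}].
  by move=> /(_ (index_enum 'I_k)).
elim=> [|i s [nu [Mnu nuE Wnu]]].
  (* The zero charge is written as a combination of [mu i0], so that linearity makes [W] vanish at
     it almost surely. *)
  pose i0 := Ordinal k0.
  exists (cadd (cscale 0 (mu i0)) (cscale 0 (mu i0))); split.
  - exact: MH_combination.
  - by move=> A mA; rewrite fine_combination// !mul0r addr0 big_nil.
  - have := cgf_linear GW 0 0 (Mmu i0) (Mmu i0).
    by apply: filterS => w ->; rewrite !mul0r addr0 big_nil.
exists (cadd (cscale (a i) (mu i)) (cscale 1 nu)); split.
- exact: MH_combination.
- by move=> A mA; rewrite fine_combination// big_cons nuE// mul1r.
- have := cgf_linear GW (a i) 1 (Mmu i) Mnu.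
  by apply: filterS2 Wnu => w e ->; rewrite big_cons e mul1r.
Qed.

(** Taking [k = 1] in the Gaussian clause gives a law with some parameter [s]; the covariance clause
    identifies [s ^+ 2] with [C nu nu]. *)
Lemma gaussian_functional_moments nu : MH H nu ->
  (forall b, \int[P']_w cos (W nu w + b) = expR (- (C nu nu / 2)) * cos b) /\
  (\int[P']_w (W nu w ^+ 2)%:E)%E = (C nu nu)%:E.
Proof.
move=> Mnu.
have [s law] := cgf_gaussian GW (fun _ : 'I_1 => 1) (fun _ => Mnu).
have lawX : forall B, measurable B -> P' [set w | B (W nu w)] = gaussian_prob 0 s B.
  move=> B mB; rewrite -law//; congr (P' _); apply/seteqP.
  by split => w /=; rewrite big_ord1 mul1r.
have [v1 v2] := gaussian_variance lawX.
have Cs : C nu nu = s ^+ 2.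
  by have := cgf_cov GW Mnu Mnu; rewrite v1 => -[].
split; last by rewrite v2 Cs.
move=> b; have := gaussian_cos lawX 1 b.
rewrite expr1n mulr1 -Cs => <-; apply: eq_Rintegral => w _.
by rewrite mul1r.
Qed.

End gaussian_combination.

(** * The normalized functional along a sequence of scales *)

Section sequence_limit.
Context {R : realType} {n : nat}.
Variables (H : R) (f lambda : R -> R).
Variables (d : R -> measure_display) (Omega : forall rho : R, measurableType (d rho)).
Variable P : forall rho : R, probability (Omega rho) R.
Variable N : forall rho : R, R.-ker (Omega rho) ~> (sphere R n * R)%type.
Hypotheses (H0 : 0 < H) (Hn : 2 * H != n%:R) (Af : assumptionA n H f).
Hypothesis lambda0 : forall rho, 0 < rho -> 0 < lambda rho.
Hypothesis lambday : lambda rho * rho `^ (n%:R - 2 * H) @[rho --> +oo] --> +oo.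
Hypothesis prmN : forall rho, 0 < rho ->
  poisson_random_measure (P rho) (N rho) (ball_intensity lambda f rho).
Variable rho : nat -> R.
Hypotheses (rho0 : forall j, 0 < rho j) (rhoy : rho j @[j --> \oo] --> +oo).
Local Notation S := (sphere R n).
Local Notation sigma := (@surface_measure R n).
Local Notation leb := (@lebesgue_measure R).
Local Notation M := (@ball_space R n).
Local Notation al := (2 * H - n%:R - 1).
Let L := measurableTypeR R.

Let w (p : S * R) : R := radial_weight (n := n) H p.2.

Let mw : measurable_fun setT w.
Proof. exact: (measurableT_comp (@measurable_radial_weight R n H) measurable_snd). Qed.

Let s (j : nat) : R := Num.sqrt (lambda (rho j) * rho j `^ (n%:R - 2 * H)).

Let s0 j : 0 < s j.
Proof. by rewrite sqrtr_gt0 mulr_gt0 ?powR_gt0// lambda0. Qed.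

Let sy : s j @[j --> \oo] --> +oo.
Proof.
have /cvgryPge h := cvg_comp _ _ rhoy lambday.
apply/cvgryPge => A; have := h (A ^+ 2); apply: filterS => j /= Aj.
have [A0|/ltW A0] := leP 0 A; last exact: le_trans A0 (sqrtr_ge0 _).
rewrite (_ : A = Num.sqrt (A ^+ 2)); first exact: ler_wsqrtr.
by rewrite sqrtr_sqr ger0_norm.
Qed.

(** Set to 0 also at radius 0, where the value of [f] is not controlled by the power; the domination
    by the weight then holds at every point. *)
Let dens (j : nat) (p : S * R) : R :=
  if 0 < p.2 then lambda (rho j) * (rho j)^-1 * f ((rho j)^-1 * p.2) else 0.

(** Measurability of [f] is given on the half-line only, whence this extension by 0. *)
Let fr : R -> R := f \_ (`[0, +oo[%classic : set R).

Let mfr : measurable_fun setT fr.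
Proof.
apply/(measurable_restrictT f); first exact: measurable_itv.
exact: (assumptionA_measurable Af).
Qed.

Let frE r : 0 <= r -> fr r = f r.
Proof. by move=> r0; rewrite /fr patchE mem_set//= in_itv/= r0. Qed.

Let inv_ge0 j r : 0 <= r -> 0 <= (rho j)^-1 * r.
Proof. by move=> r0; rewrite mulr_ge0// invr_ge0 ltW. Qed.

Let mdens j : measurable_fun setT (dens j).
Proof.
rewrite (_ : dens j = fun p => if 0 < p.2 then
    lambda (rho j) * (rho j)^-1 * fr ((rho j)^-1 * p.2) else 0).
  apply: measurable_fun_ifT => //; first exact: measurable_fun_ltr.
  apply: measurable_funM => //; apply: (measurableT_comp mfr).
  exact: measurable_funM.
apply/funext => p; rewrite /dens; case: ifPn => // p0.
by rewrite frE// inv_ge0// ltW.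
Qed.

Let dens0 j p : 0 <= dens j p.
Proof.
rewrite /dens; case: ifPn => // p0.
rewrite mulr_ge0// ?(assumptionA_ge0 Af)// ?inv_ge0 ?(ltW p0)//.
by rewrite mulr_ge0 ?invr_ge0// ltW ?lambda0.
Qed.

Let m (j : nat) : {measure set (S * R) -> \bar R} :=
  density_measure M (mdens j) (dens0 j).

Let mE j A : measurable A -> m j A = (\int[M]_(p in A) (dens j p)%:E)%E.
Proof. by []. Qed.

(** The integrands agree except possibly at radius 0, which is a null set; on negative radii both
    vanish. *)
Let ball_intensityE j A : measurable A -> ball_intensity lambda f (rho j) A = m j A.
Proof.
move=> mA; rewrite /m /= /density_measure ge0_integral_ball_space//; last 2 first.
- exact/measurable_EFinP.
- by move=> p; rewrite lee_fin.
have mA' : measurable (A : set (S * L)).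
  by have := @measurable_ball_id R n measurableT A mA; rewrite setTI.
pose phi (p : S * L) : \bar R :=
  (lambda (rho j) * (rho j)^-1 * fr ((rho j)^-1 * p.2))%:E.
have mphi : measurable_fun setT phi.
  apply/measurable_EFinP; apply: measurable_funM => //.
  by apply: (measurableT_comp mfr); apply: measurable_funM => //; exact: measurable_snd.
transitivity (\int[sigma \x leb]_(p in A) phi p)%E.
  rewrite /ball_intensity integral_mkcondr; apply: eq_integral => p _.
  rewrite patchE /phi; case: ifPn => [/set_mem [_ /=]|h].
    by rewrite in_itv/= andbT => p0; rewrite frE// inv_ge0.
  have p0 : p.2 < 0 :> R.
    rewrite ltNge; apply: contra h => p0; apply/mem_set; split => //=.
    by rewrite in_itv/= p0.
  rewrite /fr patchE memNset ?mulr0//=; apply/negP; rewrite in_itv/= andbT -ltNge.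
  by rewrite pmulr_rlt0// invr_gt0.
apply: ae_eq_integral => //.
- exact: measurable_funTS.
- have md := measurableT_comp (mdens j) (@measurable_ball_id R n).
  by apply: measurable_funTS; apply/measurable_EFinP.
exists (setT `*` [set 0]); split.
- by apply: measurableX => //; exact: measurable_set1.
- have e := product_measure1E sigma leb measurableT (measurable_set1 (0 : R)).
  apply: (etrans e).
  rewrite [X in (_ * X)%E](_ : _ = 0%E) ?mule0//; exact: lebesgue_measure_set1.
move=> p /=; apply: contra_notP => /not_andP[//|p0] _.
rewrite /phi /dens; case: ltP => [p1|p1]; first by rewrite frE// inv_ge0// ltW.
have p2 : p.2 < 0 :> R by rewrite lt_neqAle p1 andbT; apply/eqP.
rewrite /fr patchE memNset ?mulr0//=; apply/negP; rewrite in_itv/= andbT -ltNge.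
by rewrite pmulr_rlt0// invr_gt0.
Qed.

Let prm j : poisson_random_measure (P (rho j)) (N (rho j)) (m j).
Proof.
by apply: poisson_random_measure_ext (prmN (rho0 j)) => A; exact: ball_intensityE.
Qed.

Let densE j p : 0 < p.2 ->
  dens j p / s j ^+ 2 = f ((rho j)^-1 * p.2) * rho j `^ al.
Proof.
move=> p0; rewrite /dens p0 /s sqr_sqrtr; last first.
  by rewrite mulr_ge0 ?powR_ge0// ltW ?lambda0.
have -> : rho j `^ al = (rho j)^-1 * (rho j `^ (n%:R - 2 * H))^-1.
  rewrite -powRN -powR_inv1 ?(ltW (rho0 j))// -powRD ?(gt_eqF (rho0 j)) ?implybT//.
  by congr (_ `^ _); ring.
have l0 : lambda (rho j) != 0 by rewrite gt_eqF ?lambda0.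
rewrite invfM; set u := (_ `^ _)^-1; set v := f _.
rewrite -[RHS]mul1r -(mulfV l0).
by move: (lambda (rho j))^-1 (rho j)^-1 => x y; ring.
Qed.

Let powR_rho j r : 0 < r -> ((rho j)^-1 * r) `^ al * rho j `^ al = r `^ al.
Proof.
move=> r0; rewrite -powRM ?inv_ge0 ?(ltW r0) ?(ltW (rho0 j))//.
by rewrite mulrAC mulVf ?mul1r// gt_eqF.
Qed.

Let K_ex := assumptionA_le Af.

Let dens_le K j p : (forall r, 0 < r -> f r <= K * r `^ al) ->
  dens j p / s j ^+ 2 <= K * w p.
Proof.
move=> fK; rewrite /w /radial_weight; case: ltP => p0; last first.
  by rewrite /dens ltNge p0/= mul0r mulr0.
rewrite densE// -(powR_rho j p0) mulrA ler_wpM2r ?powR_ge0// fK//.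
by rewrite mulr_gt0// invr_gt0.
Qed.

Let dens_cvg p : dens j p / s j ^+ 2 @[j --> \oo] --> w p.
Proof.
rewrite /w /radial_weight; case: ltP => p0; last first.
  rewrite (_ : (fun j => _) = cst 0); first exact: cvg_cst.
  by apply/funext => j; rewrite /dens ltNge p0/= mul0r.
pose x j := (rho j)^-1 * p.2.
have x0 j : 0 < x j by rewrite mulr_gt0// invr_gt0.
have xc : x j @[j --> \oo] --> 0.
  rewrite -[X in _ --> X](mul0r p.2); apply: cvgMl.
  by apply/gtr0_cvgV0 => //; apply: nearW.
have aE : - n%:R - 1 + 2 * H = al by ring.
have := assumptionA_equiv Af; rewrite aE => /cvg_at_rightP/(_ x (conj x0 xc)) fx.
rewrite (_ : (fun j => _) = fun j => f (x j) / x j `^ al * p.2 `^ al).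
  by rewrite -[X in _ --> X]mul1r; exact: cvgMl.
apply/funext => j; rewrite densE// -(powR_rho j p0) -/(x j) mulrA divfK//.
by rewrite gt_eqF// powR_gt0.
Qed.

Section one_charge.
Variable mu : {charge set S -> \bar R}.
Hypothesis Mmu : MH H mu.
Let h : S * R -> R := ball_charge mu.

Let mh : measurable_fun setT h.
Proof. exact: (measurableT_comp (measurable_ball_charge mu) (@measurable_ball_id' R n)). Qed.

(** As [f] vanishes beyond [b], only radii up to [b * rho j] count; there the density is at most a
    multiple of the weight, and the ball masses of the Jordan parts are integrable by
    [integral_ball_measure_lty]. *)
Lemma integrable_ball_charge j : (m j).-integrable setT (EFin \o h).
Proof.
apply/(integrable_density (mdens j) (dens0 j) (mE j) mh).
have [K K0 fK] := K_ex.
have [b /andP[b0 bpi] fb] := assumptionA_eq0 Af.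
pose v (r : R) : R := radial_weight (n := n) H r * \1_(`]0, b * rho j]%classic : set R) r.
have v0 r : 0 <= v r by apply: mulr_ge0 => //; exact: radial_weight_ge0.
have mv : measurable_fun setT v.
  by apply: measurable_funM; [exact: measurable_radial_weight|exact: measurable_indic].
pose F (nu : {finite_measure set S -> \bar R}) (p : S * L) : R :=
  fine (nu (geoball p.1 p.2)) * v p.2.
have F0 nu p : 0 <= F nu p by apply: mulr_ge0 => //; exact: fine_ge0.
have iF nu : (sigma \x leb)%E.-integrable setT (EFin \o F nu).
  apply/integrableP; split.
    apply/measurable_EFinP; apply: measurable_funM; first exact: measurable_ball_measure.
    exact: (measurableT_comp mv measurable_snd).
  under eq_integral do rewrite /= ger0_norm//.
  by apply: integral_ball_measure_lty => //; rewrite mulr_gt0.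
have iFF := integrableD measurableT (iF (charge_pos mu)) (iF (charge_neg mu)).
have iC : (sigma \x leb)%E.-integrable setT (EFin \o (fun p =>
    K * s j ^+ 2 * (F (charge_pos mu) p + F (charge_neg mu) p))).
  exact: (integrableZl measurableT (K * s j ^+ 2) iFF).
have mhd : measurable_fun setT (fun p => h p * dens j p) by exact: measurable_funM.
apply: integrable_ball_space => //.
apply: (le_integrable measurableT _ _ iC).
  by apply/measurable_EFinP; exact: (measurableT_comp mhd (@measurable_ball_id R n)).
move=> p _ /=; rewrite lee_fin.
rewrite [leRHS]ger0_norm; last first.
  by apply: mulr_ge0; [apply: mulr_ge0 => //; exact: sqr_ge0|exact: addr_ge0].
rewrite normrM (ger0_norm (dens0 j p)) /h /ball_charge.
have [p0|p0] := ltP 0 p.2; last first.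
  rewrite /dens ltNge p0/= mulr0.
  by apply: mulr_ge0; [apply: mulr_ge0 => //; exact: sqr_ge0|exact: addr_ge0].
rewrite (ltW p0) fine_chargeE; last exact: measurable_geoball.
have [pb|bp] := leP p.2 (b * rho j); last first.
  rewrite /dens p0 fb ?mulr0; last by rewrite mulrC ler_pdivlMr// ltW.
  by apply: mulr_ge0; [apply: mulr_ge0 => //; exact: sqr_ge0|exact: addr_ge0].
have vE : v p.2 = w p.
  by rewrite /v indicE mem_set ?mulr1//= in_itv/= p0 pb.
have dle : dens j p <= K * s j ^+ 2 * v p.2.
  have := dens_le j p fK; rewrite ler_pdivrMr ?exprn_gt0//.
  by rewrite vE [in leRHS]mulrAC.
rewrite /F -mulrDl mulrCA.
apply: ler_pM => //.
rewrite (le_trans (ler_normB _ _))// !ger0_norm//; exact: fine_ge0.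
Qed.

Lemma integrable_ball_charge_sqr :
  M.-integrable setT (EFin \o (fun p => h p ^+ 2 * w p)) /\
  charge_integral2 mu mu (fun q => KH n H (geodist q.1 q.2)) =
  \int[M]_p (h p ^+ 2 * w p).
Proof.
have [i e] := charge_integral2E H0 Hn Mmu.
have mhw : measurable_fun setT (fun p => h p ^+ 2 * w p).
  by apply: measurable_funM => //; exact: measurable_funX.
split; first exact: integrable_ball_space.
by rewrite e Rintegral_ball_space.
Qed.

End one_charge.

Definition normalized_functional (j : nat) (mu : {charge set S -> \bar R})
    (x : Omega (rho j)) : R :=
  (ball_functional (N (rho j) x) mu
     - fine ('E_(P (rho j))[fun x' => ball_functional (N (rho j) x') mu])%E)
  / Num.sqrt (lambda (rho j) * rho j `^ (n%:R - 2 * H)).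
Local Notation Y := normalized_functional.

Let ball_functionalE (nu : {measure set (S * R) -> \bar R}) mu :
  ball_functional nu mu = \int[nu]_p ball_charge mu p.
Proof.
rewrite /ball_functional Rintegral_mkcond; apply: eq_Rintegral => p _.
rewrite patchE /ball_charge; case: ifPn => [/set_mem[_ /=]|h].
  by rewrite in_itv/= andbT => ->.
case: ifPn => // p0; case/negP : h; apply/mem_set; split => //=.
by rewrite in_itv/= p0.
Qed.

Let YE j mu x : Y mu x = (\int[N (rho j) x]_p ball_charge mu p -
  \int[P (rho j)]_x' (\int[N (rho j) x']_p ball_charge mu p)) / s j.
Proof.
rewrite /Y ball_functionalE expectation.unlock.
by under eq_integral do rewrite ball_functionalE.
Qed.

Lemma measurable_normalized_functional j mu : measurable_fun setT (@Y j mu).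
Proof.
have h := @measurable_poisson_limit _ _ _ _ _ (fun j => P (rho j))
  (fun j => N (rho j)) _ s _ (@integrable_ball_charge mu) j.
by apply: eq_measurable_fun h => x _; rewrite YE.
Qed.

Lemma normalized_functional_sqr mu : MH H mu -> exists C : R, forall j,
  (\int[P (rho j)]_x (@Y j mu x ^+ 2)%:E <= C%:E)%E.
Proof.
move=> Mmu; have [K K0 fK] := K_ex.
have [i2 _] := integrable_ball_charge_sqr Mmu.
eexists => j; under eq_integral do rewrite YE.
exact: (poisson_limit_sqr prm mdens dens0 mE
  (fun j p => dens_le j p fK) (@integrable_ball_charge mu) i2 j).
Qed.

Lemma normalized_functional_cos mu b : MH H mu ->
  \int[P (rho j)]_x cos (@Y j mu x + b) @[j --> \oo] -->
  expR (- (charge_integral2 mu mu (fun q => KH n H (geodist q.1 q.2)) / 2)) * cos b.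
Proof.
move=> Mmu; have [K K0 fK] := K_ex.
have [i2 ->] := integrable_ball_charge_sqr Mmu.
rewrite (_ : (fun j => _) = fun j => \int[P (rho j)]_x
    cos ((\int[N (rho j) x]_p ball_charge mu p -
  \int[P (rho j)]_x' (\int[N (rho j) x']_p ball_charge mu p)) / s j + b)).
  exact: (poisson_limit_cos prm mdens dens0 mE s0 sy mw
    (fun j p => dens_le j p fK) dens_cvg (@integrable_ball_charge mu) i2).
by apply/funext => j; apply: eq_Rintegral => x _; rewrite YE.
Qed.

(** Linearity holds only almost surely: it needs all the ball masses to be integrable for the
    realization [N (rho j) x]. *)
Lemma normalized_functional_linear j (k : nat) (a : 'I_k -> R)
    (mu : 'I_k -> {charge set S -> \bar R}) (nu : {charge set S -> \bar R}) :
  (forall A, measurable A -> fine (nu A) = \sum_i a i * fine (mu i A)) ->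
  {ae P (rho j), forall x, \sum_i a i * Y (mu i) x = Y nu x}.
Proof.
move=> nuE.
have hE p : ball_charge nu p = \sum_i a i * ball_charge (mu i) p.
  rewrite /ball_charge; case: ifPn => _; first exact/nuE/measurable_geoball.
  by rewrite big1// => i _; rewrite mulr0.
have im i := @integrable_ball_charge (mu i) j.
have ae_i : {ae P (rho j), forall x, forall i,
    (N (rho j) x).-integrable setT (EFin \o (ball_charge (mu i) : S * R -> R))}.
  apply: (@filter_forall _ 'I_k (fun i x => (N (rho j) x).-integrable setT
    (EFin \o (ball_charge (mu i) : S * R -> R)))) => i.
  by have := prm_integrable_ae (prm j) (im i).
apply: filterS ae_i => x ix; rewrite YE.
under eq_bigr do rewrite YE.
rewrite (prm_functional_mean (prm j) (@integrable_ball_charge nu j)).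
under eq_bigr do rewrite (prm_functional_mean (prm j) (im _)).
under [in RHS]eq_Rintegral do rewrite hE.
under [X in _ = (_ - X) / _]eq_Rintegral do rewrite hE.
rewrite !Rintegral_linear// -sumrB mulr_suml; apply: eq_bigr => i _.
by rewrite mulrA mulrBr.
Qed.

End sequence_limit.

(** * Finite-dimensional convergence as the scale tends to infinity *)

Theorem theorem2p3 (R : realType) (n : nat) (H : R) (f : R -> R)
    (lambda : R -> R)
    (d : R -> measure_display) (Omega : forall rho : R, measurableType (d rho))
    (P : forall rho : R, probability (Omega rho) R)
    (N : forall rho : R, R.-ker (Omega rho) ~> (sphere R n * R)%type)
    (d' : measure_display) (Omega' : measurableType d')
    (P' : probability Omega' R)
    (W : {charge set (sphere R n) -> \bar R} -> {RV P' >-> R}) :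
  (1 <= n)%N -> 0 < H -> 2 * H != n%:R ->
  assumptionA n H f ->
  (forall rho, 0 < rho -> 0 < lambda rho) ->
  lambda rho * rho `^ (n%:R - 2 * H) @[rho --> +oo] --> +oo ->
  (forall rho, 0 < rho ->
    poisson_random_measure (P rho) (N rho) (ball_intensity lambda f rho)) ->
  centered_gaussian_functional (MH H)
    (fun mu nu => charge_integral2 mu nu (fun p => KH n H (geodist p.1 p.2)))
    W ->
  cvg_fdd (MH H)
    P (fun rho mu w =>
         (ball_functional (N rho w) mu
            - fine ('E_(P rho)[fun w' => ball_functional (N rho w') mu])%E)
         / Num.sqrt (lambda rho * rho `^ (n%:R - 2 * H)))
    P' W.
Proof.
move=> _ H0 Hn Af lambda0 lambday prmN GW k mu k0 Mmu g cg [B gB].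
pose V i := charge_integral2 (mu i) (mu i) (fun p => KH n H (geodist p.1 p.2)).
pose Y rho nu x := (ball_functional (N rho x) nu
  - fine ('E_(P rho)[fun w' => ball_functional (N rho w') nu])%E)
  / Num.sqrt (lambda rho * rho `^ (n%:R - 2 * H)).
pose G rho : R := \int[P rho]_x g (\row_i Y rho (mu i) x).
pose G' : R := \int[P']_x g (\row_i W (mu i) x).
have mW i : measurable_fun setT (W (mu i)) by [].
(* Dominated convergence is sequential, so the limit is taken along positive sequences of scales. *)
have seqlim u : (forall j, 0 < u j) -> u j @[j --> \oo] --> +oo ->
    G (u j) @[j --> \oo] --> G'.
  move=> u0 uy.
  have mY j i : measurable_fun setT (Y (u j) (mu i)).
    exact: (@measurable_normalized_functional _ _ _ _ _ _ _ P N H0 Af lambda0 u u0 j).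
  have sqr i : exists C : R, forall j, (\int[P (u j)]_x (Y (u j) (mu i) x ^+ 2)%:E <= C%:E)%E.
    by have := @normalized_functional_sqr _ _ _ _ _ _ _ _ _ H0 Hn Af lambda0 prmN _ u0 _ (Mmu i).
  have [c cP] := choice sqr.
  have c0 i : 0 <= c i.
    rewrite -lee_fin; apply: le_trans (cP i 0).
    by apply: integral_ge0 => x _; rewrite lee_fin sqr_ge0.
  have V0 i : 0 <= V i.
    rewrite -lee_fin -(gaussian_functional_moments GW (Mmu i)).2.
    by apply: integral_ge0 => x _; rewrite lee_fin sqr_ge0.
  (* [levy_cvg] takes a single constant; the sum dominates every second moment, before and at the
     limit, since all terms are nonnegative. *)
  have le_sum i : c i <= \sum_i (c i + V i) /\ V i <= \sum_i (c i + V i).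
    rewrite (bigD1 i)//=.
    have : 0 <= \sum_(j < k | j != i) (c j + V j) by apply: sumr_ge0 => j _; exact: addr_ge0.
    by have := c0 i; have := V0 i; split; lra.
  apply: (@levy_cvg R k (fun j => d (u j)) (fun j => Omega (u j)) (fun j => P (u j))
    (fun j i => Y (u j) (mu i)) d' Omega' P' (fun i => W (mu i))
    (\sum_i (c i + V i)) _ _ _ _ _ g B) => //.
  - move=> j i; apply: (le_trans (cP i j)); rewrite lee_fin; exact: (le_sum i).1.
  - move=> i; rewrite (gaussian_functional_moments GW (Mmu i)).2 lee_fin.
    exact: (le_sum i).2.
  move=> a b.
  (* The Cramer-Wold device: a linear combination of the coordinates is, almost surely on both
     sides, the functional at the single charge [nu]. *)
  have [nu [Mnu nuE Wnu]] := charge_combination GW a k0 Mmu.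
  have -> : \int[P']_w cos (\sum_i a i * W (mu i) w + b) =
      \int[P']_w cos (W nu w + b).
    apply: ae_eq_Rintegral.
    - apply: (measurableT_comp (@measurable_cos R)); apply: measurable_funD => //.
      by apply: measurable_sum => i; exact: measurable_funM.
    - apply: (measurableT_comp (@measurable_cos R)); exact: measurable_funD.
    - by apply: filterS Wnu => w ->.
  rewrite (gaussian_functional_moments GW Mnu).1.
  rewrite (_ : (fun j => _) = fun j => \int[P (u j)]_w cos (Y (u j) nu w + b)).
    by have := @normalized_functional_cos _ _ _ _ _ _ _ _ _ H0 Hn Af lambda0 lambday prmN _ u0 uy _ b Mnu.
  apply/funext => j; apply: ae_eq_Rintegral.
  - apply: (measurableT_comp (@measurable_cos R)); apply: measurable_funD => //.
    by apply: measurable_sum => i; exact: measurable_funM.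
  - apply: (measurableT_comp (@measurable_cos R)); apply: measurable_funD => //.
    exact: (@measurable_normalized_functional _ _ _ _ _ _ _ P N H0 Af lambda0 u u0 j).
  - have := @normalized_functional_linear _ _ _ _ _ _ _ _ _ H0 Af lambda0 prmN _ u0 j _ _ _ _ nuE.
    by apply: filterS => w; rewrite /normalized_functional => ->.
have GE rho : 0 < rho -> ('E_(P rho)[fun w => g (\row_i Y rho (mu i) w)] = (G rho)%:E)%E.
  move=> r0; rewrite expectation.unlock /G EFin_Rintegral//.
  apply: (@bounded_integrable _ _ _ _ (fun w => g (\row_i Y rho (mu i) w)) B) => //.
  apply: (measurable_continuous_row _ cg gB) => i.
  exact: (@measurable_normalized_functional _ _ _ _ _ _ _ P N H0 Af lambda0
    (fun=> rho) (fun=> r0) 0).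
have GE' : ('E_P'[fun w => g (\row_i W (mu i) w)] = G'%:E)%E.
  rewrite expectation.unlock /G' EFin_Rintegral//.
  apply: (@bounded_integrable _ _ _ _ (fun w => g (\row_i W (mu i) w)) B) => //.
  exact: (measurable_continuous_row _ cg gB).
have Glim : G rho @[rho --> +oo] --> G'.
  apply/cvg_pinftyP => u uy.
  (* A sequence tending to [+oo] is eventually positive; replacing its other terms by 1 leaves the
     limits unchanged. *)
  pose v j := if 0 < u j then u j else 1.
  have v0 j : 0 < v j by rewrite /v; case: ifP.
  have uv : \forall j \near \oo, v j = u j.
    have /cvgryPgt/(_ 0) := uy; apply: filterS => j uj.
    by rewrite /v uj.
  have vy : v j @[j --> \oo] --> +oo.
    apply: cvg_trans uy; apply: near_eq_cvg.
    by apply: filterS uv => j ->.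
  apply: cvg_trans (seqlim v v0 vy); apply: near_eq_cvg.
  by apply: filterS uv => j ->.
rewrite GE'; apply: cvg_EFin.
  (* Measurability, hence the finite expectation, is known for positive [rho] only, which is enough
     near [+oo]. *)
  by exists 0; split => // rho r0; rewrite GE.
apply: cvg_trans Glim; apply: near_eq_cvg.
by exists 0; split => // rho r0; rewrite /= GE.
Qed.
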